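(* Assume the standing setting with $\rho_n\in(0,1)$ for all $n$, and assume $1-F(1-t^{-1})\in 2RV_{-\alpha,\tau}$ with $\alpha>0$, $\tau\le 0$ and auxiliary function $A$. Let $\lambda\in(0,\infty)$ and suppose there is a sequence $c_n\to 0$ ($c_n\neq 0$) such that, with $\lambda_n=\left(\frac{1-\rho_n}{2a_n}\right)^{1/2}$, $$\lim_{n\to\infty}\frac{\lambda_n-\lambda}{c_n}=\gamma\in\mathbb{R}.$$ Fix $x<0$, $y<0$ with $\lambda^2+x+y+\frac{(x-y)^2}{4\lambda^2}<0$. Then, as $n\to\infty$, $$\mathbb{P}(M_{n1}\le 1+a_nx,\ M_{n2}\le 1+a_ny)-H_{\alpha+\frac12,\lambda}(x,y)=H_{\alpha+\frac12,\lambda}(x,y)\Big\{-\tfrac12 n^{-1}\big(|x|^{\alpha+\frac12}\psi_\alpha(z_x)+|y|^{\alpha+\frac12}\psi_\alpha(z_y)\big)^2+Q_n(x,y)+o\big(a_n+c_n+|A(a_n^{-1})|+n^{-1}\big)\Big\},$$ where $$Q_n(x,y)=|x|^{\alpha+\frac12}\Big\{-\frac{a_n|x|}{c_\alpha}\int_{-1}^{z_x}(1-s^2)^{\alpha-1}s^2\big(\alpha+1-\tfrac32\alpha s^2-s^2\big)ds-\frac{A(a_n^{-1})|x|^{-\tau}}{c_\alpha}\int_{-1}^{z_x}(1-s^2)^\alpha\frac{(1-s^2)^{-\tau}-1}{\tau}ds$$ $$+\psi_\alpha(z_x)\Big(-A(a_n^{-1})\frac{|x|^{-\tau}-1}{\tau}+\frac{a_n}{c_\alpha}I_1+\frac{A(a_n^{-1})}{c_\alpha}I_2\Big)-\frac{(1-z_x^2)^\alpha}{c_\alpha\sqrt{2|x|}}\Big(c_n\gamma\Big(1-\frac{y-x}{2\lambda^2}\Big)-\frac{a_n}{2}\Big(\lambda(y-x)+\frac{x(y-x)}{\lambda}+\frac{3(y-x)^2}{4\lambda}+\frac{(y-x)^3}{8\lambda^3}\Big)\Big)\Big\}$$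 $$+|y|^{\alpha+\frac12}\Big\{-\frac{a_n|y|}{c_\alpha}\int_{-1}^{z_y}(1-s^2)^{\alpha-1}s^2\big(\alpha+1-\tfrac32\alpha s^2-s^2\big)ds-\frac{A(a_n^{-1})|y|^{-\tau}}{c_\alpha}\int_{-1}^{z_y}(1-s^2)^\alpha\frac{(1-s^2)^{-\tau}-1}{\tau}ds$$ $$+\psi_\alpha(z_y)\Big(-A(a_n^{-1})\frac{|y|^{-\tau}-1}{\tau}+\frac{a_n}{c_\alpha}I_1+\frac{A(a_n^{-1})}{c_\alpha}I_2\Big)-\frac{(1-z_y^2)^\alpha}{c_\alpha\sqrt{2|y|}}\Big(c_n\gamma\Big(1-\frac{x-y}{2\lambda^2}\Big)+\frac{a_n}{2}\Big(\lambda(y-x)+\frac{x(y-x)}{\lambda}+\frac{(y-x)^2}{4\lambda}+\frac{(y-x)^3}{8\lambda^3}\Big)\Big)\Big\},$$ with $I_1=\int_{-1}^1(1-s^2)^{\alpha-1}s^2(\alpha+1-\frac32\alpha s^2-s^2)ds$ and $I_2=\int_{-1}^1\frac{(1-s^2)^{\alpha-\tau}-(1-s^2)^\alpha}{\tau}ds$.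
   Context: Standing setting: Let $(S_1,S_2)$ be a bivariate spherical random vector (i.e. $(S_1,S_2)\overset{d}{=}R(\cos\Theta,\sin\Theta)$ with $\Theta$ uniform on $[0,2\pi)$ independent of $R$), whose radius $R=\sqrt{S_1^2+S_2^2}$ is almost surely positive with distribution function $F$ having upper endpoint $\sup\{t:F(t)<1\}=1$. Let $G$ be the distribution function of $S_1$ (upper endpoint 1), $G^{\leftarrow}$ its generalized inverse, and $a_n=1-G^{\leftarrow}(1-n^{-1})$. Given $\rho_n\in[-1,1]$, let $\{(\xi_{ni},\eta_{ni}),1\le i\le n,n\ge1\}$ be a triangular array such that for each $n$ the vectors $(\xi_{ni},\eta_{ni})$, $1\le i\le n$, are independent with $(\xi_{ni},\eta_{ni})\overset{d}{=}(S_1,\rho_nS_1+\sqrt{1-\rho_n^2}\,S_2)$; $M_{n1}=\max_{1\le i\le n}\xi_{ni}$, $M_{n2}=\max_{1\le i\le n}\eta_{ni}$. Second-order regular variation: $1-F(1-t^{-1})\in 2RV_{-\alpha,\tau}$ with auxiliary function $A$ means $A$ is eventually of constant sign, $A(t)\to0$ as $t\to\infty$, and for every $s>0$, $\lim_{t\to\infty}\frac{\frac{1-F(1-(ts)^{-1})}{1-F(1-t^{-1})}-s^{-\alpha}}{A(t)}=s^{-\alpha}\frac{s^\tau-1}{\tau}$. Throughout, $\frac{u^\tau-1}{\tau}$ is read as $\log u$ when $\tau=0$; correspondingly expressions like $\frac{|x|^{-\tau}-1}{\tau}$, $\frac{(1-s)^{-\tau}-1}{\tau}$, $\frac{(1-s)^{\alpha-\tau}-(1-s)^\alpha}{\tau}$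 are read as $-\log|x|$, $-\log(1-s)$, $-(1-s)^\alpha\log(1-s)$ when $\tau=0$. Notation: $c_\alpha=\int_0^1(1-s)^\alpha s^{-1/2}ds=\frac{\Gamma(\alpha+1)\sqrt\pi}{\Gamma(\alpha+3/2)}$; $\psi_\alpha(z)=c_\alpha^{-1}\int_{-1}^z(1-s^2)^\alpha ds$ for $z\in[-1,1]$, $\psi_\alpha(z)=0$ for $z<-1$ and $\psi_\alpha(z)=1$ for $z>1$. For $\lambda\in(0,\infty)$ and $x,y<0$: $z_x=\frac{\lambda+\frac{y-x}{2\lambda}}{\sqrt{2|x|}}$, $z_y=\frac{\lambda+\frac{x-y}{2\lambda}}{\sqrt{2|y|}}$, and $H_{\alpha+\frac12,\lambda}(x,y)=\exp\big(-|x|^{\alpha+\frac12}\psi_\alpha(z_x)-|y|^{\alpha+\frac12}\psi_\alpha(z_y)\big)$. An $o(r_n)$ term denotes a sequence whose ratio to $r_n$ tends to $0$ as $n\to\infty$.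
   Formalization: The remainder is proved to be o(a_n + |c_n| + |A(1/a_n)| + 1/n), with |c_n| in place of c_n, because for negative c_n the rate as written can vanish identically, e.g. when c_n = -(a_n + |A(1/a_n)| + 1/n). *)

(* Defs.v *)
From HB Require Import structures.
From mathcomp Require Import all_boot all_order all_algebra.
From mathcomp Require Import all_classical all_reals all_analysis.
Set Implicit Arguments. Unset Strict Implicit. Unset Printing Implicit Defensive.
Import Order.TTheory GRing.Theory Num.Theory.
Import numFieldNormedType.Exports.
Local Open Scope classical_set_scope.
Local Open Scope ring_scope.

Section Defs.
Variable R : realType.

Definition hpow (tau u : R) : R :=
  if tau == 0 then ln u else (u `^ tau - 1) / tau.

Definition qneg (tau u : R) : R :=
  if tau == 0 then - ln u else (u `^ (- tau) - 1) / tau.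

Definition twoRV (Fb : R -> R) (alpha tau : R) (A : R -> R) : Prop :=
  (exists t0 : R, (forall t, t0 <= t -> 0 < A t) \/ (forall t, t0 <= t -> A t < 0))
  /\ (A t @[t --> +oo] --> 0)
  /\ (forall s : R, 0 < s ->
        ((Fb (t * s) / Fb t - s `^ (- alpha)) / A t) @[t --> +oo] -->
          s `^ (- alpha) * hpow tau s).

Definition ginv (G : R -> R) (p : R) : R := inf [set x : R | p <= G x].

Definition a_seq (G : R -> R) (n : nat) : R := 1 - ginv G (1 - n%:R^-1).

Definition Rint (lo hi : R) (f : R -> R) : R :=
  Rintegral (@lebesgue_measure R) `[lo, hi] f.

Definition c_alpha (alpha : R) : R :=
  Rint 0 1 (fun s => (1 - s) `^ alpha * s `^ (- (2^-1))).

Definition psi (alpha z : R) : R :=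
  if z < -1 then 0 else if 1 < z then 1
  else (c_alpha alpha)^-1 * Rint (-1) z (fun s => (1 - s ^+ 2) `^ alpha).

Definition zx (lam x y : R) : R := (lam + (y - x) / (2 * lam)) / Num.sqrt (2 * `|x|).
Definition zy (lam x y : R) : R := (lam + (x - y) / (2 * lam)) / Num.sqrt (2 * `|y|).

Definition H (alpha lam x y : R) : R :=
  expR (- (`|x| `^ (alpha + 2^-1)) * psi alpha (zx lam x y)
        - (`|y| `^ (alpha + 2^-1)) * psi alpha (zy lam x y)).

Definition J1 (alpha z : R) : R :=
  Rint (-1) z (fun s => (1 - s ^+ 2) `^ (alpha - 1) * s ^+ 2 *
                        (alpha + 1 - 3 / 2 * alpha * s ^+ 2 - s ^+ 2)).

Definition J2 (alpha tau z : R) : R :=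
  Rint (-1) z (fun s => (1 - s ^+ 2) `^ alpha * qneg tau (1 - s ^+ 2)).

Definition I1 (alpha : R) : R := J1 alpha 1.

Definition I2 (alpha tau : R) : R :=
  Rint (-1) 1 (fun s => if tau == 0 then - ((1 - s ^+ 2) `^ alpha * ln (1 - s ^+ 2))
                        else ((1 - s ^+ 2) `^ (alpha - tau) - (1 - s ^+ 2) `^ alpha) / tau).

(* Q_n(x,y), with an = a_n, Aa = A(a_n^{-1}), cn = c_n *)
Definition Qn (alpha tau lam gam an Aa cn x y : R) : R :=
  let ca := c_alpha alpha in
  let zX := zx lam x y in let zY := zy lam x y in
  `|x| `^ (alpha + 2^-1) *
    (- (an * `|x|) / ca * J1 alpha zX
     - Aa * `|x| `^ (- tau) / ca * J2 alpha tau zX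
     + psi alpha zX * (- Aa * qneg tau `|x| + an / ca * I1 alpha + Aa / ca * I2 alpha tau)
     - (1 - zX ^+ 2) `^ alpha / (ca * Num.sqrt (2 * `|x|)) *
       (cn * gam * (1 - (y - x) / (2 * lam ^+ 2))
        - an / 2 * (lam * (y - x) + x * (y - x) / lam + 3 * (y - x) ^+ 2 / (4 * lam)
                    + (y - x) ^+ 3 / (8 * lam ^+ 3))))
  + `|y| `^ (alpha + 2^-1) *
    (- (an * `|y|) / ca * J1 alpha zY
     - Aa * `|y| `^ (- tau) / ca * J2 alpha tau zY
     + psi alpha zY * (- Aa * qneg tau `|y| + an / ca * I1 alpha + Aa / ca * I2 alpha tau)
     - (1 - zY ^+ 2) `^ alpha / (ca * Num.sqrt (2 * `|y|)) *
       (cn * gam * (1 - (x - y) / (2 * lam ^+ 2))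
        + an / 2 * (lam * (y - x) + x * (y - x) / lam + (y - x) ^+ 2 / (4 * lam)
                    + (y - x) ^+ 3 / (8 * lam ^+ 3)))).

(* maximum of the first n entries f 0, ..., f (n-1) (n >= 1) *)
Definition maxn_seq (f : nat -> R) (n : nat) : R :=
  \big[Num.max/f 0%N]_(i < n) f i.

End Defs.

Definition indep_vecs {R : realType} {d} {T : measurableType d} (P : probability T R)
  (n : nat) (V : nat -> T -> R * R) : Prop :=
  forall B : nat -> set (R * R), (forall i, measurable (B i)) ->
    P (\bigcap_(i in [set i | (i < n)%N]) (V i @^-1` B i))
    = (\prod_(i < n) P (V i @^-1` B i))%E.

(* Main.v *)
(* Let Phi w = 1 - F (1 - w) be the tail of the radius at its endpoint. The event that S1 > 1 - wx
   or rho S1 + sqrt (1 - rho^2) S2 > 1 - wy is a union of two half-planes whose boundary lines cross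
   on a single ray, so in polar coordinates its probability is a sum of two integrals over adjacent
   arcs, one for each half-plane. On the arc of the line at distance 1 - w the substitution
   1 / cos t = 1 + q s^2 with q = w / (1 - w) turns the integral into
   sqrt (2 q) times the integral of Phi (w (1 - s^2)) k (s) over [-1, s0], where
   k (s) = 1 - 5/4 w s^2 + O(w^2). Second-order regular variation, in the uniform form
   |Phi (w h) / Phi w - h^alpha| <= C |A (1 / w)| for 0 < h <= 1, allows passing to the limit under
   the integral. The full arc s0 = 1 gives P(S1 > 1 - w), which is 1/n at w = a_n; hence n times the
   exceedance probability is a quotient of two such expansions and the unknown factor Phi (a_n)
   cancels. Expanding the crossing point s0 in a_n and lambda_n - lambda, then
   (1 - B / n)^n = exp (- B - B^2 / (2 n) + o(1 / n)), gives the claim. *)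

Require Import Defs.
From HB Require Import structures.
From mathcomp Require Import all_boot all_order all_algebra.
From mathcomp Require Import all_classical all_reals all_analysis.
From mathcomp Require Import measurable_realfun ring lra.
Set Implicit Arguments. Unset Strict Implicit. Unset Printing Implicit Defensive.
Import Order.TTheory GRing.Theory Num.Theory.
Import numFieldNormedType.Exports.
Local Open Scope classical_set_scope.
Local Open Scope ring_scope.

(** * Regular variation with a second-order bound *)

(** Regular variation is assumed pointwise in s, and nothing is known about the measurability of
    [A], so uniformity has to be earned. [A] is replaced by the deviation over the single step e,
    which is built from the monotone [Fb] and has the same order. An overlap argument for sets of
    large measure bounds it over short steps, and each further step e gains a factor close to exp
    (tau - alpha) < 1, which lets one constant serve all s >= 1. Every quantity in the limit is
    carried as a value plus a first-order part, up to o(r) with r n = a_n + |c_n| + |A (1 / a_n)| +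
    1 / n. Products of two first-order parts are o(r), so these pairs obey the rules of differential
    calculus, and the theorem reduces to an identity between first-order parts. In that identity the
    integrals with exponent alpha - 1 come from integration by parts; their boundary term is
    supplied by a part of the shift of s0 that is proportional to a_n. *)

Lemma lebesgue_measure_translate (R : realType) (A : set R) (c : R) : measurable A ->
  lebesgue_measure ((fun t : R => t + c) @^-1` A) = lebesgue_measure A.
Proof.
move=> mA.
have mf : measurable_fun setT ((fun t : R => t + c) : measurableTypeR R -> measurableTypeR R).
  by apply: measurable_funD => //; exact: measurable_cst.
have -> : lebesgue_measure ((fun t : R => t + c) @^-1` A) =
   pushforward (@lebesgue_measure R) ((fun t : R => t + c) : measurableTypeR R -> measurableTypeR R) A by [].
apply/esym/lebesgue_measure_unique => //= _ [[a b]] _ <-.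
rewrite /pushforward.
have -> : (fun t : R => t + c) @^-1` `]a, b] = `]a - c, b - c]%classic.
  by apply/seteqP; split => t /=; rewrite !in_itv/= ltrBlDr lerBrDr.
rewrite /= !lebesgue_measure_itv/= !lte_fin ltrD2r; case: ifP => // _.
by rewrite -!EFinB; congr (_%:E); ring.
Qed.

Definition bounded_points {R : realType} (p : nat -> R -> R) (m : nat) : set R :=
  `[1, 3] `&` \bigcap_n [set t : R | `|p n t| <= m%:R].

Lemma measurable_bounded_points (R : realType) (p : nat -> R -> R) m :
  (forall n, measurable_fun setT (p n)) -> measurable (bounded_points p m).
Proof.
move=> mp; apply: measurableI => //; apply: bigcapT_measurable => n.
rewrite [X in measurable X](_ : _ = setT `&` (Num.norm \o p n) @^-1` `]-oo, m%:R]); last first.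
  by apply/seteqP; split => t /=; rewrite in_itv/=; [move=> ?; split|case].
have mn : measurable_fun setT (Num.norm \o p n) by apply: measurableT_comp.
exact: mn.
Qed.

(** The sets [bounded_points p m] increase to [1, 3], so their measures tend to 2. The threshold 3/2
    is half the length of [1, 4], the interval that still contains a translate by at most 1. *)
Lemma exists_large_bounded_set (R : realType) (p : nat -> R -> R) :
  (forall n, measurable_fun setT (p n)) ->
  (forall t, 1 <= t <= 3 -> exists M : R, forall n, `|p n t| <= M) ->
  \forall m \near \oo,
    ((3 / 2)%:E < lebesgue_measure (bounded_points p m))%E.
Proof.
move=> mp bp.
pose V := bounded_points p.
have mV m : measurable (V m) by exact: measurable_bounded_points.
have UV : \bigcup_m V m = `[1, 3]%classic.
  apply/seteqP; split => [t [m _ []] //|t /= t13].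
  have := t13; rewrite in_itv/= => /bp[M hM].
  exists (Num.truncn `|M|).+1 => //; split => // n _ /=.
  apply: le_trans (hM n) _; apply: le_trans (ler_norm _) _.
  exact/ltW/truncnS_gt.
have mUV : measurable (\bigcup_m V m) by rewrite UV.
have ndV : {homo V : n m / (n <= m)%N >-> (n <= m)%O}.
  move=> n m nm; apply/subsetPset => t [t13 h]; split => // k _.
  by apply: le_trans (h k I) _; rewrite ler_nat.
have : (lebesgue_measure \o V) m @[m --> \oo] --> lebesgue_measure (`[1, 3]%classic : set R).
  by rewrite -UV; exact: nondecreasing_cvg_mu.
rewrite lebesgue_measure_itv/= lte_fin (_ : (1 < 3 :> R)); last by lra.
move=> /fine_cvgP[hf hc].
have /cvgr_gt/(_ (3/2)) := hc.
rewrite (_ : (3 / 2 < 3 - 1 :> R)); last by lra.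
move=> /(_ isT) hg; near=> m.
have fm : lebesgue_measure (V m) \is a fin_num by near: m.
rewrite -(fineK fm) lte_fin.
by near: m.
Unshelve. all: by end_near. Qed.

(* Two subsets of [1, 3] of measure greater than 3/2 still meet after a translation by at most 1;
   this gives local uniformity for limits that are only assumed pointwise. *)
Lemma common_bounded_point (R : realType) (p q : nat -> R -> R) (v : nat -> R) :
  (forall n, measurable_fun setT (p n)) -> (forall n, measurable_fun setT (q n)) ->
  (forall t, 1 <= t <= 3 -> exists M : R, forall n, `|p n t| <= M) ->
  (forall t, 1 <= t <= 3 -> exists M : R, forall n, `|q n t| <= M) ->
  (forall n, 0 <= v n <= 1) ->
  exists M : R, 0 < M /\ forall n, exists t, 1 <= t - v n <= 3 /\ `|p n t| <= M /\ `|q n (t - v n)| <= M.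
Proof.
move=> mp mq bp bq v01.
have [m _ hm] := filterI (exists_large_bounded_set mp bp) (exists_large_bounded_set mq bq).
have [hV hW] := hm m.+1 (leqnSn m).
set V := bounded_points p _ in hV; set W := bounded_points q _ in hW.
have mV : measurable V by exact: measurable_bounded_points.
have mW : measurable W by exact: measurable_bounded_points.
exists m.+1%:R; split; first by rewrite ltr0n.
move=> n; apply: contrapT => hN.
pose W' := (fun t : R => t + - v n) @^-1` W.
have mW' : measurable W'.
  have mf : measurable_fun setT (fun t : R => t + - v n).
    by apply: measurable_funD => //; exact: measurable_cst.
  by rewrite -[X in measurable X]setTI; exact: mf.
have W'E : lebesgue_measure W' = lebesgue_measure W by exact: lebesgue_measure_translate.
have VW0 : V `&` W' = set0.
  rewrite -subset0 => t [[tI tV] [tJ tW]]; apply: hN; exists t.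
  move: tJ; rewrite /= in_itv/= => tJ; split; first exact: tJ.
  by split; [exact: tV|exact: tW].
have sub : V `|` W' `<=` `[1%R, 4%R].
  have /andP[v0 v1] := v01 n.
  move=> t [[+ _]|[+ _]]; rewrite /= !in_itv/= => /andP[h1 h2]; lra.
have : (lebesgue_measure (V `|` W') <= lebesgue_measure (`[1%R, 4%R] : set R))%E.
  by apply: le_measure => //; rewrite inE//; apply: measurableU.
have -> : lebesgue_measure (V `|` W') = (lebesgue_measure V + lebesgue_measure W)%E.
  by rewrite -W'E; exact: measureU.
rewrite lebesgue_measure_itv/= lte_fin (_ : (1 < 4 :> R)); last by lra.
apply/negP; rewrite -ltNge.
have -> : (4%:E - 1%:E = (3/2)%:E + (3/2)%:E :> \bar R)%E.
  by rewrite -EFinB -EFinD; congr (_%:E); lra.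
by apply: lteD.
Qed.

Lemma cvg_seq_bound (R : realType) (u : nat -> R) (l : R) :
  u n @[n --> \oo] --> l -> exists M : R, forall n, `|u n| <= M.
Proof.
move=> ul; have [M [_ hM]] := cvg_seq_bounded (cvgP _ ul).
by exists (M + 1) => n; apply: hM => //; rewrite ltrDl.
Qed.

Lemma near_eq_cvgR (R : realType) (T : Type) (F : set_system T) (FF : Filter F)
  (f g : T -> R) (l : R) :
  (\forall x \near F, f x = g x) -> f x @[x --> F] --> l -> g x @[x --> F] --> l.
Proof.
move=> fg fl; apply: cvg_trans fl; apply: near_eq_cvg.
by near=> x; near: x; apply: filterS fg => x ->.
Unshelve. all: by end_near. Qed.

Lemma measurable_fun_inv (R : realType) d (T : measurableType d) (f : T -> R) (D : set T) :
  measurable_fun D f -> measurable_fun D (fun x => (f x)^-1).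
Proof.
move=> mf.
(* Squaring makes the base nonnegative, so that [powR] with exponent -1 is the inverse; at a zero of
   [f] both sides are 0. *)
have -> : (fun x => (f x)^-1) = (fun x => f x * (f x ^+ 2) `^ (-1)).
  apply/funext => x; rewrite powR_inv1 ?sqr_ge0// expr2.
  by have [->|fx0] := eqVneq (f x) 0; [rewrite invr0 mul0r|field].
apply: measurable_funM => //.
have mp := @measurable_powR R (-1).
by apply: (measurableT_comp mp); exact: measurable_funX.
Qed.

Section limits_of_real_functions.
Context {R : realType} {T : Type} {F : set_system T} {FF : Filter F}.
Implicit Types (f g : T -> R) (a b : R).

Lemma limD f g a b : f x @[x --> F] --> a -> g x @[x --> F] --> b ->
  f x + g x @[x --> F] --> a + b.
Proof. exact: cvgD. Qed.

Lemma limB f g a b : f x @[x --> F] --> a -> g x @[x --> F] --> b ->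
  f x - g x @[x --> F] --> a - b.
Proof. exact: cvgB. Qed.

Lemma limM f g a b : f x @[x --> F] --> a -> g x @[x --> F] --> b ->
  f x * g x @[x --> F] --> a * b.
Proof. exact: cvgM. Qed.

Lemma limMl c f a : f x @[x --> F] --> a -> c * f x @[x --> F] --> c * a.
Proof. by move=> h; apply: limM => //; exact: cvg_cst. Qed.

Lemma limV f a : a != 0 -> f x @[x --> F] --> a -> (f x)^-1 @[x --> F] --> a^-1.
Proof. exact: cvgV. Qed.

End limits_of_real_functions.

Section second_order_regular_variation.
Variables (R : realType) (Fb A : R -> R) (alpha tau : R).
Hypothesis Fb_gt0 : forall t, 0 < t -> 0 < Fb t.
Hypothesis Fb_nincr : forall s t, 0 < s -> s <= t -> Fb t <= Fb s.
Hypothesis alpha_gt0 : 0 < alpha.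
Hypothesis tau_le0 : tau <= 0.
Hypothesis FbA : twoRV Fb alpha tau A.

Let E (t s : R) := Fb (t * s) / Fb t - s `^ (- alpha).

(** Cocycle identity: the step s * s' from [t] is the step s followed by the step s' from t * s.
    Bounds on long steps are chained from short ones through it. *)
Let E_mul t s s' : 0 < t -> 0 < s -> 0 < s' ->
  E t (s * s') = Fb (t * s) / Fb t * E (t * s) s' + s' `^ (- alpha) * E t s.
Proof.
move=> t0 s0 s'0; rewrite /E mulrA powRM ?ltW//.
have h1 : Fb t != 0 by rewrite gt_eqF ?Fb_gt0.
have h2 : Fb (t * s) != 0 by rewrite gt_eqF ?Fb_gt0 ?mulr_gt0.
by field; rewrite h1 h2.
Qed.

Let A_neq0 : \forall t \near +oo, A t != 0.
Proof.
have [[t0 H] _] := FbA.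
near=> t; have tt0 : t0 <= t by near: t; exact: nbhs_pinfty_ge (num_real _).
case: H => H.
  by rewrite gt_eqF ?H.
by rewrite lt_eqF ?H.
Unshelve. all: by end_near. Qed.

Let mulr_cvgy s : 0 < s -> (t * s : R) @[t --> +oo%R] --> +oo%R.
Proof.
move=> s0; apply/cvgryPge => M; near=> t.
by rewrite -ler_pdivrMr//; near: t; exact: nbhs_pinfty_ge (num_real _).
Unshelve. all: by end_near. Qed.

(** The step e can serve as a yardstick for [A] only because its second-order limit does not
    vanish. *)
Let hpow_expR1_neq0 : hpow tau (expR 1) != 0.
Proof.
rewrite /hpow; case: (tau =P 0) => [_|/eqP t0]; first by rewrite expRK oner_neq0.
rewrite mulf_neq0 ?invr_neq0// subr_eq0 -expRM mul1r.
by apply: contraNneq t0 => /(congr1 (@ln R)); rewrite expRK ln1 => ->.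
Qed.

Let hpow_mul s s' : 0 < s -> 0 < s' ->
  hpow tau (s * s') - hpow tau s = s `^ tau * hpow tau s'.
Proof.
move=> s0 s'0; rewrite /hpow; case: (tau =P 0) => [->|/eqP t0].
  by rewrite lnM ?posrE// powRr0 mul1r addrAC subrr add0r.
by rewrite powRM ?ltW//; field.
Qed.

Let ratio_cvg s : 0 < s -> Fb (t * s) / Fb t @[t --> +oo] --> s `^ (- alpha).
Proof.
move=> s0; have [_ [A0 H]] := FbA.
pose proof (limD (limM (H s s0) A0) (cvg_cst (s `^ (- alpha)))) as h.
rewrite mulr0 add0r in h.
apply: near_eq_cvgR h; near=> t.
by rewrite /= divfK ?subrK//; near: t.
Unshelve. all: by end_near. Qed.

(** By the cocycle identity the deviation over e from t * s, weighted by Fb (t * s) / Fb t, is a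
    combination of two deviations from [t]. Dividing it once by A t and once by A (t * s) gives two
    quantities with known nonzero limits, whose quotient is A (t * s) / A t. *)
Lemma auxiliary_ratio_cvg s : 0 < s -> A (t * s) / A t @[t --> +oo] --> s `^ tau.
Proof.
move=> s0; have [_ [_ H]] := FbA.
have e0 : 0 < expR 1 :> R by exact: expR_gt0.
have k0 := hpow_expR1_neq0.
have s1 : s `^ (- alpha) != 0 by rewrite gt_eqF ?powR_gt0.
have e1 : (expR 1 : R) `^ (- alpha) != 0 by rewrite gt_eqF ?powR_gt0.
have H1 : E (t * s) (expR 1) / A (t * s) @[t --> +oo] -->
    (expR 1 : R) `^ (- alpha) * hpow tau (expR 1).
  exact: (cvg_comp _ _ (mulr_cvgy s0) (H (expR 1) e0)).
pose proof (limM (ratio_cvg s0) H1) as H2.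
pose proof (limB (H (s * expR 1) (mulr_gt0 s0 e0))
  (limMl (c := expR 1 `^ (- alpha)) (H s s0))) as H3.
have d0 : s `^ (- alpha) * (expR 1 `^ (- alpha) * hpow tau (expR 1)) != 0.
  by rewrite !mulf_neq0.
pose proof (limM H3 (limV d0 H2)) as H4.
have -> : s `^ tau = ((s * expR 1) `^ (- alpha) * hpow tau (s * expR 1) -
  expR 1 `^ (- alpha) * (s `^ (- alpha) * hpow tau s)) /
  (s `^ (- alpha) * (expR 1 `^ (- alpha) * hpow tau (expR 1))).
  rewrite powRM ?expR_ge0 ?ltW// -[hpow tau (s * _)](subrK (hpow tau s)) hpow_mul//.
  by field; rewrite k0 s1 e1.
apply: near_eq_cvgR H4; near=> t => /=.
have t0 : 0 < t by near: t; exact: nbhs_pinfty_gt (num_real _).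
have At0 : A t != 0 by near: t.
have Ats0 : A (t * s) != 0 by near: t; exact: (mulr_cvgy s0 A_neq0).
have h : E (t * s) (expR 1) / A (t * s) != 0.
  near: t; apply: (H1 [set x : R | x != 0]).
  by apply: open_nbhs_nbhs; split; [exact: open_neq|rewrite /= mulf_neq0].
have E0 : E (t * s) (expR 1) != 0 by apply: contraNneq h => ->; rewrite mul0r.
have f1 : Fb t != 0 by rewrite gt_eqF ?Fb_gt0.
have f2 : Fb (t * s) != 0 by rewrite gt_eqF ?Fb_gt0 ?mulr_gt0.
rewrite -/(E t (s * expR 1)) -/(E t s) -/(E (t * s) (expR 1)) E_mul//.
by field; rewrite f1 f2 At0 Ats0 E0.
Unshelve. all: by end_near. Qed.

Let c1 : R := (expR 1 : R) `^ (- alpha) * hpow tau (expR 1).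

Let c1_neq0 : c1 != 0.
Proof. by rewrite mulf_neq0// gt_eqF ?powR_gt0 ?expR_gt0. Qed.

(* [E t e] is comparable to [A t] and, unlike [A], depends measurably on [t] *)
Let B (t : R) := E t (expR 1).

Let BA_cvg : B t / A t @[t --> +oo] --> c1.
Proof. by have [_ [_ H]] := FbA; exact: H (expR_gt0 _). Qed.

Let AB_bound : exists C T : R, [/\ 0 < C, 0 < T & forall t, T < t ->
  [/\ A t != 0, B t != 0, `|B t| <= C * `|A t| & `|A t| <= C * `|B t|]].
Proof.
have c0 : 0 < `|c1| by rewrite normr_gt0.
have h1 : \forall t \near +oo, `|c1| / 2 < `|B t / A t|.
  by apply: (cvgr_gt _ (cvg_norm BA_cvg)); rewrite ltr_pdivrMr// ltr_pMr//; lra.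
have h2 : \forall t \near +oo, `|B t / A t| < `|c1| * 2.
  by apply: (cvgr_lt _ (cvg_norm BA_cvg)); rewrite ltr_pMr//; lra.
have [T [_ hT]] := filterI A_neq0 (filterI h1 h2).
exists (`|c1| * 2 + 2 / `|c1|), (Num.max T 1); split.
- by apply: addr_gt0; [apply: mulr_gt0|apply: divr_gt0].
- by rewrite lt_max ltr01 orbT.
move=> t; rewrite gt_max => /andP[Tt _].
have [At0 [l r]] := hT t Tt.
have a0 : 0 < `|A t| by rewrite normr_gt0.
move: l r; rewrite [`|B t / A t|]normrM normfV ltr_pdivlMr// ltr_pdivrMr// => l r.
split=> //.
- by rewrite -normr_gt0; apply: le_lt_trans l; rewrite mulr_ge0// divr_ge0// ltW.
- apply: le_trans (ltW r) _; rewrite ler_wpM2r// lerDl divr_ge0//.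
- rewrite mulrDl; apply: ler_wpDl; first by rewrite !mulr_ge0.
  have {1}-> : `|A t| = 2 / `|c1| * (`|c1| / 2 * `|A t|) by field; rewrite gt_eqF.
  by rewrite ler_wpM2l ?divr_ge0 ?(ltW l).
Qed.

Let B_ratio_cvg s : 0 < s -> B (t * s) / B t @[t --> +oo] --> s `^ tau.
Proof.
move=> s0.
have H1 : B (t * s) / A (t * s) @[t --> +oo] --> c1.
  exact: (cvg_comp _ _ (mulr_cvgy s0) BA_cvg).
pose proof (limM (limM H1 (auxiliary_ratio_cvg s0)) (limV c1_neq0 BA_cvg)) as H.
have -> : s `^ tau = c1 * s `^ tau / c1 by rewrite mulrAC divff// mul1r.
apply: near_eq_cvgR H; have [C [T [C0 T0 hT]]] := AB_bound.
near=> t.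
have Tt : T < t by near: t; exact: nbhs_pinfty_gt (num_real _).
have Tts : T < t * s.
  by rewrite -ltr_pdivrMr//; near: t; exact: nbhs_pinfty_gt (num_real _).
have [h1 h2 _ _] := hT t Tt; have [h3 h4 _ _] := hT _ Tts.
by field; rewrite h1 h2 h3.
Unshelve. all: by end_near. Qed.

Let measurable_Fb_exp t : 0 < t -> measurable_fun setT (fun v => Fb (t * expR v)).
Proof.
move=> t0; apply: nonincreasing_measurable; [exact: measurableT|move=> u v uv].
by apply: Fb_nincr; [rewrite mulr_gt0 ?expR_gt0|rewrite ler_pM2l// ler_expR].
Qed.

Let measurable_B_exp t : 0 < t -> measurable_fun setT (fun v => B (t * expR v)).
Proof.
move=> t0; apply: measurable_funB; last exact: measurable_cst.
apply: measurable_funM.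
  have -> : (fun v => Fb (t * expR v * expR 1)) = (fun v => Fb (t * expR 1 * expR v)).
    by apply/funext => v; rewrite mulrAC.
  by apply: measurable_Fb_exp; rewrite mulr_gt0 ?expR_gt0.
apply: nondecreasing_measurable => // u v uv.
rewrite lef_pV2 ?posrE ?Fb_gt0 ?mulr_gt0 ?expR_gt0//.
by apply: Fb_nincr; [rewrite mulr_gt0 ?expR_gt0|rewrite ler_pM2l// ler_expR].
Qed.

Let measurable_E_exp t : 0 < t -> measurable_fun setT (fun v => E t (expR v)).
Proof.
move=> t0; apply: measurable_funB.
  by apply: measurable_funM; [exact: measurable_Fb_exp|exact: measurable_cst].
apply: nonincreasing_measurable; [exact: measurableT|move=> u v uv].
by rewrite -!expRM ler_expR mulrN mulrN lerN2 ler_wpM2r// ltW.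
Qed.

Let cvgy_of_ge (t : nat -> R) : (forall n, n%:R <= t n) -> t n @[n --> \oo] --> +oo%R.
Proof.
move=> h; apply/cvgryPge => M; near=> n.
by apply: le_trans (h n); near: n; exact: nbhs_infty_ger.
Unshelve. all: by end_near. Qed.

(** A failure yields t_n -> oo and v_n in [0, 1] with |A (t_n e^v_n)| > n |A t_n|. The ratio of [B]
    at t_n e^v_n and at t_n splits through an intermediate point t_n e^u. Each factor is bounded in
    n when the step it spans is fixed, and [common_bounded_point] provides for each n a u at which
    both obey one bound M. *)
Let auxiliary_locally_bounded : exists C T : R, [/\ 0 < C, 0 < T & forall t v, T < t ->
  0 <= v <= 1 -> `|A (t * expR v)| <= C * `|A t|].
Proof.
apply: contrapT => hN.
have [C [T [C0 T0 hT]]] := AB_bound.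
have /choice[f hf] : forall n : nat, exists tv : R * R, [/\ n%:R + T + 1 <= tv.1,
   0 <= tv.2 <= 1 & (n%:R + 1) * `|A tv.1| < `|A (tv.1 * expR tv.2)|].
  move=> n; apply: contrapT => hn; apply: hN.
  exists (n%:R + 1), (n%:R + T + 1); split.
  - by have := ler0n R n; lra.
  - by have := ler0n R n; lra.
  move=> t v Tt v01; rewrite leNgt; apply/negP => h; apply: hn.
  by exists (t, v); split => //=; exact: ltW.
pose t n := (f n).1; pose v n := (f n).2.
have tT n : T < t n by have [+ _ _] := hf n; rewrite -/(t n); have := ler0n R n; lra.
have t0 n : 0 < t n by exact: lt_trans (tT n).
have tn n : n%:R <= t n by have [+ _ _] := hf n; rewrite -/(t n); lra.
have v01 n : 0 <= v n <= 1 by have [_ + _] := hf n.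
have ev1 n : 1 <= expR (v n) by rewrite -expR0 ler_expR; have /andP[] := v01 n.
have tvn n : n%:R <= t n * expR (v n).
  by apply: le_trans (tn n) _; rewrite ler_peMr ?ev1// ltW.
have tvT n : T < t n * expR (v n).
  by apply: lt_le_trans (tT n) _; rewrite ler_peMr ?ev1// ltW.
have tv0 n : 0 < t n * expR (v n) by exact: lt_trans (tvT n).
pose p n u := B (t n * expR u) / B (t n).
pose q n u := B (t n * expR (v n)) / B (t n * expR (v n) * expR u).
have [|| | |//|M [M0 hM]] := @common_bounded_point R p q v.
- move=> n; apply: measurable_funM; last exact: measurable_cst.
  exact: measurable_B_exp.
- move=> n; apply: measurable_funM; first exact: measurable_cst.
  apply: measurable_fun_inv.
  exact: measurable_B_exp.
- move=> u _; apply: (@cvg_seq_bound _ _ (expR u `^ tau)).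
  exact: (cvg_comp _ _ (cvgy_of_ge tn) (B_ratio_cvg (expR_gt0 u))).
- move=> u _; apply: (@cvg_seq_bound _ _ (expR u `^ tau)^-1).
  have e0 : (expR u : R) `^ tau != 0 by rewrite gt_eqF ?powR_gt0 ?expR_gt0.
  have H : B (t n * expR (v n) * expR u) / B (t n * expR (v n)) @[n --> \oo] --> (expR u : R) `^ tau.
    exact: (cvg_comp _ _ (cvgy_of_ge tvn) (B_ratio_cvg (expR_gt0 u))).
  apply: near_eq_cvgR (limV e0 H); apply: nearW => n.
  by rewrite /q invf_div.
(* Two factors C pass from [A] to [B] and back; the two factors M come from the two halves of the
   step. *)
have [n hn] : exists n : nat, C * M * M * C <= n%:R.
  exists (Num.truncn (C * M * M * C)).+1; apply/ltW/truncnS_gt.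
have [u [/andP[u1 _] [pM qM]]] := hM n.
have [_ _] := hf n; rewrite -/(t n) -/(v n); apply/negP; rewrite -leNgt.
have [At0 Bt0 Bt At] := hT _ (tT n).
have [_ Bv0 _ Av] := hT _ (tvT n).
have tvuT : T < t n * expR (v n) * expR (u - v n).
  apply: lt_le_trans (tvT n) _; rewrite ler_peMr ?(ltW (tv0 n))//.
  by rewrite -expR0 ler_expR; lra.
have [_ Bw0 _ _] := hT _ tvuT.
move: pM qM; rewrite /p /q -mulrA -expRD (addrC (v n)) subrK.
move: Bw0; rewrite -mulrA -expRD (addrC (v n)) subrK => Bw0.
rewrite !normrM !normfV ler_pdivrMr ?normr_gt0// ler_pdivrMr ?normr_gt0// => pM qM.
apply: le_trans Av _.
have h1 : `|B (t n * expR (v n))| <= M * (M * (C * `|A (t n)|)).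
  apply: le_trans qM _; rewrite ler_wpM2l ?(ltW M0)//.
  by apply: le_trans pM _; rewrite ler_wpM2l ?(ltW M0).
apply: le_trans (ler_wpM2l (ltW C0) h1) _.
rewrite !mulrA ler_wpM2r//.
by apply: le_trans hn _; rewrite lerDl.
Qed.

(** Same contradiction as for [A]. The cocycle identity is solved for the deviation over the short
    step v_n, in terms of those over u from t_n and over u - v_n from t_n e^v_n. *)
Let E_locally_bounded : exists C T : R, [/\ 0 < C, 0 < T & forall t v, T < t ->
  0 <= v <= 1 -> `|E t (expR v)| <= C * `|A t|].
Proof.
apply: contrapT => hN.
have [C [T0 [C0 T00 hA]]] := auxiliary_locally_bounded.
have [C1 [T1 [_ T10 hT]]] := AB_bound.
have [_ [_ H]] := FbA.
pose T := Num.max T0 T1.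
have TT0 : T0 <= T by rewrite /T le_max lexx.
have TT1 : T1 <= T by rewrite /T le_max lexx orbT.
have T_0 : 0 < T by exact: lt_le_trans TT0.
have /choice[f hf] : forall n : nat, exists tv : R * R, [/\ n%:R + T + 1 <= tv.1,
   0 <= tv.2 <= 1 & (n%:R + 1) * `|A tv.1| < `|E tv.1 (expR tv.2)|].
  move=> n; apply: contrapT => hn; apply: hN.
  exists (n%:R + 1), (n%:R + T + 1); split.
  - by have := ler0n R n; lra.
  - by have := ler0n R n; lra.
  move=> t v Tt v01; rewrite leNgt; apply/negP => h; apply: hn.
  by exists (t, v); split => //=; exact: ltW.
pose t n := (f n).1; pose v n := (f n).2.
have tT n : T < t n by have [+ _ _] := hf n; rewrite -/(t n); have := ler0n R n; lra.
have t0 n : 0 < t n by exact: lt_trans (tT n).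
have tn n : n%:R <= t n by have [+ _ _] := hf n; rewrite -/(t n); lra.
have v01 n : 0 <= v n <= 1 by have [_ + _] := hf n.
have ev1 n : 1 <= expR (v n) by rewrite -expR0 ler_expR; have /andP[] := v01 n.
have tvn n : n%:R <= t n * expR (v n).
  by apply: le_trans (tn n) _; rewrite ler_peMr ?ev1// ltW.
have tvT n : T < t n * expR (v n).
  by apply: lt_le_trans (tT n) _; rewrite ler_peMr ?ev1// ltW.
have tv0 n : 0 < t n * expR (v n) by exact: lt_trans (tvT n).
pose p n u := E (t n) (expR u) / A (t n).
pose q n u := E (t n * expR (v n)) (expR u) / A (t n * expR (v n)).
have [|| | |//|M [M0 hM]] := @common_bounded_point R p q v.
- move=> n; apply: measurable_funM; last exact: measurable_cst.
  exact: measurable_E_exp.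
- move=> n; apply: measurable_funM; last exact: measurable_cst.
  exact: measurable_E_exp.
- move=> u _; apply: (@cvg_seq_bound _ _ ((expR u : R) `^ (- alpha) * hpow tau (expR u))).
  exact: (cvg_comp _ _ (cvgy_of_ge tn) (H _ (expR_gt0 u))).
- move=> u _; apply: (@cvg_seq_bound _ _ ((expR u : R) `^ (- alpha) * hpow tau (expR u))).
  exact: (cvg_comp _ _ (cvgy_of_ge tvn) (H _ (expR_gt0 u))).
(* The step u - v_n is at most 3, whence [expR 3]. M bounds the deviation over u, and M * C the one
   starting at t_n e^v_n, where |A| is at most C times |A t_n|. *)
pose D := (expR 3 : R) `^ alpha * (M + M * C).
have [n hn] : exists n : nat, D <= n%:R.
  by exists (Num.truncn D).+1; apply/ltW/truncnS_gt.
have [u [/andP[u1 u3] [pM qM]]] := hM n.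
have [_ _] := hf n; rewrite -/(t n) -/(v n); apply/negP; rewrite -leNgt.
have [At0 _ _ _] := hT _ (le_lt_trans TT1 (tT n)).
have [Av0 _ _ _] := hT _ (le_lt_trans TT1 (tvT n)).
move: pM qM; rewrite /p /q !normrM !normfV ler_pdivrMr ?normr_gt0//.
rewrite ler_pdivrMr ?normr_gt0// => pM qM.
have qM' : `|E (t n * expR (v n)) (expR (u - v n))| <= M * (C * `|A (t n)|).
  apply: le_trans qM _; rewrite ler_wpM2l ?(ltW M0)//.
  by apply: hA => //; exact: le_lt_trans (tT n).
have := @E_mul (t n) (expR (v n)) (expR (u - v n)) (t0 n) (expR_gt0 _) (expR_gt0 _).
rewrite -expRD addrC subrK => Emul.
have w0 : 0 < (expR (u - v n) : R) `^ alpha by rewrite powR_gt0 ?expR_gt0.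
have {Emul} -> : E (t n) (expR (v n)) = (expR (u - v n) : R) `^ alpha *
   (E (t n) (expR u) - Fb (t n * expR (v n)) / Fb (t n) * E (t n * expR (v n)) (expR (u - v n))).
  have w1 : (expR (u - v n) : R) `^ alpha != 0 by rewrite gt_eqF.
  rewrite Emul powRN; move: (Fb _ / Fb _) (E (t n * _) _) (E (t n) _) (_ `^ _) w1 => a b d w w1.
  by field.
rewrite normrM ger0_norm ?(ltW w0)//.
have r1 : `|Fb (t n * expR (v n)) / Fb (t n)| <= 1.
  rewrite ger0_norm ?divr_ge0 ?(ltW (Fb_gt0 _))//.
  rewrite ler_pdivrMr ?Fb_gt0// mul1r; apply: Fb_nincr => //.
  by rewrite ler_peMr ?ev1// ltW.
have h1 : `|E (t n) (expR u) - Fb (t n * expR (v n)) / Fb (t n) * E (t n * expR (v n)) (expR (u - v n))|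
   <= (M + M * C) * `|A (t n)|.
  apply: le_trans (ler_normB _ _) _; rewrite mulrDl; apply: lerD => //.
  rewrite normrM; apply: le_trans (ler_wpM2r (normr_ge0 _) r1) _.
  by rewrite mul1r -mulrA.
have h2 : (expR (u - v n) : R) `^ alpha <= (expR 3 : R) `^ alpha.
  by rewrite ge0_ler_powR ?(ltW alpha_gt0) ?nnegrE ?expR_ge0// ler_expR.
apply: le_trans (ler_pM (ltW w0) (normr_ge0 _) h2 h1) _.
rewrite mulrA ler_wpM2r//.
by apply: le_trans hn _; rewrite lerDl.
Qed.

(** Induction on k with s <= e^k, peeling off one step e. The remaining deviation from t e is at
    most C |A (t e)|, and for large t its weight Fb (t e) / Fb t times |A (t e) / A t| is below [th]
    < 1, the limit being exp (tau - alpha); so the constant does not grow with k. *)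
Lemma second_order_uniform_bound : exists C T : R, [/\ 0 < C, 0 < T &
  forall t s, T < t -> 1 <= s ->
  `|Fb (t * s) / Fb t - s `^ (- alpha)| <= C * `|A t|].
Proof.
have [C0 [T0 [C00 T00 hE]]] := E_locally_bounded.
have [C1 [T1 [_ T10 hT]]] := AB_bound.
have e0 : 0 < expR 1 :> R by exact: expR_gt0.
pose th : R := (expR (- alpha) * expR tau + 1) / 2.
have th0 : expR (- alpha) * expR tau < 1 by rewrite -expRD -[ltRHS]expR0 ltr_expR; rewrite addrC subr_lt0; exact: le_lt_trans tau_le0 alpha_gt0.
have th1 : th < 1 by rewrite /th; lra.
have thl : expR (- alpha) * expR tau < th by rewrite /th; lra.
have : \forall t \near +oo, `|Fb (t * expR 1) / Fb t * (A (t * expR 1) / A t)| < th.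
  pose proof (cvg_norm (limM (ratio_cvg e0) (auxiliary_ratio_cvg e0))) as h.
  apply: (cvgr_lt _ h).
  by rewrite -!expRM !mul1r ger0_norm// mulr_ge0 ?expR_ge0.
move=> [T2 [_ hT2]].
pose T := Num.max T0 (Num.max T1 T2).
have TT0 : T0 <= T by rewrite /T le_max lexx.
have TT1 : T1 <= T by rewrite /T !le_max lexx orbT.
have TT2 : T2 <= T by rewrite /T !le_max lexx !orbT.
have T_0 : 0 < T by exact: lt_le_trans TT0.
(* Fixed point of C -> C * th + C0, the recursion produced by one induction step. *)
pose C := C0 / (1 - th).
have C_0 : 0 < C by rewrite divr_gt0// subr_gt0.
have CE : C * th + C0 = C by rewrite /C; field; rewrite subr_eq0 gt_eqF.
have th_0 : 0 <= th by rewrite /th divr_ge0// addr_ge0 ?mulr_ge0 ?expR_ge0.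
have C0C : C0 <= C by rewrite -CE lerDr mulr_ge0// ltW.
exists C, T; split=> // t s Tt s1.
have [k hk] : exists k : nat, s <= expR k%:R.
  exists (Num.truncn s).+1; apply: le_trans (ltW (truncnS_gt _)) _.
  by apply: le_trans (expR_ge1Dx _); rewrite lerDr.
rewrite -/(E t s).
elim: k t s Tt s1 hk => [|k IH] t s Tt s1 hk.
  have -> : s = expR 0 by apply/eqP; rewrite eq_le hk/= expR0.
  apply: le_trans (hE t 0 (le_lt_trans TT0 Tt) _) _; first by rewrite lexx ler01.
  by rewrite ler_wpM2r.
have s0 : 0 < s by exact: lt_le_trans s1.
have t0 : 0 < t by exact: lt_trans Tt.
have [se|es] := leP s (expR 1).
  have -> : s = expR (ln s) by rewrite lnK.
  apply: le_trans (hE t (ln s) (le_lt_trans TT0 Tt) _) _.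
    by rewrite ln_ge0//= -(@expRK R 1) ler_ln ?posrE.
  by rewrite ler_wpM2r.
have -> : s = expR 1 * (s / expR 1) by rewrite mulrCA divff ?mulr1 ?gt_eqF.
have s'0 : 0 < s / expR 1 by rewrite divr_gt0.
have s'1 : 1 <= s / expR 1 by rewrite ler_pdivlMr// mul1r ltW.
rewrite E_mul//.
have Tte : T < t * expR 1.
  by apply: lt_le_trans Tt _; rewrite ler_peMr ?(ltW t0)// -{1}(@expR0 R) ler_expR.
have h1 := IH _ _ Tte s'1.
have hk' : s / expR 1 <= expR k%:R.
  by rewrite ler_pdivrMr// -expRD -natr1 in hk *.
have {}h1 := h1 hk'.
apply: le_trans (ler_normD _ _) _.
rewrite -[X in _ <= X * _]CE mulrDl; apply: lerD.
  have [At0 _ _ _] := hT _ (le_lt_trans TT1 Tt).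
  have := hT2 _ (le_lt_trans TT2 Tt).
  rewrite mulrA normrM normfV ltr_pdivrMr ?normr_gt0// => h2.
  rewrite normrM.
  apply: le_trans (ler_wpM2l (normr_ge0 _) h1) _.
  rewrite mulrCA -[X in _ <= X]mulrA ler_wpM2l ?(ltW C_0)// -normrM; exact: ltW.
rewrite normrM ger0_norm ?powR_ge0//.
have h2 : (s / expR 1) `^ (- alpha) <= 1.
  by rewrite powRN invf_le1 ?powR_gt0// -[leLHS](powRr0 (s / expR 1)) ler_powR// ltW.
apply: le_trans (ler_wpM2r (normr_ge0 _) h2) _; rewrite mul1r.
have h3 := hE t 1 (le_lt_trans TT0 Tt).
by apply: h3; rewrite ler01 lexx.
Qed.

End second_order_regular_variation.

(** * The fundamental theorem of calculus on an open interval *)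

Lemma is_derive_continuous (R : realType) (f : R -> R) (x df : R) :
  is_derive x 1 f df -> {for x, continuous f}.
Proof. by move=> h; apply/differentiable_continuous/derivable1_diffP; exact: ex_derive. Qed.

(** The integrand may be unbounded at both ends: compact subintervals exhaust ]a, b[, and its sign
    permits monotone convergence. Finiteness of the integral is part of the conclusion. *)
Lemma ge0_improper_FTC2 (R : realType) (F f : R -> R) (a b : R) : a < b ->
  F x @[x --> a^'+] --> F a -> F x @[x --> b^'-] --> F b ->
  (forall x, a < x < b -> is_derive x 1 F (f x)) ->
  (forall x, a < x < b -> {for x, continuous f}) ->
  (forall x, a < x < b -> 0 <= f x) ->
  (\int[lebesgue_measure]_(x in `[a, b]) (f x)%:E = (F b - F a)%:E)%E.
Proof.
move=> ab Fa Fb dF cf f0.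
have mf : measurable_fun `]a, b[ f.
  apply: open_continuous_measurable_fun; first exact: interval_open.
  by move=> x; rewrite inE/= in_itv/=; exact: cf.
rewrite integral_itv_bndoo; last exact/measurable_EFinP.
(* Starting the denominators at 3 keeps 2 e n below b - a, so every subinterval is nondegenerate. *)
pose e (n : nat) : R := (b - a) / n.+3%:R.
have e0 n : 0 < e n by rewrite divr_gt0 ?subr_gt0.
have e2 n : e n * 2 < b - a.
  rewrite /e mulrAC ltr_pdivrMr// ltr_pM2l ?subr_gt0//.
  by rewrite ltr_nat.
have ecvg : e n @[n --> \oo] --> (0 : R).
  rewrite -(mulr0 (b - a)); apply: cvgMr.
  by have := @cvg_harmonic R; rewrite -(cvg_shiftn 2) /harmonic; under eq_fun do rewrite addn2.
pose G n : set R := `[a + e n, b - e n]%classic.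
have ndG : {homo G : n m / (n <= m)%N >-> (n <= m)%O}.
  move=> n m nm; apply/subsetPset => x; rewrite /G /= !in_itv/= => /andP[h1 h2].
  have : e m <= e n.
    by rewrite /e ler_pM2l ?subr_gt0// lef_pV2 ?posrE// ler_nat !ltnS.
  by move=> h; rewrite (le_trans _ h1) ?lerD2l// (le_trans h2)// lerB.
have UG : \bigcup_n G n = `]a, b[%classic.
  apply/seteqP; split=> [x [n _]|x]; rewrite /G /= !in_itv/= => /andP[ax xb].
    by have := e0 n; move: ax xb; lra.
  have xe : \forall n \near \oo, e n < Num.min (x - a) (b - x).
    by apply: (cvgr_lt _ ecvg); rewrite lt_min !subr_gt0 ax.
  have [n _ /(_ n (leqnn n))] := xe.
  rewrite lt_min => /andP[h1 h2].
  exists n => //=; rewrite in_itv/=; move: h1 h2; lra.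
have GS n : G n `<=` `]a, b[ by rewrite -UG; exact: bigcup_sup.
have H : (\int[lebesgue_measure]_(x in G i) (f x)%:E)%E @[i --> \oo] -->
    (\int[lebesgue_measure]_(x in `]a, b[) (f x)%:E)%E.
  rewrite -UG; apply: ge0_nondecreasing_set_cvg_integral => // [n|n|n x Gx].
  - exact: measurable_itv.
  - by apply/measurable_EFinP; apply: measurable_funS (GS n) mf.
  - by have := GS n x Gx; rewrite /= in_itv/= lee_fin; exact: f0.
have E n : (\int[lebesgue_measure]_(x in G n) (f x)%:E)%E = (F (b - e n) - F (a + e n))%:E.
  have sub x : a + e n <= x <= b - e n -> a < x < b by have := e0 n; lra.
  have abn : a + e n < b - e n by have := e2 n; lra.
  rewrite /G (@continuous_FTC2 _ f F) ?EFinB//.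
  - apply: continuous_in_subspaceT => x; rewrite inE/= in_itv/= => /sub; exact: cf.
  - have C x : a + e n <= x <= b - e n -> {for x, continuous F}.
      by move=> /sub /dF; exact: is_derive_continuous.
    split.
    + move=> x; rewrite in_itv/= => /andP[h1 h2].
      by apply: ex_derive; apply: dF; apply: sub; rewrite !ltW.
    + by apply: cvg_at_right_filter; apply: C; rewrite lexx ltW.
    + by apply: cvg_at_left_filter; apply: C; rewrite lexx ltW.
  - move=> x; rewrite in_itv/= => /andP[h1 h2].
    rewrite derive1E; apply: derive_val.
    by apply: dF; apply: sub; rewrite !ltW.
have H2 : (F (b - e n) - F (a + e n))%:E @[n --> \oo] --> (F b - F a)%:E.
  apply: cvg_EFin; first exact: nearW.
  change (F (b - e n) - F (a + e n) @[n --> \oo] --> F b - F a); apply: cvgB.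
  - move/cvg_at_leftP : Fb; apply; split.
      by move=> n; rewrite ltrBlDr ltrDl.
    by rewrite -[X in _ --> X]subr0; apply: cvgB => //; exact: cvg_cst.
  - move/cvg_at_rightP : Fa; apply; split.
      by move=> n; rewrite ltrDl.
    by rewrite -[X in _ --> X]addr0; apply: cvgD => //; exact: cvg_cst.
apply: (cvg_unique _ H) => //.
have EF : (fun n => (F (b - e n) - F (a + e n))%:E) =
    (fun n => (\int[lebesgue_measure]_(x in G n) (f x)%:E)%E).
  by apply/funext => n; rewrite E.
by rewrite EF in H2.
Qed.

Lemma derive_Rint (R : realType) (f : R -> R) (a b z : R) : a < z -> z < b ->
  (@lebesgue_measure R).-integrable `[a, b] (EFin \o f) -> {for z, continuous f} ->
  is_derive z 1 (fun x => Defs.Rint a x f) (f z).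
Proof.
move=> az zb fi fz.
have [d1 d2] := continuous_FTC1_closed zb fi az fz.
by apply: (DeriveDef d1); rewrite -d2 derive1E.
Qed.

(** * Elementary integrals on [-1, 1] *)

Section pointwise_derivatives.
Context {R : realType}.
Implicit Types (f g : R -> R) (x a b : R).

Lemma dervD f g x a b : is_derive x 1 f a -> is_derive x 1 g b ->
  is_derive x 1 (fun t => f t + g t) (a + b).
Proof. by move=> fa gb; exact: is_deriveD. Qed.

Lemma dervN f x a : is_derive x 1 f a -> is_derive x 1 (fun t => - f t) (- a).
Proof. by move=> fa; exact: is_deriveN. Qed.

Lemma dervM f g x a b : is_derive x 1 f a -> is_derive x 1 g b ->
  is_derive x 1 (fun t => f t * g t) (a * g x + f x * b).
Proof.
move=> fa gb; apply: (is_derive_eq (is_deriveM fa gb)).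
by rewrite addrC /GRing.scale/= [g x * a]mulrC.
Qed.

Lemma dervC x a : is_derive x 1 (fun _ : R => a) 0.
Proof. exact: is_derive_cst. Qed.

Lemma dervI x : is_derive x 1 (fun t : R => t) 1.
Proof. exact: is_derive_id. Qed.

Lemma dervComp f g x a b : is_derive (g x) 1 f a -> is_derive x 1 g b ->
  is_derive x 1 (fun t => f (g t)) (a * b).
Proof. by move=> fa gb; have := is_derive1_comp fa gb. Qed.

Lemma dervX f x a n : is_derive x 1 f a ->
  is_derive x 1 (fun t => f t ^+ n) (n%:R * f x ^+ n.-1 * a).
Proof.
move=> fa; rewrite (_ : (fun t => f t ^+ n) = f ^+ n); last first.
  by apply/funext => t; rewrite exprfctE.
exact: is_deriveX.
Qed.

Lemma dervV f x a : f x != 0 -> is_derive x 1 f a ->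
  is_derive x 1 (fun t => (f t)^-1) (- a / f x ^+ 2).
Proof.
move=> f0 fa; apply: (is_derive_eq (is_deriveV f0 fa)).
by rewrite /GRing.scale/= mulNr mulNr mulrC.
Qed.

Lemma dervPow f x a p : 0 < f x -> is_derive x 1 f a ->
  is_derive x 1 (fun t => f t `^ p) (p * f x `^ (p - 1) * a).
Proof. by move=> f0 fa; exact: (dervComp (is_derive1_powR p f0) fa). Qed.

Lemma dervSqrt f x a : 0 < f x -> is_derive x 1 f a ->
  is_derive x 1 (fun t => Num.sqrt (f t)) ((2 * Num.sqrt (f x))^-1 * a).
Proof. by move=> f0 fa; exact: (dervComp (is_derive1_sqrt f0) fa). Qed.

End pointwise_derivatives.

Ltac derv := repeat first
  [ eapply dervC | eapply dervI | eapply dervN | eapply dervD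
  | eapply dervX | eapply dervM | eassumption ].
Ltac derive_by := eapply is_derive_eq; [derv|].

Section moments.
Context {R : realType}.
Variable alpha : R.
Hypothesis alpha_gt0 : 0 < alpha.
Implicit Types (z s : R).

Definition Psi (z : R) := Defs.Rint (-1) z (fun s => (1 - s ^+ 2) `^ alpha).
(** The moment created by the -5/4 w s^2 term of the arc density. *)
Definition Kap (z : R) := Defs.Rint (-1) z (fun s => (1 - s ^+ 2) `^ alpha * s ^+ 2).

Lemma sqr_itvP (s : R) : (-1 <= s <= 1) = (s ^+ 2 <= 1).
Proof. by apply/idP/idP => [/andP[]|h]; [|apply/andP; split]; nra. Qed.

Lemma onem_sqr_ge0 (s : R) : -1 <= s <= 1 -> 0 <= 1 - s ^+ 2.
Proof. by rewrite sqr_itvP subr_ge0. Qed.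

Lemma onem_sqr_gt0 (s : R) : -1 < s < 1 -> 0 < 1 - s ^+ 2.
Proof. by move=> /andP[]; nra. Qed.

Lemma onem_sqr_powR_itv (s : R) : -1 <= s <= 1 -> 0 <= (1 - s ^+ 2) `^ alpha <= 1.
Proof.
move=> s1; rewrite powR_ge0/=.
have E : 1 `^ alpha = 1 :> R by rewrite powR1.
rewrite -[leRHS]E.
apply: ge0_ler_powR; rewrite ?nnegrE ?onem_sqr_ge0 ?(ltW alpha_gt0) ?ler01//.
by rewrite lerBlDr lerDl sqr_ge0.
Qed.

Lemma is_derive_onem_sqr_powR p (s : R) : -1 < s < 1 ->
  is_derive s 1 (fun s => (1 - s ^+ 2) `^ p) (- (2 * p * s * (1 - s ^+ 2) `^ (p - 1))).
Proof.
move=> s1; eapply is_derive_eq.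
  by eapply dervPow; [exact: onem_sqr_gt0|derv].
by rewrite expr1; ring.
Qed.

Lemma measurable_onem_sqr_powR p : measurable_fun [set: R] (fun s : R => (1 - s ^+ 2) `^ p).
Proof.
have mp := @measurable_powR R p; apply: (measurableT_comp mp).
by apply: measurable_funB; [exact: measurable_cst|exact: exprn_measurable].
Qed.

Lemma bounded_integrable (f : R -> R) (a b M : R) : measurable_fun setT f ->
  (forall s, a <= s <= b -> `|f s| <= M) ->
  (@lebesgue_measure R).-integrable `[a, b] (EFin \o f).
Proof.
move=> mf fM; apply: measurable_bounded_integrable => //.
- have : (lebesgue_measure (`[a, b] : set R) < +oo)%E.
    by rewrite lebesgue_measure_itv/=; case: ifP => // _; rewrite -EFinB ltry.
  exact.
- exact: measurable_funTS.
- exists M; split; first exact: num_real.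
  by move=> N MN s /=; rewrite in_itv/= => /fM h; apply: le_trans h (ltW MN).
Qed.

Lemma Psi_integrable z : z <= 1 -> (@lebesgue_measure R).-integrable `[-1, z]
   (EFin \o (fun s : R => (1 - s ^+ 2) `^ alpha)).
Proof.
move=> z1; apply: (@bounded_integrable _ _ _ 1); first exact: measurable_onem_sqr_powR.
move=> s /andP[s1 s2]; have /onem_sqr_powR_itv/andP[h0 h1] : -1 <= s <= 1 by rewrite s1 (le_trans s2).
by rewrite ger0_norm.
Qed.

Lemma Kap_integrable z : z <= 1 -> (@lebesgue_measure R).-integrable `[-1, z]
   (EFin \o (fun s : R => (1 - s ^+ 2) `^ alpha * s ^+ 2)).
Proof.
move=> z1; apply: (@bounded_integrable _ _ _ 1).
  by apply: measurable_funM; [exact: measurable_onem_sqr_powR|exact: exprn_measurable].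
move=> s /andP[s1 s2].
have s11 : -1 <= s <= 1 by rewrite s1 (le_trans s2).
have /andP[h0 h1] := onem_sqr_powR_itv s11.
have s0 := sqr_ge0 s; have s2' : s ^+ 2 <= 1 by rewrite -sqr_itvP.
rewrite ger0_norm; last exact: mulr_ge0.
exact: mulr_ile1.
Qed.

Lemma is_derive_Psi z : -1 < z < 1 -> is_derive z 1 Psi ((1 - z ^+ 2) `^ alpha).
Proof.
move=> /andP[z1 z2]; apply: (derive_Rint z1 z2); first exact: Psi_integrable.
by apply: is_derive_continuous; apply: is_derive_onem_sqr_powR; rewrite z1.
Qed.

Lemma is_derive_Kap z : -1 < z < 1 -> is_derive z 1 Kap ((1 - z ^+ 2) `^ alpha * z ^+ 2).
Proof.
move=> /andP[z1 z2]; apply: (derive_Rint z1 z2); first exact: Kap_integrable.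
apply: (is_derive_continuous (dervM (is_derive_onem_sqr_powR alpha _) (dervX 2 (dervI z)))).
by rewrite z1.
Qed.

Lemma Rint_point (f : R -> R) (a : R) : Defs.Rint a a f = 0.
Proof. by rewrite /Defs.Rint set_itv1 Rintegral_set1. Qed.

Lemma onem_sqr_powR_cvg_left z : -1 < z <= 1 ->
  (1 - s ^+ 2) `^ alpha @[s --> z^'-] --> (1 - z ^+ 2) `^ alpha.
Proof.
move=> /andP[z1]; rewrite le_eqVlt => /orP[/eqP->|z2]; last first.
  apply: cvg_at_left_filter; apply: (is_derive_continuous (is_derive_onem_sqr_powR _ _)).
  by rewrite z1.
rewrite expr1n subrr powR0 ?gt_eqF//.
apply/cvgr0Pnorm_lt => e e0.
have /cvgr0Pnorm_lt/(_ e e0) := powR_cvg0 alpha_gt0.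
move=> [d /= d0 hd].
near=> s; apply: (hd (1 - s ^+ 2)).
- rewrite /= sub0r normrN.
  have s1 : s < 1 by near: s; exact: nbhs_left_lt.
  have s2 : 0 < s by near: s; exact: nbhs_left_gt.
  have s11 : -1 < s < 1 by rewrite s1 andbT (lt_trans _ s2)// ltrN10.
  rewrite ger0_norm; last exact: ltW (onem_sqr_gt0 s11).
  have s3 : 1 - d / 2 < s by near: s; apply: nbhs_left_gt; rewrite ltrBlDr ltrDl divr_gt0.
  have -> : 1 - s ^+ 2 = (1 - s) * (1 + s) by ring.
  apply: (@lt_le_trans _ _ (d / 2 * (1 + s))); first by rewrite ltr_pM2r; lra.
  by nra.
- rewrite onem_sqr_gt0//.
  have s1 : s < 1 by near: s; exact: nbhs_left_lt.
  have s2 : 0 < s by near: s; exact: nbhs_left_gt.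
  by rewrite s1 andbT (lt_trans _ s2)// ltrN10.
Unshelve. all: by end_near. Qed.

Lemma Psi_cvg_left z : -1 < z <= 1 -> Psi s @[s --> z^'-] --> Psi z.
Proof.
by move=> /andP[z1 z2]; exact: (parameterized_integral_cvg_at_left z1 (Psi_integrable z2)).
Qed.

Lemma Kap_cvg_left z : -1 < z <= 1 -> Kap s @[s --> z^'-] --> Kap z.
Proof.
by move=> /andP[z1 z2]; exact: (parameterized_integral_cvg_at_left z1 (Kap_integrable z2)).
Qed.

Lemma Psi_cvg_right : Psi s @[s --> (-1)^'+] --> 0.
Proof.
have ab : -1 < 1 :> R by lra.
by apply: cvg_at_right_filter; exact: (parameterized_integral_cvg_left ab (Psi_integrable (lexx _))).
Qed.

Lemma Kap_cvg_right : Kap s @[s --> (-1)^'+] --> 0.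
Proof.
have ab : -1 < 1 :> R by lra.
by apply: cvg_at_right_filter; exact: (parameterized_integral_cvg_left ab (Kap_integrable (lexx _))).
Qed.

Lemma onem_sqr_powR_cvg_right : (1 - s ^+ 2) `^ alpha @[s --> (-1)^'+] --> 0.
Proof.
have h : (1 - s ^+ 2) `^ alpha @[s --> 1^'-] --> (0 : R).
  have := @onem_sqr_powR_cvg_left 1; rewrite expr1n subrr powR0 ?gt_eqF//; apply.
  by apply/andP; split; lra.
apply/cvg_at_rightP => u [u1 ucvg].
have h' : (1 - (- u n) ^+ 2) `^ alpha @[n --> \oo] --> (0 : R).
  move/cvg_at_leftP : h => /(_ (fun n => - u n)); apply; split=> [n|]; first by rewrite ltrNl.
  by rewrite -[X in _ --> X](opprK 1); exact: cvgN.
by apply: near_eq_cvgR h'; apply: nearW => n; rewrite sqrrN.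
Qed.

(** Substitution u = s^2 in the Beta integral: each u in ]0, 1[ comes from two values of s, hence
    the two terms of [F]. The factor u^(-1/2) blows up at 0, which the improper fundamental theorem
    tolerates. *)
Lemma c_alphaE : c_alpha alpha = Psi 1.
Proof.
have sqrt_cont (t : R) : {for t, continuous (@Num.sqrt R)} by exact: sqrt_continuous.
have sub0 : -1 < (0 : R) < 1 by lra.
pose F (u : R) := Psi (Num.sqrt u) - Psi (- Num.sqrt u).
have sq (u : R) : 0 < u < 1 -> [/\ 0 < Num.sqrt u, Num.sqrt u < 1 & Num.sqrt u ^+ 2 = u].
  move=> /andP[u0 u1]; split; first by rewrite sqrtr_gt0.
    by rewrite -[ltRHS]sqrtr1 ltr_sqrt.
  by rewrite sqr_sqrtr ?ltW.
have H : (\int[lebesgue_measure]_(x in `[0%R, 1%R]) ((1 - x) `^ alpha * x `^ (- (2^-1)))%:E =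
    (F 1 - F 0)%:E)%E; last first.
  rewrite /c_alpha /Defs.Rint /Rintegral H.
  by rewrite /= /F sqrtr1 sqrtr0 oppr0 subrr subr0 [Psi (-1)]Rint_point subr0.
apply: (@ge0_improper_FTC2 R F (fun s => (1 - s) `^ alpha * s `^ (- (2^-1))) 0 1).
- exact: ltr01.
- have c0 : Num.sqrt u @[u --> (0 : R)] --> (0 : R).
    by rewrite -[X in _ --> X]sqrtr0; exact: sqrt_cont.
  have c0' : - Num.sqrt u @[u --> (0 : R)] --> (0 : R).
    by rewrite -[X in _ --> X]oppr0; exact: cvgN.
  have P0 : Psi v @[v --> (0 : R)] --> Psi 0 by exact: (is_derive_continuous (is_derive_Psi sub0)).
  have h1 : Psi (Num.sqrt u) @[u --> (0 : R)] --> Psi 0 by exact: (cvg_comp _ _ c0 P0).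
  have h2 : Psi (- Num.sqrt u) @[u --> (0 : R)] --> Psi 0 by exact: (cvg_comp _ _ c0' P0).
  have F0 : F 0 = Psi 0 - Psi 0 by rewrite /F sqrtr0 oppr0.
  by rewrite F0; apply: cvg_at_right_filter; exact: (cvgB h1 h2).
- apply/cvg_at_leftP => u [u1 ucvg]; rewrite /F sqrtr1 [Psi (-1)]Rint_point.
  have vcvg : Num.sqrt (u n) @[n --> \oo] --> (1 : R).
    by rewrite -sqrtr1; apply: continuous_cvg => //; exact: sqrt_cont.
  have v1 n : Num.sqrt (u n) < 1 by rewrite -[ltRHS]sqrtr1 ltr_sqrt.
  apply: cvgB.
    have /Psi_cvg_left/cvg_at_leftP/(_ (fun n => Num.sqrt (u n))) : -1 < (1 : R) <= 1 by lra.
    by apply; split.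
  move/cvg_at_rightP : Psi_cvg_right => /(_ (fun n => - Num.sqrt (u n))); apply; split.
    by move=> n; rewrite ltrN2.
  exact: cvgN.
- move=> u u01; have [s0 s1 s2] := sq u u01.
  have su : is_derive u 1 (@Num.sqrt R) (2 * Num.sqrt u)^-1.
    by apply: is_derive1_sqrt; case/andP: u01.
  have P1 : is_derive (Num.sqrt u) 1 Psi ((1 - u) `^ alpha).
    by rewrite -{2}s2; apply: is_derive_Psi; lra.
  have P2 : is_derive (- Num.sqrt u) 1 Psi ((1 - u) `^ alpha).
    by rewrite -{2}s2 -sqrrN; apply: is_derive_Psi; lra.
  apply: (is_derive_eq (dervD (dervComp P1 su)
    (dervN (dervComp (g := fun t => - Num.sqrt t) P2 (dervN su))))).
  rewrite powRN powR12_sqrt; last by case/andP: u01 => /ltW.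
  by field; rewrite gt_eqF.
- move=> u /andP[u0 u1]; apply: is_derive_continuous.
  apply: (dervM (dervPow alpha _ (dervD (dervC u 1) (dervN (dervI u))))).
    by rewrite subr_gt0.
  exact: is_derive1_powR.
- by move=> u _; rewrite mulr_ge0 ?powR_ge0.
Qed.

Lemma c_alpha_gt0 : 0 < c_alpha alpha.
Proof.
have ab : -1 < 1 :> R by lra.
have [c c1 cE] := @MVT R Psi (fun s => (1 - s ^+ 2) `^ alpha) (-1) 1 ab
  (fun x xI => @is_derive_Psi x xI)
  (parameterized_integral_continuous (ltW ab) (Psi_integrable (lexx 1))).
move: cE; rewrite c_alphaE [Psi (-1)]Rint_point subr0 => ->.
by rewrite mulr_gt0 ?powR_gt0 ?onem_sqr_gt0//; lra.
Qed.

(* Integration by parts removes the factor [(1 - s ^+ 2) `^ (alpha - 1)], which is unbounded near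
   the endpoints when [alpha < 1]. *)
Lemma J1E z : -1 < z <= 1 -> J1 alpha z =
  Psi z / 2 - 5 / 4 * Kap z - (1 - z ^+ 2) `^ alpha * z * (1 / 2 - 3 / 4 * z ^+ 2).
Proof.
move=> z11; have /andP[z1 z2] := z11.
pose J (s : R) := Psi s / 2 - 5 / 4 * Kap s - (1 - s ^+ 2) `^ alpha * s * (1 / 2 - 3 / 4 * s ^+ 2).
(* The polynomial factor of [J1] equals (alpha + 1) (1 - s^2) - alpha / 2 s^2, so its integrand is
   alpha + 1 times that of [Kap] minus [g2]. Only [g2] can be singular, and it has a constant
   sign. *)
pose g2 (s : R) := alpha / 2 * (1 - s ^+ 2) `^ (alpha - 1) * s ^+ 4.
have mg2 : measurable_fun setT g2.
  apply: measurable_funM; last exact: exprn_measurable.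
  by apply: measurable_funM; [exact: measurable_cst|exact: measurable_onem_sqr_powR].
have g2_ge0 s : 0 <= g2 s.
  apply: mulr_ge0; last exact: exprn_even_ge0.
  by apply: mulr_ge0; [rewrite divr_ge0 ?(ltW alpha_gt0)|exact: powR_ge0].
have split_powR s : -1 <= s <= 1 ->
    (1 - s ^+ 2) * (1 - s ^+ 2) `^ (alpha - 1) = (1 - s ^+ 2) `^ alpha.
  by move=> /onem_sqr_ge0 h; rewrite mulr_powRB1.
have H : (\int[lebesgue_measure]_(x in `[(-1)%R, z]) (g2 x)%:E =
    ((alpha + 1) * Kap z - J z)%:E)%E.
  have JN1 : (alpha + 1) * Kap (-1) - J (-1) = 0.
    rewrite /J [Kap (-1)]Rint_point [Psi (-1)]Rint_point sqrrN expr1n subrr.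
    by rewrite powR0 ?gt_eqF// !(mulr0, mul0r, subr0, oppr0).
  rewrite -[X in _ = X%:E]subr0 -[X in _ = (_ - X)%:E]JN1.
  apply: (@ge0_improper_FTC2 R (fun s => (alpha + 1) * Kap s - J s) g2 (-1) z z1).
  - have -> : (alpha + 1) * Kap (-1) - J (-1) = (alpha + 1) * 0 -
        (0 / 2 - 5 / 4 * 0 - 0 * (-1) * (1 / 2 - 3 / 4 * (-1) ^+ 2)).
      rewrite /J [Kap (-1)]Rint_point [Psi (-1)]Rint_point sqrrN expr1n subrr.
      by rewrite powR0 ?gt_eqF// !(mulr0, mul0r, subr0, oppr0).
    have idc : s @[s --> (-1)^'+] --> (-1 : R) by apply: cvg_at_right_filter; exact: cvg_id.
    have sqc : s ^+ 2 @[s --> (-1)^'+] --> ((-1) ^+ 2 : R).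
      by apply: cvg_at_right_filter; exact: exprn_continuous.
    apply: cvgB; first by apply: cvgMr; exact: Kap_cvg_right.
    apply: cvgB; first apply: cvgB.
    + by apply: cvgM; [exact: Psi_cvg_right|exact: cvg_cst].
    + by apply: cvgMr; exact: Kap_cvg_right.
    + apply: cvgM; first by apply: cvgM => //; exact: onem_sqr_powR_cvg_right.
      by apply: cvgB; [exact: cvg_cst|exact: cvgMr].
  - have idc : s @[s --> z^'-] --> (z : R) by apply: cvg_at_left_filter; exact: cvg_id.
    have sqc : s ^+ 2 @[s --> z^'-] --> (z ^+ 2 : R).
      by apply: cvg_at_left_filter; exact: exprn_continuous.
    apply: cvgB; first by apply: cvgMr; exact: Kap_cvg_left.
    apply: cvgB; first apply: cvgB.
    + by apply: cvgM; [exact: Psi_cvg_left|exact: cvg_cst].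
    + by apply: cvgMr; exact: Kap_cvg_left.
    + apply: cvgM; first by apply: cvgM => //; exact: onem_sqr_powR_cvg_left.
      by apply: cvgB; [exact: cvg_cst|exact: cvgMr].
  - move=> s /andP[s1 s2]; have s11 : -1 < s < 1 by rewrite s1 (lt_le_trans s2).
    have dP := is_derive_Psi s11; have dK := is_derive_Kap s11.
    have dp := is_derive_onem_sqr_powR alpha s11.
    eapply is_derive_eq; first by rewrite /J; derv.
    rewrite /= /g2 -split_powR; first by field.
    by rewrite (ltW s1)/= (le_trans (ltW s2)).
  - move=> s /andP[s1 s2]; have s11 : -1 < s < 1 by rewrite s1 (lt_le_trans s2).
    have dp := is_derive_onem_sqr_powR (alpha - 1) s11.
    exact: (is_derive_continuous (dervM (dervM (dervC s (alpha / 2)) dp) (dervX 4 (dervI s)))).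
  - by move=> s _.
have ig2 : (@lebesgue_measure R).-integrable `[-1, z] (EFin \o g2).
  apply/integrableP; split; first by apply/measurable_EFinP; exact: measurable_funTS.
  under eq_integral do rewrite /= ger0_norm//.
  by rewrite H ltry.
have -> : J1 alpha z = Defs.Rint (-1) z (fun s => (alpha + 1) * ((1 - s ^+ 2) `^ alpha * s ^+ 2) - g2 s).
  apply: eq_Rintegral => s; rewrite inE/= in_itv/= => /andP[s1 s2].
  by rewrite /g2 -split_powR ?s1 ?(le_trans s2)//; field.
rewrite /Defs.Rint RintegralB//; last exact: (integrableZl _ (alpha + 1) (Kap_integrable z2)).
rewrite RintegralZl//; last exact: Kap_integrable.
rewrite -/(Kap z) [X in _ - X]/Rintegral H /=.
rewrite /J -[X in (alpha + 1) * X]/(Kap z); ring.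
Qed.

Lemma I2E tau : tau <= 0 -> I2 alpha tau = J2 alpha tau 1.
Proof.
move=> tau0; apply: eq_Rintegral => s; rewrite inE/= in_itv/= => s11.
rewrite /qneg; case: (eqVneq tau 0) => [_|tau1]; first by rewrite mulrN.
(* At s = 1 or s = -1 the base is 0, and the exponent may be split there only because alpha - tau is
   nonzero. *)
rewrite powRD; last first.
  by apply/implyP => /eqP h; exfalso; have := alpha_gt0; lra.
by field.
Qed.

End moments.

(** * Parametrisation of arcs *)

Section arc_parametrization.
Context {R : realType}.
Implicit Types (q s t r w : R).

(* The angle [t = arcmap q s] solves [1 / cos t = 1 + q * s ^+ 2]. For [q = w / (1 - w)] the ray of
   angle [t] meets the line [z.1 = 1 - w] at radius [1 - w * (1 - s ^+ 2)], and
   [dt = Num.sqrt (2 * q) * arcker q s ds]. *)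
Definition arcmap q s : R := atan (s * (Num.sqrt (2 * q) * Num.sqrt (1 + q * s ^+ 2 / 2))).
Definition arcker q s : R := ((1 + q * s ^+ 2) * Num.sqrt (1 + q * s ^+ 2 / 2))^-1.

Lemma arc_gt0 q s : 0 < q -> 0 < 1 + q * s ^+ 2.
Proof. by move=> q0; rewrite ltr_wpDr// mulr_ge0 ?sqr_ge0// ltW. Qed.

Lemma half_arc_gt0 q s : 0 < q -> 0 < 1 + q * s ^+ 2 / 2.
Proof. by move=> q0; rewrite ltr_wpDr// divr_ge0// mulr_ge0 ?sqr_ge0// ltW. Qed.

Lemma arcker_gt0 q s : 0 < q -> 0 < arcker q s.
Proof. by move=> q0; rewrite invr_gt0 mulr_gt0 ?sqrtr_gt0 ?half_arc_gt0 ?arc_gt0. Qed.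

Lemma arc_tan_sqr q s : 0 < q ->
  1 + (s * (Num.sqrt (2 * q) * Num.sqrt (1 + q * s ^+ 2 / 2))) ^+ 2 = (1 + q * s ^+ 2) ^+ 2.
Proof.
move=> q0; rewrite 2!exprMn !sqr_sqrtr ?mulr_ge0 ?(ltW q0) ?(ltW (half_arc_gt0 _ q0))//.
by field.
Qed.

Lemma cos_arcmap q s : 0 < q -> cos (arcmap q s) = (1 + q * s ^+ 2)^-1.
Proof.
move=> q0; rewrite cos_atan arc_tan_sqr// sqrtr_sqr ger0_norm//.
exact/ltW/arc_gt0.
Qed.

Lemma is_derive_arcmap q s : 0 < q ->
  is_derive s 1 (arcmap q) (Num.sqrt (2 * q) * arcker q s).
Proof.
move=> q0; have h0 := half_arc_gt0 s q0; have h1 := arc_gt0 s q0.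
have dh : is_derive s 1 (fun t : R => 1 + q * t ^+ 2 / 2) (q * s).
  by derive_by; rewrite /= ?expr1; field.
have ds := dervSqrt (f := fun t : R => 1 + q * t ^+ 2 / 2) (x := s) h0 dh.
have D := dervComp
  (g := fun t : R => t * (Num.sqrt (2 * q) * Num.sqrt (1 + q * t ^+ 2 / 2)))
  (is_derive1_atan _) (dervM (dervI s) (dervM (dervC s (Num.sqrt (2 * q))) ds)).
apply: (is_derive_eq D); rewrite arc_tan_sqr// /arcker.
set v := Num.sqrt (1 + _); set c := Num.sqrt (2 * q).
have v0 : v != 0 by rewrite gt_eqF// sqrtr_gt0.
have v2 : v ^+ 2 = 1 + q * s ^+ 2 / 2 by rewrite sqr_sqrtr ?ltW.
have P0 : 1 + q * s ^+ 2 != 0 by rewrite gt_eqF.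
have -> : 1 * (c * v) + s * (0 * v + c * ((2 * v)^-1 * (q * s))) =
    c * (2 * v ^+ 2 + q * s ^+ 2) / (2 * v) by field.
have -> : 2 * v ^+ 2 + q * s ^+ 2 = 2 * (1 + q * s ^+ 2) by rewrite v2; field.
by field; rewrite v0 P0.
Qed.

Lemma arcmapN q s : arcmap q (- s) = - arcmap q s.
Proof. by rewrite /arcmap sqrrN mulNr atanN. Qed.

Lemma arcmap_lt q : 0 < q -> {mono arcmap q : s t / s < t}.
Proof.
move=> q0; apply: leW_mono; apply: le_mono => s t st.
have [c _ cE] := @MVT R (arcmap q) (fun s => Num.sqrt (2 * q) * arcker q s) s t st
  (fun x _ => is_derive_arcmap x q0)
  (continuous_subspaceT (fun x => is_derive_continuous (is_derive_arcmap x q0))).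
by rewrite -subr_gt0 cE !mulr_gt0 ?arcker_gt0 ?sqrtr_gt0 ?mulr_gt0// subr_gt0.
Qed.

Lemma continuous_arcker q : 0 < q -> continuous (arcker q).
Proof.
move=> q0 s.
have dh : is_derive s 1 (fun t : R => 1 + q * t ^+ 2 / 2) (q * s).
  by derive_by; rewrite /= ?expr1; field.
have dk : is_derive s 1 (fun t : R => 1 + q * t ^+ 2) (2 * q * s).
  by derive_by; rewrite /= ?expr1; ring.
have n0 : (1 + q * s ^+ 2) * Num.sqrt (1 + q * s ^+ 2 / 2) != 0.
  by rewrite gt_eqF// mulr_gt0 ?sqrtr_gt0 ?half_arc_gt0 ?arc_gt0.
have ds := dervSqrt (f := fun t : R => 1 + q * t ^+ 2 / 2) (x := s) (half_arc_gt0 s q0) dh.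
exact: (is_derive_continuous (dervV
  (f := fun t : R => (1 + q * t ^+ 2) * Num.sqrt (1 + q * t ^+ 2 / 2)) (x := s) n0 (dervM dk ds))).
Qed.

Lemma measurable_arcker q : 0 < q -> measurable_fun setT (arcker q).
Proof. by move=> q0; apply: continuous_measurable_fun; exact: continuous_arcker. Qed.

Lemma arcmap_FTC q a b : 0 < q -> a <= b ->
  (\int[lebesgue_measure]_(s in `]a, b[) (Num.sqrt (2 * q) * arcker q s)%:E =
   (arcmap q b - arcmap q a)%:E)%E.
Proof.
move=> q0; rewrite le_eqVlt => /orP[/eqP ->|ab].
  by rewrite set_itv_ge ?bnd_simp ?ltxx// integral_set0 subrr.
have mk : measurable_fun setT (fun s => Num.sqrt (2 * q) * arcker q s).
  by apply: measurable_funM; [exact: measurable_cst|exact: measurable_arcker].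
rewrite -(@integral_itv_bndoo _ _ _ _ true false); last first.
  by apply/measurable_EFinP; exact: measurable_funTS.
have C x : {for x, continuous (arcmap q)} := is_derive_continuous (is_derive_arcmap x q0).
apply: ge0_improper_FTC2 => //.
- by apply: cvg_at_right_filter; exact: C.
- by apply: cvg_at_left_filter; exact: C.
- by move=> x _; exact: is_derive_arcmap.
- move=> x _; apply: cvgM; first exact: cvg_cst.
  exact: continuous_arcker.
- by move=> x _; rewrite mulr_ge0// ltW// arcker_gt0.
Qed.

(** The part of the exceedance at radius [r] charged to the line z.1 = 1 - w. The bound [b] will be
    the angle of the crossing ray, where the other line takes over, or the end of the full arc. *)
Definition lower_arc w r (b : R) : set R := [set t | - pi <= t <= b /\ 1 - w < r * cos t].

(** For fixed [r] both sides measure one interval: the indicator means |s| < sigma with sigma^2 = 1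
    - (1 - r) / w, and [arcmap] carries sigma to the angle where the circle of radius [r] meets the
    line. Since r <= 1, also sigma <= 1, so the lower limit -1 cuts nothing off. *)
Lemma measure_lower_arc w r s0 : 0 < w < 1 -> 0 < r <= 1 -> -1 <= s0 <= 1 ->
  let q := w / (1 - w) in
  (lebesgue_measure (lower_arc w r (arcmap q s0)) =
   \int[lebesgue_measure]_(s in `[(-1)%R, s0])
     (Num.sqrt (2 * q) * arcker q s * \1_[set s : R | (1 - w * (1 - s ^+ 2) < r)%R] s)%:E)%E.
Proof.
move=> /andP[w0 w1] /andP[r0 r1] /andP[s01 s02] q.
have w1' : 0 < 1 - w by rewrite subr_gt0.
have q0 : 0 < q by rewrite divr_gt0.
pose k := 1 - (1 - r) / w.
have kP (s : R) : (1 - w * (1 - s ^+ 2) < r) = (s ^+ 2 < k).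
  by rewrite /k ltrBrDr -ltrBrDl ltr_pdivrMr//; apply/idP/idP; lra.
have [k0|k0] := leP k 0.
  have rw : r <= 1 - w.
    by move: k0; rewrite /k subr_le0 ler_pdivlMr// mul1r; lra.
  rewrite (_ : lower_arc _ _ _ = set0) ?measure0; last first.
    rewrite -subset0 => t [_]; apply/negP; rewrite -leNgt.
    by apply: le_trans rw; rewrite ger_pMr// cos_le1.
  rewrite integral0_eq// => s _; rewrite indicE memNset ?mulr0//=.
  by rewrite kP; apply/negP; rewrite -leNgt (le_trans k0)// sqr_ge0.
pose sg := Num.sqrt k.
have sg0 : 0 < sg by rewrite sqrtr_gt0.
have sg2 : sg ^+ 2 = k by rewrite sqr_sqrtr// ltW.
have k1 : k <= 1 by rewrite /k gerBl divr_ge0 ?subr_ge0 ?(ltW w0).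
have sg1 : sg <= 1 by rewrite -[leRHS](@sqrtr1 R) ler_wsqrtr.
have sP (s : R) : (1 - w * (1 - s ^+ 2) < r) = (- sg < s < sg).
  rewrite kP -sg2 -ltr_norml; apply/idP/idP => h.
    by rewrite -(@ltr_pXn2r _ 2) ?nnegrE ?(ltW sg0)// real_normK ?num_real.
  by rewrite -[s ^+ 2]real_normK ?num_real// ltr_pXn2r ?nnegrE ?(ltW sg0).
have Tpi t : - (pi / 2) < arcmap q t < pi / 2 by rewrite atan_gtNpi2 atan_ltpi2.
have pi0 := pi_gt0 R.
have T0 : arcmap q 0 = 0 by rewrite /arcmap mul0r atan0.
have Tsg0 : 0 < arcmap q sg by rewrite -T0 arcmap_lt.
have cosT : r * cos (arcmap q sg) = 1 - w.
  rewrite cos_arcmap// sg2 /k /q.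
  have -> : 1 + w / (1 - w) * (1 - (1 - r) / w) = r / (1 - w).
    by field; rewrite !gt_eqF.
  by rewrite invf_div mulrCA divff ?mulr1// gt_eqF.
have tP t : - pi <= t <= arcmap q s0 -> (1 - w < r * cos t) = (- arcmap q sg < t < arcmap q sg).
  move=> /andP[t1 t2]; have /andP[h1 h2] := Tpi s0; have /andP[h3 h4] := Tpi sg.
  have h5 : `|t| \in `[0, pi].
    by rewrite in_itv/= normr_ge0 ler_norml; apply/andP; split; lra.
  have h6 : arcmap q sg \in `[0, pi] by rewrite in_itv/= ltW//=; lra.
  by rewrite -cosT ltr_pM2l// -(cos_norm t) -ltr_norml ltr_cos.
have -> : lower_arc w r (arcmap q s0) =
    `](- arcmap q sg), (arcmap q sg)[ `&` `]-oo, (arcmap q s0)].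
  apply/seteqP; split=> t /=; rewrite !in_itv/=.
    by move=> [h]; rewrite tP// => ->; case/andP: h.
  move=> [h t2]; have /andP[h3 h4] := Tpi sg; have /andP[h1 h2] := h.
  have t3 : - pi <= t <= arcmap q s0 by rewrite t2 andbT; lra.
  by split => //; rewrite tP.
have mk : measurable_fun setT (fun s => Num.sqrt (2 * q) * arcker q s).
  by apply: measurable_funM; [exact: measurable_cst|exact: measurable_arcker].
have -> : (\int[lebesgue_measure]_(s in `[(-1)%R, s0])
     (Num.sqrt (2 * q) * arcker q s * \1_[set s : R | (1 - w * (1 - s ^+ 2) < r)%R] s)%:E =
   \int[lebesgue_measure]_(s in `[(-1)%R, s0] `&` `](- sg)%R, sg[)
     (Num.sqrt (2 * q) * arcker q s)%:E)%E.
  rewrite integral_mkcondr; apply: eq_integral => s _.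
  rewrite patchE indicE.
  have -> : (s \in [set s : R | 1 - w * (1 - s ^+ 2) < r]) = (s \in `](- sg)%R, sg[%classic).
    by apply/idP/idP; rewrite !inE/= in_itv/= sP.
  by case: ifP; rewrite ?mulr1 ?mulr0.
(* The endpoint [s0] leaves nothing of ]-sg, sg[, a truncated piece, or all of it. *)
have [s0sg|sgs0] := leP s0 (- sg).
  rewrite (_ : _ `&` _ = set0); last first.
    rewrite -subset0 => t []; rewrite /= !in_itv/= => /andP[h1 h2] h3.
    move: s0sg; rewrite leNgt -(arcmap_lt q0) arcmapN => /negP; apply.
    exact: lt_le_trans h3.
  rewrite measure0 (_ : _ `&` _ = set0) ?integral_set0//.
  rewrite -subset0 => t []; rewrite /= !in_itv/= => /andP[h1 h2] /andP[h3 h4].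
  by have := lt_le_trans h3 (le_trans h2 s0sg); rewrite ltxx.
have [s0sg|sgs0'] := ltP s0 sg.
  have -> : `](- arcmap q sg), (arcmap q sg)[ `&` `]-oo, (arcmap q s0)] =
      `](- arcmap q sg), (arcmap q s0)]%classic.
    apply/seteqP; split=> t /=; rewrite !in_itv/=.
      by move=> [/andP[-> _] ->].
    move=> /andP[h1 h2]; rewrite h1 h2 (le_lt_trans h2)//.
    by rewrite arcmap_lt.
  have -> : `[(-1)%R, s0] `&` `](- sg)%R, sg[ = `](- sg)%R, s0]%classic.
    apply/seteqP; split=> t /=; rewrite !in_itv/=.
      by move=> [/andP[_ ->] /andP[-> _]].
    by move=> /andP[h1 h2]; rewrite h1 h2 (le_lt_trans h2)//; split => //; lra.
  rewrite integral_itv_bndoo; last by apply/measurable_EFinP; exact: measurable_funTS.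
  rewrite arcmap_FTC//; last exact: ltW.
  rewrite lebesgue_measure_itv/= lte_fin -arcmapN arcmap_lt// sgs0.
  by rewrite EFinB.
have -> : `](- arcmap q sg), (arcmap q sg)[ `&` `]-oo, (arcmap q s0)] =
    `](- arcmap q sg), (arcmap q sg)[%classic.
  apply/seteqP; split=> t /=; rewrite !in_itv/=; first by case.
  move=> /andP[h1 h2]; rewrite h1 h2; split => //.
  by apply: le_trans (ltW h2) _; rewrite leNgt arcmap_lt// -leNgt.
have -> : `[(-1)%R, s0] `&` `](- sg)%R, sg[ = `](- sg)%R, sg[%classic.
  apply/seteqP; split=> t /=; rewrite !in_itv/=; first by case.
  move=> /andP[h1 h2]; rewrite h1 h2; split => //.
  by rewrite (le_trans (ltW h2))// andbT; lra.
rewrite arcmap_FTC//; last by lra.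
rewrite lebesgue_measure_itv/= lte_fin -arcmapN arcmap_lt// ifT; last by lra.
by rewrite EFinB.
Qed.

End arc_parametrization.

(** * Second-order expansion of tail integrals *)

Lemma arcker_expansion (R : realType) (w s : R) : 0 < w <= 1 / 2 -> -1 <= s <= 1 ->
  0 < arcker (w / (1 - w)) s <= 1 /\
  `|arcker (w / (1 - w)) s - 1 + 5 / 4 * w * s ^+ 2| <= 26 * w ^+ 2.
Proof.
move=> /andP[w0 w2]; rewrite sqr_itvP => s1; have s0 := sqr_ge0 s.
have w1 : 0 < 1 - w by lra.
set q := w / (1 - w).
have q0 : 0 < q by rewrite divr_gt0.
have qE : q = w + q * w by rewrite /q; field; rewrite gt_eqF.
have q2 : q <= 2 * w by rewrite /q ler_pdivrMr//; nra.
pose v := Num.sqrt (1 + q * s ^+ 2 / 2).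
have X0 : 0 <= q * s ^+ 2 by rewrite mulr_ge0// ltW.
have X1 : q * s ^+ 2 <= q by rewrite ger_pMr.
have v2 : v ^+ 2 = 1 + q * s ^+ 2 / 2 by rewrite sqr_sqrtr// ltW// half_arc_gt0.
have v0 : 0 <= v by exact: sqrtr_ge0.
have v1 : 1 <= v by rewrite -[leLHS](@sqrtr1 R) ler_wsqrtr//; lra.
(* In this variable q s^2 = 4 d + 2 d^2 and the square root is 1 + d, so [arcker] is the inverse of
   a cubic and the remainder is a rational function. *)
pose d := v - 1.
have d0 : 0 <= d by rewrite subr_ge0.
have XE : q * s ^+ 2 = 4 * d + 2 * d ^+ 2 by rewrite /d; lra.
have dq : 4 * d <= 2 * w by have := sqr_ge0 d; lra.
have kE : arcker q s = (1 + 5 * d + 6 * d ^+ 2 + 2 * d ^+ 3)^-1.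
  have vE : v = 1 + d by rewrite /d; ring.
  by rewrite /arcker -/v XE vE; congr (_^-1); ring.
have d30 : 0 <= d ^+ 3 by rewrite exprn_ge0.
have d20 : 0 <= d ^+ 2 by exact: sqr_ge0.
have D1 : 1 <= 1 + 5 * d + 6 * d ^+ 2 + 2 * d ^+ 3 by lra.
set D := 1 + 5 * d + _ + _ in kE D1.
have D0 : 0 < D by lra.
split; first by rewrite kE invr_gt0 D0/= invf_le1.
have -> : arcker q s - 1 + 5 / 4 * w * s ^+ 2 =
   (arcker q s - 1 + 5 / 4 * (q * s ^+ 2)) - 5 / 4 * (w * (q * s ^+ 2)).
  have wE : w = q - q * w by rewrite {1}qE; ring.
  by rewrite {1}wE; ring.
have -> : arcker q s - 1 + 5 / 4 * (q * s ^+ 2) =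
   (43 / 2 * d ^+ 2 + 81 / 2 * d ^+ 3 + 25 * d ^+ 4 + 5 * d ^+ 5) / D.
  by rewrite kE XE /D; field; rewrite gt_eqF.
have d1 : d <= 1 by lra.
have e2 : 0 <= d ^+ 2 by exact: sqr_ge0.
have e3 : 0 <= d ^+ 3 <= d ^+ 2 by rewrite exprn_ge0//= exprS ler_piMl.
have e4 : 0 <= d ^+ 4 <= d ^+ 2.
  by rewrite exprn_ge0//= (_ : d ^+ 4 = d ^+ 2 * d ^+ 2); [nra|ring].
have e5 : 0 <= d ^+ 5 <= d ^+ 2.
  by rewrite exprn_ge0//= (_ : d ^+ 5 = d ^+ 3 * d ^+ 2); [nra|ring].
(* The coefficients of [N] add up to 92; with d <= 1 and d^2 <= w^2 / 4 this gives 23 w^2.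
   Exchanging q for w in the linear term adds at most 5/2 w^2, hence the constant 26. *)
set N := _ + 5 * d ^+ 5.
have N0 : 0 <= N / D by rewrite divr_ge0 ?(ltW D0)// /N; lra.
have ND : N / D <= N by rewrite ler_pdivrMr// ler_peMr// /N; lra.
have dw : d ^+ 2 <= w ^+ 2 / 4 by nra.
have qw : 0 <= w * (q * s ^+ 2) <= 2 * w ^+ 2 by apply/andP; split; nra.
by rewrite ler_norml; apply/andP; split; rewrite /N in N0 ND *; nra.
Qed.

Lemma invr_powR (R : realType) (h a : R) : 0 < h -> h^-1 `^ a = h `^ (- a).
Proof. by move=> h0; rewrite -[h^-1]powR_inv1 ?(ltW h0)// -powRrM mulN1r. Qed.

Section tail_integrals.
Context {R : realType}.
Variables (Phi A : R -> R) (alpha tau : R).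
Hypothesis Phi_nd : {homo Phi : v w / v <= w}.
Hypothesis Phi_ge0 : forall w, 0 <= Phi w.
Hypothesis Phi_gt0 : forall w, 0 < w -> 0 < Phi w.
Hypothesis alpha_gt0 : 0 < alpha.
Hypothesis tau_le0 : tau <= 0.
Hypothesis PhiA : twoRV (fun t => Phi t^-1) alpha tau A.
Implicit Types (w s z : R).

(** Up to the factor [Num.sqrt (2 * q)], the expected length of a lower arc that ends at
    [arcmap q z]. *)
Definition tail_integral w z :=
  Defs.Rint (-1) z (fun s => Phi (w * (1 - s ^+ 2)) * arcker (w / (1 - w)) s).

Lemma tail_uniform_bound : exists C d : R, [/\ 0 < C, 0 < d & forall w h, 0 < w < d ->
  0 < h <= 1 -> `|Phi (w * h) / Phi w - h `^ alpha| <= C * `|A w^-1|].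
Proof.
have [||C [T [C0 T0 H]]] := @second_order_uniform_bound R (fun t => Phi t^-1) A alpha tau
   _ _ alpha_gt0 tau_le0 PhiA.
- by move=> t t0; rewrite Phi_gt0// invr_gt0.
- by move=> s t s0 st; apply: Phi_nd; rewrite lef_pV2 ?posrE// (lt_le_trans s0).
exists C, T^-1; split=> //; first by rewrite invr_gt0.
move=> w h /andP[w0 wT] /andP[h0 h1].
have := H w^-1 h^-1; rewrite -invfM !invrK invr_powR// opprK; apply.
  by rewrite -[T]invrK ltf_pV2 ?posrE ?invr_gt0.
by rewrite invf_ge1.
Qed.

Lemma tail_second_order_cvg (w : nat -> R) h : 0 < h -> (forall n, 0 < w n) ->
  w n @[n --> \oo] --> 0 ->
  (Phi (w n * h) / Phi (w n) - h `^ alpha) / A (w n)^-1 @[n --> \oo] -->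
    h `^ alpha * qneg tau h.
Proof.
move=> h0 w0 wcvg; have [_ [_ H]] := PhiA.
have vcvg : (w n)^-1 @[n --> \oo] --> +oo%R.
  apply/gtr0_cvgV0; first by apply: nearW => n; rewrite invr_gt0.
  by apply: near_eq_cvgR wcvg; apply: nearW => n; rewrite /= invrK.
have := H h^-1; rewrite invr_gt0 => /(_ h0) {}H.
have := cvg_comp _ _ vcvg H.
have -> : h^-1 `^ (- alpha) * hpow tau h^-1 = h `^ alpha * qneg tau h.
  by rewrite invr_powR// opprK /hpow /qneg lnV ?posrE// invr_powR.
apply: near_eq_cvgR; apply: nearW => n /=.
by rewrite -invfM !invrK invr_powR// opprK.
Qed.

Let err w s := Phi (w * (1 - s ^+ 2)) / Phi w * arcker (w / (1 - w)) s
  - ((1 - s ^+ 2) `^ alpha + (- (5 / 4 * w)) * ((1 - s ^+ 2) `^ alpha * s ^+ 2)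
     + A w^-1 * ((1 - s ^+ 2) `^ alpha * qneg tau (1 - s ^+ 2))).

Lemma measurable_J2_integrand :
  measurable_fun setT (fun s => (1 - s ^+ 2) `^ alpha * qneg tau (1 - s ^+ 2)).
Proof.
have mh : measurable_fun setT (fun s : R => 1 - s ^+ 2).
  by apply: measurable_funB; [exact: measurable_cst|exact: exprn_measurable].
apply: measurable_funM; first exact: measurable_onem_sqr_powR.
rewrite /qneg; case: (tau =P 0) => _.
  have ml := @measurable_ln R.
  by apply: measurableT_comp => //; exact: (measurableT_comp ml).
apply: measurable_funM; last exact: measurable_cst.
by apply: measurable_funB; [exact: measurable_onem_sqr_powR|exact: measurable_cst].
Qed.

Let measurable_Phi_integrand w : 0 < w < 1 ->
  measurable_fun setT (fun s => Phi (w * (1 - s ^+ 2)) / Phi w * arcker (w / (1 - w)) s).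
Proof.
move=> /andP[w0 w1].
apply: measurable_funM; last by apply: measurable_arcker; rewrite divr_gt0// subr_gt0.
apply: measurable_funM; last exact: measurable_cst.
have mP : measurable_fun setT Phi by apply: nondecreasing_measurable => // u v _ _; exact: Phi_nd.
apply: (measurableT_comp mP).
apply: measurable_funM; first exact: measurable_cst.
by apply: measurable_funB; [exact: measurable_cst|exact: exprn_measurable].
Qed.

Let measurable_err w : 0 < w < 1 -> measurable_fun setT (err w).
Proof.
move=> w01; apply: measurable_funB; first exact: measurable_Phi_integrand.
have ma := measurable_onem_sqr_powR alpha.
apply: measurable_funD.
  apply: measurable_funD; first exact: ma.
  apply: measurable_funM; first exact: measurable_cst.
  by apply: measurable_funM; [exact: ma|exact: exprn_measurable].
by apply: measurable_funM; [exact: measurable_cst|exact: measurable_J2_integrand].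
Qed.

Let small_w (w : nat -> R) : (forall n, 0 < w n < n.+1%:R^-1) -> w n @[n --> \oo] --> 0.
Proof.
move=> h; apply: (@squeeze_cvgr _ _ _ _ (fun=> 0) (@harmonic R)).
- by near=> n; have /andP[h1 h2] := h n; rewrite !ltW.
- exact: cvg_cst.
- exact: cvg_harmonic.
Unshelve. all: by end_near. Qed.

(** The function is the pointwise limit of normalised deviations, which [tail_uniform_bound] bounds
    by one constant. This treats the logarithm and the powers in [qneg] alike, including their
    behaviour near h = 0. *)
Lemma J2_integrand_bounded : exists2 C : R, 0 < C & forall h, 0 < h <= 1 ->
  `|h `^ alpha * qneg tau h| <= C.
Proof.
have [C [d [C0 d0 H]]] := tail_uniform_bound.
have [[t0 sgA] _] := PhiA.
exists C => // h /andP[h0 h1].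
pose e := Num.min d (Num.max 1 t0)^-1.
have e0 : 0 < e by rewrite lt_min d0 invr_gt0 lt_max ltr01.
pose w n : R := Num.min (e / 2) (n.+1%:R^-1 / 2).
have w0 n : 0 < w n by rewrite lt_min !divr_gt0.
have we n : w n < e.
  by rewrite (@le_lt_trans _ _ (e / 2)) ?ge_min ?lexx// ltr_pdivrMr// ltr_pMr//; lra.
have wcvg : w n @[n --> \oo] --> 0.
  apply: small_w => n; rewrite w0 (@le_lt_trans _ _ (n.+1%:R^-1 / 2)) ?ge_min ?lexx ?orbT//.
  by rewrite ltr_pdivrMr// ltr_pMr//; lra.
pose proof (cvg_norm (tail_second_order_cvg h0 w0 wcvg)) as lim.
rewrite -(cvg_lim _ lim)//; apply: limr_le; first exact: cvgP lim.
apply: nearW => n.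
have wd : 0 < w n < d by rewrite w0 (lt_le_trans (we n))// ge_min lexx.
have t0w : t0 <= (w n)^-1.
  have : e <= (Num.max 1 t0)^-1 by rewrite ge_min lexx orbT.
  move/(lt_le_trans (we n)) => /ltW; rewrite -{1}[w n]invrK lef_pV2 ?posrE ?invr_gt0//.
    by rewrite ge_max => /andP[].
  by rewrite lt_max ltr01.
have An : A (w n)^-1 != 0.
  by case: sgA => /(_ _ t0w) ?; [rewrite gt_eqF|rewrite lt_eqF].
rewrite normrM normfV ler_pdivrMr ?normr_gt0//.
by apply: H => //; rewrite h0.
Qed.

Lemma J2_integrable z : z <= 1 -> (@lebesgue_measure R).-integrable `[-1, z]
    (EFin \o (fun s => (1 - s ^+ 2) `^ alpha * qneg tau (1 - s ^+ 2))).
Proof.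
move=> z1; have [C C0 hC] := J2_integrand_bounded.
apply: (@bounded_integrable _ _ _ _ C); first exact: measurable_J2_integrand.
move=> s /andP[s0 s1].
have : 0 <= 1 - s ^+ 2 by apply: onem_sqr_ge0; rewrite s0 (le_trans s1).
rewrite le_eqVlt => /orP[/eqP <-|h0].
  by rewrite powR0 ?gt_eqF// mul0r normr0 ltW.
by apply: hC; rewrite h0 lerBlDr lerDl sqr_ge0.
Qed.

Let A_neq0 : exists2 d : R, 0 < d & forall w, 0 < w < d -> A w^-1 != 0.
Proof.
have [[t0 sgA] _] := PhiA.
have e0 : 0 < (Num.max 1 t0)^-1 by rewrite invr_gt0 lt_max ltr01.
exists (Num.max 1 t0)^-1 => // w /andP[w0 we].
have t0w : t0 <= w^-1.
  move/ltW: we; rewrite -{1}[w]invrK lef_pV2 ?posrE ?invr_gt0//.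
    by rewrite ge_max => /andP[].
  by rewrite lt_max ltr01.
by case: sgA => /(_ _ t0w) ?; [rewrite gt_eqF|rewrite lt_eqF].
Qed.

Let dev w s := (Phi (w * (1 - s ^+ 2)) / Phi w - (1 - s ^+ 2) `^ alpha) / A w^-1
  - (1 - s ^+ 2) `^ alpha * qneg tau (1 - s ^+ 2).

(** With H the power, a the value of [A], k the kernel and j the integrand of [J2], [err] is a dev k
    + a j (k - 1) + H (k - 1 + 5/4 w s^2). The first term carries the factor [dev], which tends to
    0; the others gain a factor w, since k - 1 = O(w) and the last bracket is O(w^2). *)
Let err_le_dev : exists C d : R, [/\ 0 < C, 0 < d <= 1 / 2 & forall w s, 0 < w < d ->
  -1 < s < 1 -> [/\ A w^-1 != 0, `|dev w s| <= C &
    `|err w s| <= (w + `|A w^-1|) * (`|dev w s| + C * w)]].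
Proof.
have [d1 d10 hA] := A_neq0.
have [C2 [d2 [C20 d20 hC2]]] := tail_uniform_bound.
have [C3 C30 hC3] := J2_integrand_bounded.
(* C2 + C3 bounds [dev]; 28 * C3 and 26 come from the kernel, through |k - 1| <= 28 w and the
   remainder in [arcker_expansion]. *)
pose C := C2 + 28 * C3 + 26.
exists C, (Num.min (1 / 2) (Num.min d1 d2)); split.
- by rewrite /C; lra.
- by rewrite !lt_min d10 d20 ge_min lexx !andbT; lra.
move=> w s /andP[w0]; rewrite !lt_min => /and3P[w2 wd1 wd2] s11.
have An : A w^-1 != 0 by apply: hA; rewrite w0.
have h01 : 0 < 1 - s ^+ 2 <= 1 by rewrite onem_sqr_gt0// lerBlDr lerDl sqr_ge0.
have sI : -1 <= s <= 1 by case/andP: s11 => /ltW -> /ltW ->.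
have [/andP[k0 k1] hk] : 0 < arcker (w / (1 - w)) s <= 1 /\
  `|arcker (w / (1 - w)) s - 1 + 5 / 4 * w * s ^+ 2| <= 26 * w ^+ 2.
  by apply: arcker_expansion => //; rewrite w0 ltW.
have b1 : `|(Phi (w * (1 - s ^+ 2)) / Phi w - (1 - s ^+ 2) `^ alpha) / A w^-1| <= C2.
  rewrite normrM normfV ler_pdivrMr ?normr_gt0//; apply: hC2 => //.
  by rewrite w0.
have b2 := hC3 _ h01.
split => //.
  by apply: le_trans (ler_normB _ _) _; rewrite /C; lra.
have /andP[p0 p1] := onem_sqr_powR_itv alpha_gt0 sI.
have s21 : 0 <= s ^+ 2 <= 1 by rewrite sqr_ge0 -sqr_itvP.
rewrite /err.
set P := _ / Phi w; set k := arcker _ _ in k0 k1 hk *; set a := A w^-1 in An b1 *.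
set H := _ `^ alpha in p0 p1 b1 b2 *; set j := H * qneg _ _ in b2 *.
have devE : P - H = a * (dev w s + j) by rewrite /dev -/P -/H -/j -/a subrK; field.
have -> : P * k - (H + - (5 / 4 * w) * (H * s ^+ 2) + a * j) =
   a * dev w s * k + a * j * (k - 1) + H * (k - 1 + 5 / 4 * w * s ^+ 2).
  by rewrite (_ : P = H + a * (dev w s + j)); [ring|rewrite -devE; ring].
have k11 : `|k - 1| <= 28 * w.
  have -> : k - 1 = (k - 1 + 5 / 4 * w * s ^+ 2) - 5 / 4 * w * s ^+ 2 by ring.
  apply: le_trans (ler_normB _ _) _.
  rewrite [`|5 / 4 * w * _|]ger0_norm; last by rewrite mulr_ge0//; lra.
  by nra.
have a0 : 0 <= `|a| by []. have dv0 : 0 <= `|dev w s| by [].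
have t1 : `|a * dev w s * k| <= `|a| * `|dev w s|.
  by rewrite !normrM (ger0_norm (ltW k0)) ler_piMr// mulr_ge0.
have t2 : `|a * j * (k - 1)| <= `|a| * (C3 * (28 * w)).
  by rewrite [`|a * j * _|]normrM [`|a * j|]normrM -mulrA; apply: ler_wpM2l => //; apply: ler_pM.
have t3 : `|H * (k - 1 + 5 / 4 * w * s ^+ 2)| <= 26 * w ^+ 2.
  by rewrite normrM (ger0_norm p0); apply: le_trans hk; rewrite ler_piMl.
apply: le_trans (ler_normD _ _) _; apply: le_trans (lerD (ler_normD _ _) (lexx _)) _.
apply: le_trans (lerD (lerD t1 t2) t3) _.
rewrite /C.
have -> : (w + `|a|) * (`|dev w s| + (C2 + 28 * C3 + 26) * w) =
  `|a| * `|dev w s| + `|a| * (C3 * (28 * w)) + 26 * w ^+ 2 +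
  (w * `|dev w s| + `|a| * ((C2 + 26) * w) + (C2 + 28 * C3) * w ^+ 2) by ring.
rewrite lerDl !addr_ge0 ?mulr_ge0 ?sqr_ge0 ?(ltW w0)//; lra.
Qed.

(** Arguing by contradiction produces a sequence w_n -> 0, to which dominated convergence applies:
    [dev] is bounded and tends to 0 at every interior point. Integrating |err| over all of ]-1, 1[
    is what later makes the expansion uniform in z. *)
Let err_integral_small e : 0 < e -> exists2 d : R, 0 < d <= 1 / 2 & forall w, 0 < w < d ->
  (\int[lebesgue_measure]_(s in `](-1)%R, 1%R[) (`|err w s| / (w + `|A w^-1|))%:E < e%:E)%E.
Proof.
move=> e0; apply: contrapT => hN.
have [C [d [C0 /andP[d0 d2] H]]] := err_le_dev.
have /choice[w hw] : forall n : nat, exists w, [/\ 0 < w < d, w < n.+1%:R^-1 &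
  (e%:E <= \int[lebesgue_measure]_(s in `](-1)%R, 1%R[) (`|err w s| / (w + `|A w^-1|))%:E)%E].
  move=> n; apply: contrapT => hn; apply: hN.
  exists (Num.min d n.+1%:R^-1).
    by rewrite lt_min d0 invr_gt0 ltr0n/= ge_min d2.
  move=> w /andP[w0]; rewrite lt_min => /andP[wd wn].
  by rewrite ltNge; apply/negP => h; apply: hn; exists w; rewrite w0 wd.
have wI n : 0 < w n < 1 by have [/andP[-> h] _ _] := hw n; lra.
have w0 n : 0 < w n by have /andP[] := wI n.
have wd n : 0 < w n < d by have [] := hw n.
have wcvg : w n @[n --> \oo] --> 0 by apply: small_w => n; rewrite w0; have [_ ->] := hw n.
have r0 n : 0 < w n + `|A (w n)^-1| by rewrite ltr_pwDl.
pose f (n : nat) (s : R) : \bar R := (`|err (w n) s| / (w n + `|A (w n)^-1|))%:E.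
have fle n s : -1 < s < 1 -> `|err (w n) s| / (w n + `|A (w n)^-1|) <= `|dev (w n) s| + C * w n.
  by move=> sI; rewrite ler_pdivrMr// mulrC; have [] := H (w n) s (wd n) sI.
have f0 n s : 0 <= `|err (w n) s| / (w n + `|A (w n)^-1|) by rewrite divr_ge0// ltW.
have mf n : measurable_fun (`]-1, 1[%classic : set R) (f n).
  apply/measurable_EFinP; apply: measurable_funTS.
  apply: measurable_funM; last exact: measurable_cst.
  by apply: measurableT_comp => //; exact: measurable_err.
have cf s : `]-1, 1[%classic s -> f n s @[n --> \oo] --> (cst 0%E : R -> \bar R) s.
  rewrite /= in_itv/= => sI; apply: cvg_EFin; first exact: nearW.
  apply: (@squeeze_cvgr _ _ _ _ (fun=> 0) (fun n => `|dev (w n) s| + C * w n)).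
  - by apply: nearW => n; rewrite f0/= fle.
  - exact: cvg_cst.
  - rewrite -[X in _ --> X]addr0; apply: cvgD.
      rewrite -[X in _ --> X](@normr0 _ R); apply: cvg_norm.
      rewrite -[X in _ --> X](subrr ((1 - s ^+ 2) `^ alpha * qneg tau (1 - s ^+ 2))).
      apply: cvgB; last exact: cvg_cst.
      by apply: tail_second_order_cvg => //; exact: onem_sqr_gt0.
    by rewrite -[X in _ --> X](mulr0 C); apply: cvgMr.
have bf s n : `]-1, 1[%classic s -> (`|f n s| <= (C + C * 1)%:E)%E.
  rewrite /= in_itv/= => sI; rewrite lee_fin ger0_norm//.
  apply: le_trans (fle n s sI) _; have [_ h _] := H (w n) s (wd n) sI.
  apply: lerD => //; rewrite ler_wpM2l ?(ltW C0)//.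
  by have /andP[_ /ltW] := wI n.
have ig : (@lebesgue_measure R).-integrable `](-1)%R, 1%R[ (cst (C + C * 1)%:E).
  apply: integrableS (@bounded_integrable R (cst (C + C * 1)) (-1) 1 (C + C * 1) _ _) => //.
    exact: subset_itv_oo_cc.
  by move=> s _; rewrite ger0_norm// addr_ge0 ?mulr_ge0 ?(ltW C0).
have [||||| _ _] := @dominated_convergence _ _ R (@lebesgue_measure R) `]-1, 1[
  (measurable_itv _) f (cst 0%E) (cst (C + C * 1)%:E).
- exact: mf.
- exact: measurable_cst.
- by apply: aeW => s; exact: cf.
- exact: ig.
- by apply: aeW => s n; exact: bf.
rewrite integral0 => lim.
have [N _ /(_ N (leqnn N))] : \forall n \near \oo,
    (\int[lebesgue_measure]_(s in `](-1)%R, 1%R[) f n s < e%:E)%E.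
  move/fine_cvgP : lim => [fin lim]; near=> n.
  have fn : (\int[lebesgue_measure]_(s in `](-1)%R, 1%R[) f n s)%E \is a fin_num by near: n.
  by rewrite -(fineK fn) lte_fin; near: n; exact: (cvgr_lt _ lim).
by apply/negP; rewrite -leNgt; have [] := hw N.
Unshelve. all: by end_near. Qed.

Lemma tail_integral_expansion e : 0 < e -> exists2 d : R, 0 < d <= 1 / 2 &
  forall w z, 0 < w < d -> -1 <= z <= 1 ->
  `|tail_integral w z / Phi w -
     (Psi alpha z - 5 / 4 * w * Kap alpha z + A w^-1 * J2 alpha tau z)|
   <= e * (w + `|A w^-1|).
Proof.
move=> e0; have [d /andP[d0 d2] H] := err_integral_small e0.
exists d; first by rewrite d0.
move=> w z wd /andP[z0 z1].
have /andP[w0 wd'] := wd.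
have w01 : 0 < w < 1 by lra.
have P0 := Phi_gt0 w0.
have q0 : 0 < w / (1 - w) by rewrite divr_gt0// subr_gt0; lra.
have iJ := J2_integrable z1.
have iP : (@lebesgue_measure R).-integrable `[-1, z]
    (EFin \o (fun s => Phi (w * (1 - s ^+ 2)) / Phi w * arcker (w / (1 - w)) s)).
  apply: (@bounded_integrable _ _ _ _ 1); first exact: measurable_Phi_integrand.
  move=> s /andP[s0 s1].
  have sI : -1 <= s <= 1 by rewrite s0 (le_trans s1).
  have [/andP[k0 k1] _] : 0 < arcker (w / (1 - w)) s <= 1 /\
    `|arcker (w / (1 - w)) s - 1 + 5 / 4 * w * s ^+ 2| <= 26 * w ^+ 2.
    by apply: arcker_expansion => //; lra.
  have q1 : 0 <= Phi (w * (1 - s ^+ 2)) / Phi w by rewrite divr_ge0 ?(ltW P0).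
  have q2 : Phi (w * (1 - s ^+ 2)) / Phi w <= 1.
    rewrite ler_pdivrMr// mul1r; apply: Phi_nd.
    by rewrite ger_pMr// lerBlDr lerDl sqr_ge0.
  rewrite ger0_norm; last exact: mulr_ge0 q1 (ltW k0).
  exact: mulr_ile1 q1 (ltW k0) q2 k1.
have mI : measurable (`[-1, z]%classic : set (measurableTypeR R)) by exact: measurable_itv.
have iPsi := Psi_integrable alpha_gt0 z1.
have iK := integrableZl mI (- (5 / 4 * w)) (Kap_integrable alpha_gt0 z1).
have iAJ := integrableZl mI (A w^-1) iJ.
have iPK := integrableD mI iPsi iK.
have iG := integrableD mI iPK iAJ.
have iE := integrableB mI iP iG.
have E1 : tail_integral w z / Phi w = Defs.Rint (-1) z
    (fun s => Phi (w * (1 - s ^+ 2)) / Phi w * arcker (w / (1 - w)) s).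
  apply: (canLR (mulfK (lt0r_neq0 P0))); rewrite mulrC /Defs.Rint -RintegralZl//.
  by apply: eq_Rintegral => s _; field; rewrite gt_eqF.
have E2 : Psi alpha z - 5 / 4 * w * Kap alpha z + A w^-1 * J2 alpha tau z =
    Defs.Rint (-1) z (fun s => (1 - s ^+ 2) `^ alpha +
       (- (5 / 4 * w)) * ((1 - s ^+ 2) `^ alpha * s ^+ 2)
     + A w^-1 * ((1 - s ^+ 2) `^ alpha * qneg tau (1 - s ^+ 2))).
  rewrite /Defs.Rint RintegralD// RintegralD// !RintegralZl//; last exact: Kap_integrable.
  by rewrite -mulNr.
have E3 : tail_integral w z / Phi w -
     (Psi alpha z - 5 / 4 * w * Kap alpha z + A w^-1 * J2 alpha tau z) =
     Defs.Rint (-1) z (err w).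
  by rewrite E1 E2 /Defs.Rint -RintegralB.
rewrite E3.
pose r := w + `|A w^-1|.
have r0 : 0 < r by rewrite ltr_pwDl.
have iE' : (@lebesgue_measure R).-integrable `[-1, z] (EFin \o err w) by exact: iE.
have iN : (@lebesgue_measure R).-integrable `[-1, z] (EFin \o (fun s => `|err w s|)).
  exact: (integrable_norm iE').
apply: le_trans (le_normr_Rintegral mI iE') _.
have iNr := integrableZl mI r^-1 iN.
have iNr' : (@lebesgue_measure R).-integrable `[-1, z] (EFin \o (fun s => `|err w s| / r)).
  by apply: eq_integrable iNr => // s _; rewrite /= -EFinM mulrC.
rewrite -ler_pdivrMr// -RintegralZr// -lee_fin /Rintegral fineK; last exact: integrable_fin_num.
have mE : measurable_fun setT (fun s => (`|err w s| / r)%:E).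
  apply/measurable_EFinP; apply: measurable_funM; last exact: measurable_cst.
  by apply: measurableT_comp => //; exact: measurable_err.
apply: le_trans (ltW (H w wd)).
rewrite -[leRHS](@integral_itv_bndoo _ _ _ _ true false); last exact: measurable_funTS.
apply: ge0_subset_integral => //.
- exact: measurable_funTS.
- by move=> s _; rewrite lee_fin divr_ge0// ltW.
- by apply: subset_itvl; rewrite bnd_simp.
Qed.

End tail_integrals.

(** * Polar coordinates *)

Section polar_coordinates.
Context {R : realType} {d : measure_display} {T : measurableType d} (P : probability T R).
Variables (S1 S2 Rad Th : T -> R).
Hypotheses (mS1 : measurable_fun setT S1) (mS2 : measurable_fun setT S2).
Hypotheses (mRad : measurable_fun setT Rad) (mTh : measurable_fun setT Th).
Hypothesis hsph : forall B : set (R * R), measurable B ->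
  P ((fun w => (S1 w, S2 w)) @^-1` B)
  = P ((fun w => (Rad w * cos (Th w), Rad w * sin (Th w))) @^-1` B).
Hypothesis hunif : forall B : set R, measurable B ->
  P (Th @^-1` B) = (lebesgue_measure (B `&` `[0%R, (2 * pi)%R[) * ((2 * pi)^-1)%R%:E)%E.
Hypothesis hind : forall A B : set R, measurable A -> measurable B ->
  P (Rad @^-1` A `&` Th @^-1` B) = (P (Rad @^-1` A) * P (Th @^-1` B))%E.

Definition ray_angles (E : set (R * R)) (r : R) : set R := [set t | E (r * cos t, r * sin t)].

Let cosm : measurable_fun setT (@cos R).
Proof. by apply: continuous_measurable_fun; exact: continuous_cos. Qed.

Let sinm : measurable_fun setT (@sin R).
Proof. by apply: continuous_measurable_fun; exact: continuous_sin. Qed.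

Let polar_map (x : R * R) : R * R := (x.1 * cos x.2, x.1 * sin x.2).

Let measurable_polar_map : measurable_fun setT polar_map.
Proof.
apply: measurable_fun_pair; apply: measurable_funM => //.
- exact: (measurableT_comp cosm measurable_snd).
- exact: (measurableT_comp sinm measurable_snd).
Qed.

Lemma measurable_ray_angles (E : set (R * R)) r : measurable E -> measurable (ray_angles E r).
Proof.
move=> mE.
have m : measurable_fun setT (fun t : R => (r * cos t, r * sin t)).
  by apply: measurable_fun_pair; apply: measurable_funM => //; exact: measurable_cst.
by rewrite -[X in measurable X]setTI; exact: m.
Qed.

Let lebesgue_split (D : set R) (a b c : R) : measurable D -> a <= b <= c ->
  lebesgue_measure (D `&` `[a, c[) =
  (lebesgue_measure (D `&` `[a, b[) + lebesgue_measure (D `&` `[b, c[))%E.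
Proof.
move=> mD /andP[ab bc].
have -> : D `&` `[a, c[ = (D `&` `[a, b[) `|` (D `&` `[b, c[).
  rewrite -setIUr; congr (_ `&` _); apply/seteqP; split => t /=; rewrite !in_itv/=.
    by move=> /andP[h1 h2]; have [tb|bt] := ltP t b; [left; rewrite h1|right; rewrite h2].
  by move=> [] /andP[h1 h2]; rewrite ?h1 ?h2 ?(lt_le_trans h2) ?(le_trans ab).
apply: measureU; [exact: measurableI|exact: measurableI|].
rewrite -subset0 => t [[_ +] [_ +]]; rewrite /= !in_itv/= => /andP[_ h1] /andP[h2 _].
by move: (lt_le_trans h1 h2); rewrite ltxx.
Qed.

Lemma lebesgue_full_turn (D : set R) : measurable D -> (forall t, D (t + 2 * pi) <-> D t) ->
  lebesgue_measure (D `&` `[0, 2 * pi[) = lebesgue_measure (D `&` `[- pi, pi[).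
Proof.
move=> mD per.
have pi0 := pi_gt0 R.
rewrite (@lebesgue_split D 0 pi)//; last by apply/andP; split; lra.
rewrite (@lebesgue_split D (- pi) 0)//; last by apply/andP; split; lra.
rewrite addeC; congr (_ + _)%E.
rewrite -(@lebesgue_measure_translate R (D `&` `[pi, 2 * pi[) (2 * pi)); last exact: measurableI.
congr lebesgue_measure; apply/seteqP; split => t /=; rewrite !in_itv/= => -[h1 /andP[h2 h3]].
  by split; [apply/per|apply/andP; split; lra].
by split; [apply/per|apply/andP; split; lra].
Qed.

(** [Rad] may be negative. Reversing its sign is a rotation by pi, which a full turn of angles does
    not notice, so only |Rad| matters. *)
Lemma lebesgue_ray_angles (E : set (R * R)) r : measurable E ->
  lebesgue_measure (ray_angles E r `&` `[0, 2 * pi[) =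
  lebesgue_measure (ray_angles E `|r| `&` `[- pi, pi[).
Proof.
have pi0 := pi_gt0 R; move=> mE.
have per r' t : ray_angles E r' (t + 2 * pi) <-> ray_angles E r' t.
  by rewrite /ray_angles /= mulr_natl cosD2pi sinD2pi.
have mr r' := @measurable_ray_angles E r' mE.
have [r0|r0] := leP 0 r.
  by rewrite ger0_norm// lebesgue_full_turn.
rewrite ltr0_norm// lebesgue_full_turn//.
rewrite -(@lebesgue_full_turn (ray_angles E (- r)))//.
rewrite -(@lebesgue_measure_translate R (ray_angles E (- r) `&` `[0, 2 * pi[) pi); last exact: measurableI.
congr lebesgue_measure; apply/seteqP; split => t /=; rewrite !in_itv/= => -[h1 /andP[h2 h3]].
  split; last by apply/andP; split; lra.
  by rewrite /ray_angles /= cosDpi sinDpi !mulrNN.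
split; last by apply/andP; split; lra.
by move: h1; rewrite /ray_angles /= cosDpi sinDpi !mulrNN.
Qed.

(** Independence makes the law of (Rad, Th) a product measure, being determined by its values on
    rectangles. Sectioning it along the radius leaves, for each radius, the uniform measure of a set
    of angles. *)
Lemma polar_probability (E : set (R * R)) : measurable E ->
  P ((fun w => (S1 w, S2 w)) @^-1` E) =
  (\int[P]_w (lebesgue_measure (ray_angles E `|Rad w| `&` `[(- pi)%R, pi[) * ((2 * pi)^-1)%:E))%E.
Proof.
move=> mE; rewrite hsph//.
pose RV : {mfun T >-> R} := HB.pack Rad (isMeasurableFun.Build _ _ _ _ Rad mRad).
pose TV : {mfun T >-> R} := HB.pack Th (isMeasurableFun.Build _ _ _ _ Th mTh).
have mRT : measurable_fun setT (fun w => (Rad w, Th w)) by exact: measurable_fun_pair.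
pose RTV : {mfun T >-> (R * R)%type} := HB.pack (fun w => (Rad w, Th w))
  (isMeasurableFun.Build _ _ _ _ (fun w => (Rad w, Th w)) mRT).
pose X := polar_map @^-1` E.
have mX : measurable X.
  by rewrite -[X in measurable X]setTI; exact: measurable_polar_map.
have -> : P ((fun w => (Rad w * cos (Th w), Rad w * sin (Th w))) @^-1` E) =
   distribution P RTV X by [].
rewrite -(@product_measure_unique _ _ _ _ R (distribution P RV) (distribution P TV)
  (distribution P RTV) _ _ mX); last first.
  move=> A B mA mB; rewrite /distribution /pushforward -hind//.
rewrite /product_measure1.
have mx := @measurable_fun_xsection _ _ _ _ R (distribution P TV) _ mX.
rewrite ge0_integral_distribution//.
apply: eq_integral => w _ /=.
rewrite -lebesgue_ray_angles// /distribution /pushforward hunif; last exact: measurable_xsection.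
congr (lebesgue_measure (_ `&` _) * _)%E.
by apply/seteqP; split => t /=; rewrite /xsection /= inE.
Qed.

End polar_coordinates.

(** * Angular form of the joint exceedance *)

Lemma cos_le0 (R : realType) (t : R) : pi / 2 <= t <= 3 / 2 * pi -> cos t <= 0.
Proof.
move=> /andP[t1 t2]; rewrite -(subrK pi t) cosDpi oppr_le0 cos_ge0_pihalf//.
by apply/andP; split; lra.
Qed.

Lemma cos_gt0_itv (R : realType) (t : R) : 0 < cos t -> - (3 / 2 * pi) <= t <= 3 / 2 * pi ->
  - (pi / 2) < t < pi / 2.
Proof.
move=> c0 /andP[t1 t2]; rewrite !ltNge; apply/andP; split; apply/negP => h; move: c0.
  by rewrite -cosN ltNge cos_le0//; apply/andP; split; lra.
by rewrite ltNge cos_le0// h.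
Qed.

Section two_arcs.
Context {R : realType}.
Variables (wx wy rho : R).
Hypotheses (wx01 : 0 < wx < 1) (wy01 : 0 < wy < 1) (rho01 : 0 < rho < 1).

Let u := 1 - wx.
Let v := 1 - wy.
Let sr := Num.sqrt (1 - rho ^+ 2).
Let phi := acos rho.

(* Slope of the ray through the intersection of the lines [z.1 = 1 - a] and
   [c * z.1 + Num.sqrt (1 - c ^+ 2) * z.2 = 1 - b]. *)
Definition crossing_tan (a b c : R) : R := ((1 - b) / (1 - a) - c) / Num.sqrt (1 - c ^+ 2).

Let th0 := atan (crossing_tan wx wy rho).
Let th1 := atan (crossing_tan wy wx rho).

Let u_gt0 : 0 < u. Proof. by have /andP[_ ?] := wx01; rewrite subr_gt0. Qed.
Let v_gt0 : 0 < v. Proof. by have /andP[_ ?] := wy01; rewrite subr_gt0. Qed.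

Let rhoI : -1 <= rho <= 1. Proof. by have /andP[? ?] := rho01; apply/andP; split; lra. Qed.

Let sr_gt0 : 0 < sr.
Proof. by rewrite sqrtr_gt0 onem_sqr_gt0//; have /andP[? ?] := rho01; apply/andP; split; lra. Qed.

Let sr_sqr : sr ^+ 2 = 1 - rho ^+ 2.
Proof. by rewrite sqr_sqrtr// onem_sqr_ge0. Qed.

Let cos_phi : cos phi = rho. Proof. by rewrite acosK// in_itv. Qed.
Let sin_phi : sin phi = sr. Proof. exact: sin_acos. Qed.

Let phi_itv : 0 < phi < pi / 2.
Proof.
have /andP[r0 r1] := rho01.
apply/andP; split; first by rewrite acos_gt0// ltW//; lra.
have p0 : 0 <= phi by exact: acos_ge0.
have p1 : phi <= pi by exact: acos_lepi.
have pi0 := pi_gt0 R.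
have := @cos_gt0_itv R phi; rewrite cos_phi => /(_ r0) h.
by have /andP[] : - (pi / 2) < phi < pi / 2 by apply: h; apply/andP; split; lra.
Qed.

Let th0_itv : - (pi / 2) < th0 < pi / 2.
Proof. by rewrite atan_gtNpi2 atan_ltpi2. Qed.

Let cos_th0_gt0 : 0 < cos th0. Proof. exact: cos_gt0_pihalf. Qed.

Let sin_th0 : sin th0 = (v / u - rho) / sr * cos th0.
Proof.
have : tan th0 = (v / u - rho) / sr by rewrite atanK.
by rewrite /tan => <-; rewrite divfK// gt_eqF.
Qed.

Let cos_phi_sub_th0 : cos (phi - th0) = v / u * cos th0.
Proof.
rewrite cosB cos_phi sin_phi sin_th0; field.
by rewrite !gt_eqF.
Qed.

(** In polar coordinates rho * z.1 + sr * z.2 is r cos (phi - t), so t -> phi - t exchanges the two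
    lines, and the crossing ray has angle th0 from one normal and th1 from the other. Both sides lie
    in ]-pi/2, pi/2[ and have the same tangent. *)
Let th1E : phi - th0 = th1.
Proof.
have /andP[p0 p1] := phi_itv; have /andP[t0 t1] := th0_itv; have pi0 := pi_gt0 R.
have c0 : 0 < cos (phi - th0) by rewrite cos_phi_sub_th0 mulr_gt0// divr_gt0.
have /andP[b0 b1] : - (pi / 2) < phi - th0 < pi / 2.
  by apply: cos_gt0_itv => //; apply/andP; split; lra.
rewrite -[LHS]tanK ?in_itv/=; last by apply/andP; split; lra.
congr atan; rewrite /tan sinB sin_phi cos_phi cos_phi_sub_th0 sin_th0 /crossing_tan -/u -/v -/sr.
apply: (canLR (mulfK _)); first by rewrite !mulf_neq0 ?invr_neq0// gt_eqF.
have -> : sr * cos th0 - rho * ((v / u - rho) / sr * cos th0) =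
  cos th0 / sr * (sr ^+ 2 - rho * (v / u) + rho ^+ 2) by field; rewrite !gt_eqF.
by rewrite sr_sqr; field; rewrite !gt_eqF.
Qed.

Definition exceedance : set (R * R) := [set z | u < z.1 \/ v < rho * z.1 + sr * z.2].

Lemma measurable_exceedance : measurable exceedance.
Proof.
have m1 : measurable_fun setT (fun z : R * R => z.1) by exact: measurable_fst.
have m2 : measurable_fun setT (fun z : R * R => rho * z.1 + sr * z.2).
  by apply: measurable_funD; apply: measurable_funM => //; exact: measurable_cst.
have -> : exceedance = (setT `&` (fun z : R * R => z.1) @^-1` `]u, +oo[) `|`
    (setT `&` (fun z : R * R => rho * z.1 + sr * z.2) @^-1` `]v, +oo[).
  by apply/seteqP; split => z /=; rewrite /exceedance /= !in_itv/= !andbT; tauto.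
by apply: measurableU; [exact: m1|exact: m2].
Qed.

Let ray_exceedance r t : ray_angles exceedance r t <-> (u < r * cos t \/ v < r * cos (phi - t)).
Proof.
rewrite /ray_angles /exceedance /= cosB cos_phi sin_phi.
have -> : rho * (r * cos t) + sr * (r * sin t) = r * (rho * cos t + sr * sin t) by ring.
by [].
Qed.

(** On a ray where both cosines are positive, the first line is met before the second exactly when
    the left side is positive; so the sign of sin (th0 - t) decides which line is met first. *)
Let crossing_sign t : v / u * cos t - cos (phi - t) = sr * (sin (th0 - t) / cos th0).
Proof.
rewrite cosB cos_phi sin_phi sinB sin_th0; field.
by rewrite !gt_eqF.
Qed.

Lemma measurable_lower_arc (w r b : R) : measurable (lower_arc w r b).
Proof.
have cosm : measurable_fun setT (fun t : R => r * cos t).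
  apply: measurable_funM; first exact: measurable_cst.
  by apply: continuous_measurable_fun; exact: continuous_cos.
have -> : lower_arc w r b = `[- pi, b] `&` (setT `&` (fun t => r * cos t) @^-1` `]1 - w, +oo[).
  by apply/seteqP; split => t /=; rewrite /lower_arc /= !in_itv/= andbT; tauto.
by apply: measurableI; [exact: measurable_itv|exact: cosm].
Qed.

(** Up to th0, being beyond the second line entails being beyond the first; after th0 it is the
    reverse. Hence the union splits at th0 into two arcs. The second is a lower arc reflected by t
    -> phi - t, and the two share at most the point th0. *)
Lemma measure_two_arcs r : 0 < r ->
  lebesgue_measure (ray_angles exceedance r `&` `[- pi, pi[) =
  (lebesgue_measure (lower_arc wx r th0) + lebesgue_measure (lower_arc wy r th1))%E.
Proof.
move=> r0.
have /andP[p0 p1] := phi_itv; have /andP[t0 t1] := th0_itv; have pi0 := pi_gt0 R.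
have /andP[t0' t1'] : - (pi / 2) < th1 < pi / 2 by rewrite atan_gtNpi2 atan_ltpi2.
pose B : set R := (fun t => phi - t) @^-1` lower_arc wy r th1.
have mA := measurable_lower_arc wx r th0.
have mL := measurable_lower_arc wy r th1.
have BE : lebesgue_measure B = lebesgue_measure (lower_arc wy r th1).
  rewrite -(@lebesgue_measure_translate R (lower_arc wy r th1) phi)//.
  have mL' : measurable ((fun t => t + phi) @^-1` lower_arc wy r th1).
    have mf : measurable_fun setT (fun t : R => t + phi).
      by apply: measurable_funD => //; exact: measurable_cst.
    by rewrite -[X in measurable X]setTI; exact: mf.
  rewrite -[RHS](lebesgue_measureN mL') /pushforward.
  by congr lebesgue_measure; apply/seteqP; split => t /=; rewrite addrC.
have mB : measurable B.
  have mf : measurable_fun setT (fun t : R => phi - t).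
    by apply: measurable_funB => //; exact: measurable_cst.
  by rewrite -[X in measurable X]setTI; exact: mf.
have BP t : B t <-> th0 <= t < pi /\ v < r * cos (phi - t).
  rewrite /B /lower_arc /= -th1E -/v; split=> -[h1 h2]; split => //.
    have c0 : 0 < cos (phi - t) by rewrite -(pmulr_rgt0 _ r0) (lt_trans v_gt0).
    move: h1 => /andP[h3 h4].
    have /andP[h5 h6] : - (pi / 2) < phi - t < pi / 2.
      by apply: cos_gt0_itv => //; apply/andP; split; lra.
    by apply/andP; split; lra.
  by move: h1 => /andP[h3 h4]; apply/andP; split; lra.
have AU : ray_angles exceedance r `&` `[- pi, pi[ = lower_arc wx r th0 `|` (B `\` [set th0]).
  apply/seteqP; split=> t /=.
    move=> [/ray_exceedance tE]; rewrite in_itv/= => /andP[t2 t3].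
    have [tt|tt] := leP t th0.
      left; split; first by rewrite t2.
      case: tE => // tE.
      have c0 : 0 < cos (phi - t) by rewrite -(pmulr_rgt0 _ r0) (lt_trans v_gt0).
      have s0 : 0 <= v / u * cos t - cos (phi - t).
        (* For t < - pi / 2 the angle phi - t lies between pi / 2 and 3 pi / 2, where the cosine is
           not positive. *)
        have [tp|tp] := leP (- (pi / 2)) t.
          rewrite crossing_sign mulr_ge0 ?(ltW sr_gt0)// divr_ge0 ?(ltW cos_th0_gt0)//.
          by apply: sin_ge0_pi; apply/andP; split; lra.
        have /andP[h5 h6] : - (pi / 2) < phi - t < pi / 2.
          by apply: cos_gt0_itv => //; apply/andP; split; lra.
        by exfalso; lra.
      have : v < v / u * (r * cos t).
        apply: lt_le_trans tE _; rewrite mulrCA ler_pM2l//; lra.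
      by rewrite mulrAC -mulrA ltr_pMr// ltr_pdivlMr// mul1r.
    right; split; last by apply/eqP; rewrite gt_eqF.
    apply/BP; split; first by rewrite ltW.
    case: tE => // tE.
    have c0 : 0 < cos t by rewrite -(pmulr_rgt0 _ r0) (lt_trans u_gt0).
    have /andP[h5 h6] : - (pi / 2) < t < pi / 2.
      by apply: cos_gt0_itv => //; apply/andP; split; lra.
    have s0 : v / u * cos t - cos (phi - t) <= 0.
      rewrite crossing_sign pmulr_rle0// pmulr_lle0 ?invr_gt0//.
      rewrite -[_ - t]opprB sinN oppr_le0.
      by apply: sin_ge0_pi; apply/andP; split; lra.
    apply: (@lt_le_trans _ _ (r * (v / u * cos t))); last by rewrite ler_pM2l//; lra.
    by rewrite mulrCA mulrAC -mulrA ltr_pMr// ltr_pdivlMr// mul1r.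
  move=> [[/andP[h1 h2] h3]|[/BP[/andP[h1 h2] h3] h4]].
    split; first by apply/ray_exceedance; left.
    by rewrite in_itv/= h1; lra.
  split; first by apply/ray_exceedance; right.
  by rewrite in_itv/= h2 andbT; lra.
have m1 : measurable [set th0] by exact: measurable_set1.
have mBD : measurable (B `\` [set th0]) by exact: measurableD.
have E0 : lebesgue_measure (lower_arc wx r th0 `|` (B `\` [set th0])) =
   (lebesgue_measure (lower_arc wx r th0) + lebesgue_measure (B `\` [set th0]))%E.
  apply: measureU => //; rewrite -subset0 => t [[/andP[_ h1] _] [/BP[/andP[h2 _] _] h3]].
  by apply: h3 => /=; apply/eqP; rewrite eq_le h1 h2.
have E1 : lebesgue_measure B = (lebesgue_measure (B `\` [set th0]) + lebesgue_measure (B `&` [set th0]))%E.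
  have -> : lebesgue_measure B = lebesgue_measure ((B `\` [set th0]) `|` (B `&` [set th0])).
    congr lebesgue_measure; apply/seteqP; split=> [t Bt|t [[]//|[]//]].
    by have [tth|tth] := pselect (t = th0); [right|left].
  apply: measureU => //; first exact: measurableI.
  by rewrite -subset0 => t [[_ h1] [_ h2]].
have E2 : lebesgue_measure (B `&` [set th0]) = 0%E.
  have le : (lebesgue_measure (B `&` [set th0]) <= lebesgue_measure [set th0])%E.
    by apply: le_measure; rewrite ?inE//; exact: measurableI.
  by apply/eqP; rewrite eq_le measure_ge0 andbT -(lebesgue_measure_set1 th0).
by rewrite AU E0 -BE E1 E2 adde0.
Qed.

End two_arcs.

(** * Arcs averaged over the radius *)

Lemma measurable_lt_fun (R : realType) d (U : measurableType d) (f g : U -> R) :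
  measurable_fun setT f -> measurable_fun setT g -> measurable [set x | f x < g x].
Proof.
move=> mf mg; have h := measurable_fun_ltr mf mg.
have : measurable (setT `&` (fun x => f x < g x) @^-1` [set true]) by exact: h.
by rewrite setTI (_ : _ @^-1` _ = [set x | f x < g x]).
Qed.

Lemma arcker_le1 (R : realType) (q s : R) : 0 < q -> arcker q s <= 1.
Proof.
move=> q0; rewrite invf_le1 ?mulr_gt0 ?sqrtr_gt0 ?half_arc_gt0 ?arc_gt0//.
have X0 : 0 <= q * s ^+ 2 by rewrite mulr_ge0 ?sqr_ge0// ltW.
have h1 : 1 <= 1 + q * s ^+ 2 by rewrite lerDl.
have h2 : 1 <= Num.sqrt (1 + q * s ^+ 2 / 2).
  by rewrite -[leLHS](@sqrtr1 R) ler_wsqrtr// lerDl divr_ge0.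
exact: mulr_ege1.
Qed.

Section expected_arc.
Context {R : realType} {d : measure_display} {T : measurableType d} (P : probability T R).
Variable Rad : T -> R.
Hypothesis mRad : measurable_fun setT Rad.
Variable Phi : R -> R.
Hypothesis PhiE : forall w, (Phi w)%:E = P [set x | 1 - w < `|Rad x|].
Hypothesis Rad_gt0 : {ae P, forall x, 0 < `|Rad x|}.
Hypothesis Rad_le1 : {ae P, forall x, `|Rad x| <= 1}.

Let mN : measurable_fun setT (fun x => `|Rad x|).
Proof. exact: measurableT_comp. Qed.

Lemma Phi_ge0 w : 0 <= Phi w.
Proof. by rewrite -lee_fin PhiE. Qed.

Lemma Phi_le1 w : Phi w <= 1.
Proof.
rewrite -lee_fin PhiE probability_le1//.
exact: (measurable_lt_fun (measurable_cst _) mN).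
Qed.

Lemma Phi_nd : {homo Phi : v w / v <= w}.
Proof.
move=> v w vw; rewrite -lee_fin !PhiE; apply: le_measure; rewrite ?inE.
- exact: (measurable_lt_fun (measurable_cst _) mN).
- exact: (measurable_lt_fun (measurable_cst _) mN).
- by move=> x /=; apply: le_lt_trans; rewrite lerD2l lerN2.
Qed.

Let mN2 : measurable_fun setT (fun z : T * R => `|Rad z.1|).
Proof.
apply: measurableT_comp => //.
exact: (measurableT_comp mRad measurable_fst).
Qed.

Let cosm : measurable_fun setT (fun z : T * R => cos z.2).
Proof.
have mc : measurable_fun setT (@cos R).
  by apply: continuous_measurable_fun; exact: continuous_cos.
exact: (measurableT_comp mc measurable_snd).
Qed.

Lemma measurable_arc_fun w b :
  measurable_fun setT (fun x => lebesgue_measure (lower_arc w `|Rad x| b)).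
Proof.
pose L : set (T * R) := [set z | - pi <= z.2] `&` [set z | z.2 <= b] `&`
  [set z | 1 - w < `|Rad z.1| * cos z.2].
have mL : measurable L.
  have ms : measurable_fun setT (fun z : T * R => z.2) by exact: measurable_snd.
  apply: measurableI; [apply: measurableI|].
  - rewrite [X in measurable X](_ : _ = setT `&` snd @^-1` `[- pi, +oo[); first exact: ms.
    by apply/seteqP; split => z /=; rewrite in_itv/= andbT; tauto.
  - rewrite [X in measurable X](_ : _ = setT `&` snd @^-1` `]-oo, b]); first exact: ms.
    by apply/seteqP; split => z /=; rewrite in_itv/=; tauto.
  - apply: measurable_lt_fun; first exact: measurable_cst.
    by apply: measurable_funM.
have := @measurable_fun_xsection _ _ _ _ R (@lebesgue_measure R) _ mL.
rewrite (_ : _ \o _ = (fun x => lebesgue_measure (lower_arc w `|Rad x| b)))//.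
apply/funext => x /=; congr lebesgue_measure.
apply/seteqP; split => t; rewrite /xsection /lower_arc /= inE /L /=.
  by move=> [[-> ->]].
by move=> [/andP[-> ->]].
Qed.

(** [measure_lower_arc] turns the arc into an integral over s of an indicator in the radius. Tonelli
    exchanges the two integrals, and the expectation of the indicator is Phi (w (1 - s^2)). *)
Lemma expected_lower_arc w s0 : 0 < w < 1 -> -1 <= s0 <= 1 ->
  let q := w / (1 - w) in
  (\int[P]_x lebesgue_measure (lower_arc w `|Rad x| (arcmap q s0)) =
   (Num.sqrt (2 * q) * tail_integral Phi w s0)%:E)%E.
Proof.
move=> w01 s01 q; have /andP[w0 w1] := w01.
have q0 : 0 < q by rewrite divr_gt0// subr_gt0.
pose kap s := Num.sqrt (2 * q) * arcker q s.
have kap0 s : 0 <= kap s by rewrite mulr_ge0// ltW// arcker_gt0.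
have mk : measurable_fun setT kap.
  by apply: measurable_funM; [exact: measurable_cst|exact: measurable_arcker].
pose A : set (T * R) := [set z | 1 - w * (1 - z.2 ^+ 2) < `|Rad z.1|] `&` [set z | -1 <= z.2] `&` [set z | z.2 <= s0].
have mA : measurable A.
  have ms : measurable_fun setT (fun z : T * R => z.2) by exact: measurable_snd.
  apply: measurableI; [apply: measurableI|].
  - apply: measurable_lt_fun => //.
    apply: measurable_funB; first exact: measurable_cst.
    apply: measurable_funM; first exact: measurable_cst.
    by apply: measurable_funB; [exact: measurable_cst|exact: measurable_funX].
  - rewrite [X in measurable X](_ : _ = setT `&` snd @^-1` `[- 1, +oo[); first exact: ms.
    by apply/seteqP; split => z /=; rewrite in_itv/= andbT; tauto.
  - rewrite [X in measurable X](_ : _ = setT `&` snd @^-1` `]-oo, s0]); first exact: ms.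
    by apply/seteqP; split => z /=; rewrite in_itv/=; tauto.
pose f (z : T * R) : \bar R := (kap z.2 * \1_A z)%:E.
have mf : measurable_fun setT f.
  apply/measurable_EFinP; apply: measurable_funM; last exact: measurable_indic.
  exact: (measurableT_comp mk measurable_snd).
have f0 z : (0 <= f z)%E by rewrite lee_fin mulr_ge0.
have mF := @measurable_fun_fubini_tonelli_F _ _ T (measurableTypeR R) R (@lebesgue_measure R) f mf f0.
transitivity (\int[P]_x fubini_F (@lebesgue_measure R) f x)%E.
  apply: ae_eq_integral => //; first exact: measurable_arc_fun.
  apply: filterS2 Rad_gt0 Rad_le1 => x r0 r1 _.
  rewrite measure_lower_arc//; last by rewrite r0.
  rewrite integral_mkcond /fubini_F; apply: eq_integral => s _.
  rewrite patchE /f /kap -/q !indicE; case: ifPn.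
    rewrite inE/= in_itv/= => /andP[h1 h2]; congr (_ * _%:R)%:E.
    by congr (nat_of_bool _); apply/idP/idP; rewrite !inE /A /=; [move=> ->|case=> -[]].
  rewrite notin_setE/= in_itv/= => h.
  by rewrite memNset ?mulr0// => -[[_ h1] h2]; apply: h; apply/andP.
transitivity (\int[lebesgue_measure]_s (\int[P]_x f (x, s)))%E.
  exact: (@fubini_tonelli _ _ T (measurableTypeR R) R P (@lebesgue_measure R) f mf f0).
rewrite /tail_integral -/q.
have iP : (@lebesgue_measure R).-integrable `[-1, s0]
    (EFin \o (fun s => Num.sqrt (2 * q) * (Phi (w * (1 - s ^+ 2)) * arcker q s))).
  apply: (@bounded_integrable _ _ _ _ (Num.sqrt (2 * q))).
    apply: measurable_funM; first exact: measurable_cst.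
    apply: measurable_funM; last exact: measurable_arcker.
    have mP : measurable_fun setT Phi.
      by apply: nondecreasing_measurable => //; exact: Phi_nd.
    apply: (measurableT_comp mP).
    apply: measurable_funM; first exact: measurable_cst.
    by apply: measurable_funB; [exact: measurable_cst|exact: exprn_measurable].
  move=> s _; rewrite normrM (ger0_norm (sqrtr_ge0 _)) ler_piMr ?sqrtr_ge0//.
  rewrite normrM (ger0_norm (Phi_ge0 _)) (ger0_norm (ltW (arcker_gt0 _ q0))).
  by apply: mulr_ile1; rewrite ?Phi_ge0 ?Phi_le1 ?arcker_le1// ltW// arcker_gt0.
transitivity (\int[lebesgue_measure]_(s in `[(-1)%R, s0])
    (Num.sqrt (2 * q) * (Phi (w * (1 - s ^+ 2)) * arcker q s))%:E)%E.
  rewrite [RHS]integral_mkcond; apply: eq_integral => s _.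
  rewrite patchE; case: ifPn; last first.
    rewrite notin_setE/= in_itv/= => h; apply: integral0_eq => x _.
    by rewrite /f indicE memNset ?mulr0// => -[[_ h1] h2]; apply: h; apply/andP.
  rewrite inE/= in_itv/= => /andP[h1 h2].
  pose B : set T := [set x | 1 - w * (1 - s ^+ 2) < `|Rad x|].
  have mB : measurable B by exact: (measurable_lt_fun (measurable_cst _) mN).
  transitivity (\int[P]_x ((kap s)%:E * (\1_B x)%:E))%E.
    apply: eq_integral => x _; rewrite /f /= -EFinM !indicE; congr (_ * _%:R)%:E.
    by congr (nat_of_bool _); apply/idP/idP; rewrite !inE /A /B /=; [case=> -[]|move=> ->].
  rewrite ge0_integralZl//; last 2 first.
    by apply/measurable_EFinP; exact: measurable_indic.
    by rewrite lee_fin.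
  have PB : P B = (Phi (w * (1 - s ^+ 2)))%:E by rewrite PhiE.
  have -> : (\int[P]_x (\1_B x)%:E = (Phi (w * (1 - s ^+ 2)))%:E)%E.
    by rewrite -PB integral_indic// setIT.
  by rewrite -EFinM /kap; congr (_%:E); ring.
rewrite /Defs.Rint -RintegralZl//; last first.
  have sq0 : Num.sqrt (2 * q) != 0 by rewrite lt0r_neq0// sqrtr_gt0 mulr_gt0.
  have mI : measurable (`[-1, s0]%classic : set (measurableTypeR R)) by exact: measurable_itv.
  have := integrableZl mI (Num.sqrt (2 * q))^-1 iP.
  by apply: eq_integrable => // s _; rewrite /= -EFinM mulKf.
by rewrite /Rintegral fineK//; exact: integrable_fin_num.
Qed.

End expected_arc.

(** * The spherical vector: tail, marginal law and quantiles *)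

Section spherical_vector.
Context {R : realType} {d1 : measure_display} {T1 : measurableType d1} (P1 : probability T1 R).
Variables (S1 S2 Rad Th : T1 -> R).
Hypotheses (mS1 : measurable_fun setT S1) (mS2 : measurable_fun setT S2).
Hypotheses (mRad : measurable_fun setT Rad) (mTh : measurable_fun setT Th).
Hypothesis hsph : forall B : set (R * R), measurable B ->
     P1 ((fun w => (S1 w, S2 w)) @^-1` B)
     = P1 ((fun w => (Rad w * cos (Th w), Rad w * sin (Th w))) @^-1` B).
Hypothesis hunif : forall B : set R, measurable B ->
     P1 (Th @^-1` B) = (lebesgue_measure (B `&` `[0%R, (2 * pi)%R[) * ((2 * pi)^-1)%R%:E)%E.
Hypothesis hind : forall A B : set R, measurable A -> measurable B ->
     P1 (Rad @^-1` A `&` Th @^-1` B) = (P1 (Rad @^-1` A) * P1 (Th @^-1` B))%E.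
Variables F G : R -> R.
Hypothesis hF : forall t, F t = fine (P1 [set w | Num.sqrt (S1 w ^+ 2 + S2 w ^+ 2) <= t]).
Hypothesis hRpos : P1 [set w | 0 < Num.sqrt (S1 w ^+ 2 + S2 w ^+ 2)] = 1%E.
Hypothesis hFend : sup [set t : R | F t < 1] = 1.
Hypothesis hG : forall t, G t = fine (P1 [set w | S1 w <= t]).

Definition tail_of (F : R -> R) (w : R) : R := 1 - F (1 - w).
Let Phi := tail_of F.

Let norm2 (z : R * R) := Num.sqrt (z.1 ^+ 2 + z.2 ^+ 2).

Let measurable_norm2 : measurable_fun setT norm2.
Proof.
have ms : measurable_fun setT (@Num.sqrt R).
  by apply: continuous_measurable_fun; exact: sqrt_continuous.
apply: (measurableT_comp ms).
by apply: measurable_funD; apply: measurable_funX; [exact: measurable_fst|exact: measurable_snd].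
Qed.

Let norm2_polar r t : norm2 (r * cos t, r * sin t) = `|r|.
Proof. by rewrite /norm2 /= !exprMn -mulrDr cos2Dsin2 mulr1 sqrtr_sqr. Qed.

Let law_norm (B : set R) : measurable B ->
  P1 [set w | B (norm2 (S1 w, S2 w))] = P1 [set w | B `|Rad w|].
Proof.
move=> mB.
have mB2 : measurable (norm2 @^-1` B) by rewrite -[X in measurable X]setTI; exact: measurable_norm2.
have := hsph mB2.
rewrite (_ : _ @^-1` _ = [set w | B (norm2 (S1 w, S2 w))])// => ->.
by congr (P1 _); apply/seteqP; split => w; rewrite /= norm2_polar.
Qed.

Let mN : measurable_fun setT (fun w => `|Rad w|).
Proof. exact: measurableT_comp. Qed.

Let F_eq t : (F t)%:E = P1 [set w | `|Rad w| <= t].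
Proof.
rewrite hF fineK; last first.
  apply: fin_num_measure.
  have m : measurable_fun setT (fun w => norm2 (S1 w, S2 w)).
    by apply: (measurableT_comp measurable_norm2); exact: measurable_fun_pair.
  have := m measurableT _ (measurable_itv `]-oo, t]); rewrite setTI.
  by rewrite (_ : _ @^-1` _ = [set w | norm2 (S1 w, S2 w) <= t])//;
    apply/seteqP; split => w; rewrite /= in_itv.
have := law_norm (measurable_itv `]-oo, t]).
rewrite (_ : [set w | _] = [set w | Num.sqrt (S1 w ^+ 2 + S2 w ^+ 2) <= t]); last first.
  by apply/seteqP; split => w; rewrite /= in_itv.
by move=> ->; congr (P1 _); apply/seteqP; split => w; rewrite /= in_itv.
Qed.

Let measurable_norm_le t : measurable [set w | `|Rad w| <= t].
Proof.
have := mN measurableT (measurable_itv `]-oo, t]); rewrite setTI.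
by rewrite (_ : _ @^-1` _ = [set w | `|Rad w| <= t])//; apply/seteqP; split => w; rewrite /= in_itv.
Qed.

Let PhiE w : (Phi w)%:E = P1 [set x | 1 - w < `|Rad x|].
Proof.
rewrite /Phi /tail_of EFinB F_eq -probability_setC//.
by congr (P1 _); apply/seteqP; split => x /=; [move/negP; rewrite -ltNge|move=> h; apply/negP; rewrite -ltNge].
Qed.

Let F_nd : {homo F : s t / s <= t}.
Proof.
move=> s t st; rewrite -lee_fin !F_eq; apply: le_measure; rewrite ?inE//.
by move=> w /= h; exact: le_trans st.
Qed.

(** The empty set has [sup] 0 by default, which the value 1 excludes. *)
Let F_set_neq0 : [set t : R | F t < 1] !=set0.
Proof.
apply/set0P/negP => /eqP h; move: hFend; rewrite h sup0 => /esym/eqP.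
by rewrite oner_eq0.
Qed.

Let F_lt1 t : t < 1 -> F t < 1.
Proof.
move=> t1; rewrite ltNge; apply/negP => Ft.
move: t1; rewrite -hFend ltNge => /negP; apply.
apply: sup_le_ub => // s /= Fs; rewrite leNgt; apply/negP => ts.
by move: Fs; rewrite ltNge (le_trans Ft)// F_nd// ltW.
Qed.

Let F_ge1 t : 1 < t -> 1 <= F t.
Proof.
move=> t1; rewrite leNgt; apply/negP => Ft.
(* A set without upper bound would also have the default [sup] 0. *)
have ub : has_ubound [set t : R | F t < 1].
  apply: contrapT => nub; move: hFend; rewrite sup_out; last by case.
  by move/eqP; rewrite eq_sym oner_eq0.
have : t <= sup [set t : R | F t < 1] by apply: ub_le_sup.
by rewrite hFend leNgt t1.
Qed.

Lemma tail_of_gt0 w : 0 < w -> 0 < tail_of F w.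
Proof. by move=> w0; rewrite subr_gt0 F_lt1// ltrBlDr ltrDl. Qed.

Lemma tail_of_ge0 w : 0 <= tail_of F w.
Proof. exact: (Phi_ge0 PhiE). Qed.

Lemma tail_of_nd : {homo tail_of F : v w / v <= w}.
Proof. by move=> v w vw; exact: (Phi_nd mRad PhiE). Qed.

Let ae_of_probability1 (A : set T1) : measurable A -> P1 A = 1%E -> {ae P1, forall x, A x}.
Proof.
move=> mA PA; exists (~` A); split => //; first exact: measurableC.
by rewrite probability_setC// PA subee.
Qed.

Let Rad_gt0 : {ae P1, forall x, 0 < `|Rad x|}.
Proof.
have mA : measurable [set w | 0 < `|Rad w|].
  exact: (measurable_lt_fun (measurable_cst _) mN).
have := law_norm (measurable_itv `]0, +oo[).
rewrite (_ : [set w | _] = [set w | 0 < Num.sqrt (S1 w ^+ 2 + S2 w ^+ 2)]); last first.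
  by apply/seteqP; split => w; rewrite /= in_itv/= andbT.
rewrite hRpos (_ : [set w | _] = [set w | 0 < `|Rad w|]).
  by move=> h; apply: (ae_of_probability1 mA).
by apply/seteqP; split => w; rewrite /= in_itv/= andbT.
Qed.

(** [F_ge1] speaks only of t > 1; the countably many levels 1 + 1 / (n + 1) reach down to 1. *)
Let Rad_le1 : {ae P1, forall x, `|Rad x| <= 1}.
Proof.
have h : forall n : nat, {ae P1, forall x, `|Rad x| <= 1 + n.+1%:R^-1}.
  move=> n; apply: (ae_of_probability1 (measurable_norm_le _)).
  apply/eqP; rewrite eq_le probability_le1//= -F_eq lee_fin F_ge1//.
  by rewrite ltrDl invr_gt0.
have := ae_foralln h; apply: filterS => x hx.
apply/ler_addgt0Pr => e e0.
have [n hn] : exists n : nat, n.+1%:R^-1 < e.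
  exists (Num.truncn e^-1); rewrite -[ltRHS]invrK ltf_pV2 ?posrE ?invr_gt0//.
  exact: truncnS_gt.
by apply: le_trans (hx n) _; rewrite lerD2l ltW.
Qed.

Let pi2_gt0 : 0 < (2 * pi : R).
Proof. by rewrite mulr_gt0// pi_gt0. Qed.

Let measurable_ray_fun (E : set (R * R)) : measurable E ->
  measurable_fun setT (fun w => lebesgue_measure (ray_angles E `|Rad w| `&` `[(- pi)%R, pi[)).
Proof.
move=> mE.
pose g (z : T1 * R) : R * R := (`|Rad z.1| * cos z.2, `|Rad z.1| * sin z.2).
have mg : measurable_fun setT g.
  have mr : measurable_fun setT (fun z : T1 * R => `|Rad z.1|).
    exact: (measurableT_comp mN measurable_fst).
  have mc : measurable_fun setT (@cos R).
    by apply: continuous_measurable_fun; exact: continuous_cos.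
  have ms : measurable_fun setT (@sin R).
    by apply: continuous_measurable_fun; exact: continuous_sin.
  apply: measurable_fun_pair; apply: measurable_funM => //.
    exact: (measurableT_comp mc measurable_snd).
  exact: (measurableT_comp ms measurable_snd).
pose X : set (T1 * R) := (setT `&` g @^-1` E) `&` (setT `&` snd @^-1` `[- pi, pi[).
have mX : measurable X.
  apply: measurableI; first exact: mg.
  have m2 : measurable_fun setT (fun z : T1 * R => z.2) by exact: measurable_snd.
  exact: m2.
have := @measurable_fun_xsection _ _ _ _ R (@lebesgue_measure R) _ mX.
rewrite (_ : _ \o _ = (fun w => lebesgue_measure (ray_angles E `|Rad w| `&` `[(- pi)%R, pi[)))//.
apply/funext => w /=; congr lebesgue_measure.
by apply/seteqP; split => t; rewrite /xsection /= inE /X /ray_angles /=; tauto.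
Qed.

Lemma exceedance_probability wx wy rho sx sy : 0 < wx < 1 -> 0 < wy < 1 -> 0 < rho < 1 ->
  -1 <= sx <= 1 -> -1 <= sy <= 1 ->
  let qx := wx / (1 - wx) in let qy := wy / (1 - wy) in
  arcmap qx sx = atan (crossing_tan wx wy rho) ->
  arcmap qy sy = atan (crossing_tan wy wx rho) ->
  P1 ((fun w => (S1 w, S2 w)) @^-1` exceedance wx wy rho) =
  ((Num.sqrt (2 * qx) * tail_integral Phi wx sx +
    Num.sqrt (2 * qy) * tail_integral Phi wy sy) / (2 * pi))%:E.
Proof.
move=> wx01 wy01 rho01 sx1 sy1 qx qy ex ey.
have mE := measurable_exceedance wx wy rho.
rewrite (polar_probability mRad mTh hsph hunif hind mE).
rewrite ge0_integralZr//; last 2 first.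
  exact: measurable_ray_fun.
  by rewrite lee_fin invr_ge0 ltW.
rewrite [RHS]EFinM EFinD; congr (_ * _)%E.
transitivity (\int[P1]_w (lebesgue_measure (lower_arc wx `|Rad w| (arcmap qx sx)) +
   lebesgue_measure (lower_arc wy `|Rad w| (arcmap qy sy))))%E.
  apply: ae_eq_integral => //.
  - exact: measurable_ray_fun.
  - by apply: emeasurable_funD; exact: measurable_arc_fun.
  - apply: filterS Rad_gt0 => w r0 _.
    by rewrite ex ey measure_two_arcs.
rewrite ge0_integralD//; [|exact: measurable_arc_fun|exact: measurable_arc_fun].
by rewrite !(expected_lower_arc mRad PhiE Rad_gt0 Rad_le1).
Qed.

(** [arcmap q 1] is the angle with cosine 1 - w. For radii at most 1 no larger angle reaches the
    line, so ending the arc there loses nothing. *)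
Lemma marginal_probability w : 0 < w < 1 -> let q := w / (1 - w) in
  P1 [set x | 1 - w < S1 x] = (Num.sqrt (2 * q) * tail_integral Phi w 1 / (2 * pi))%:E.
Proof.
move=> w01 q; have /andP[w0 w1] := w01.
have q0 : 0 < q by rewrite divr_gt0// subr_gt0.
have pi0 := pi_gt0 R.
pose E : set (R * R) := [set z | 1 - w < z.1].
have mE : measurable E by exact: (measurable_lt_fun (measurable_cst _) measurable_fst).
have -> : P1 [set x | 1 - w < S1 x] = P1 ((fun w => (S1 w, S2 w)) @^-1` E) by [].
rewrite (polar_probability mRad mTh hsph hunif hind mE).
rewrite ge0_integralZr//; last 2 first.
  exact: measurable_ray_fun.
  by rewrite lee_fin invr_ge0 ltW.
rewrite [RHS]EFinM; congr (_ * _)%E.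
rewrite -(expected_lower_arc mRad PhiE Rad_gt0 Rad_le1 w01); last by rewrite lexx andbT; lra.
apply: ae_eq_integral => //.
- exact: measurable_ray_fun.
- exact: measurable_arc_fun.
- apply: filterS2 Rad_gt0 Rad_le1 => x r0 r1 _; congr lebesgue_measure.
  have cosb : cos (arcmap q 1) = 1 - w.
    rewrite cos_arcmap// expr1n mulr1 /q.
    have -> : 1 + w / (1 - w) = (1 - w)^-1 by field; rewrite subr_eq0 gt_eqF.
    by rewrite invrK.
  have b0 : 0 < arcmap q 1.
    have -> : 0 = arcmap q 0 by rewrite /arcmap mul0r atan0.
    by rewrite arcmap_lt// ltr01.
  have b1 : arcmap q 1 < pi / 2 by exact: atan_ltpi2.
  apply/seteqP; split=> t; rewrite /ray_angles /lower_arc /E /= in_itv/=.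
    move=> [h /andP[t1 t2]]; split => //; rewrite t1/= leNgt; apply/negP => bt.
    have : cos t < cos (arcmap q 1).
      by rewrite ltr_cos// in_itv/=; apply/andP; split; lra.
    rewrite cosb => h2; have := h; rewrite ltNge => /negP; apply.
    have [c0|c0] := leP (cos t) 0; last first.
      by apply: le_trans (ltW h2); rewrite ler_piMl// ltW.
    by apply: (@le_trans _ _ 0); [rewrite mulr_ge0_le0// ltW|lra].
  by move=> [/andP[t1 t2] h]; split => //; rewrite t1/=; lra.
Qed.

(** For t > 0 each circle meets the line z.1 = t in at most two angles of a full turn, a null
    set. *)
Lemma S1_no_atom t : 0 < t -> P1 [set x | S1 x = t] = 0%E.
Proof.
move=> t0; have pi0 := pi_gt0 R.
pose E : set (R * R) := setT `&` fst @^-1` [set t].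
have mE : measurable E.
  have m1 : measurable_fun setT (fun z : R * R => z.1) by exact: measurable_fst.
  by apply: m1 => //; exact: measurable_set1.
have -> : P1 [set x | S1 x = t] = P1 ((fun w => (S1 w, S2 w)) @^-1` E).
  by congr (P1 _); apply/seteqP; split => w /=; rewrite /E /=; tauto.
rewrite (polar_probability mRad mTh hsph hunif hind mE).
apply: integral0_eq => w _.
set r := `|Rad w|; pose a := acos (t / r).
have sub : ray_angles E r `&` `[- pi, pi[ `<=` [set a] `|` [set - a].
  move=> s []; rewrite /ray_angles /E /= in_itv/= => -[_ rs] /andP[s1 s2].
  have r0 : r != 0 by apply: contra_eq_neq rs => ->; rewrite mul0r lt_eqF.
  have sa : `|s| = a.
    rewrite /a -rs mulrAC divff// mul1r -(cos_norm s) cosK// in_itv/= normr_ge0/=.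
    by rewrite ler_norml s1 ltW.
  by move: sa; case: (ger0P s) => _ <-; [left|right; rewrite opprK].
have m0 : lebesgue_measure ([set a] `|` [set - a]) = 0%E.
  apply/eqP; rewrite eq_le measure_ge0 andbT.
  have : (lebesgue_measure ([set a] `|` [set (- a)%R]) <=
          lebesgue_measure [set a] + lebesgue_measure [set (- a)%R])%E.
    by apply: measureU2; exact: measurable_set1.
  by rewrite !lebesgue_measure_set1 adde0.
have -> : lebesgue_measure (ray_angles E r `&` `[- pi, pi[) = 0%E; last by rewrite mul0e.
apply/eqP; rewrite eq_le measure_ge0 andbT -m0; apply: le_measure; rewrite ?inE//.
- by apply: measurableI => //; exact: measurable_ray_angles.
- by apply: measurableU; exact: measurable_set1.
Qed.

Let S1_le_norm w : `|S1 w| <= norm2 (S1 w, S2 w).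
Proof. by rewrite /norm2 /= -sqrtr_sqr ler_wsqrtr// lerDl sqr_ge0. Qed.

Let norm_gt1_null : P1 [set w | 1 < norm2 (S1 w, S2 w)] = 0%E.
Proof.
have := law_norm (measurable_itv `]1, +oo[).
rewrite (_ : [set w | _] = [set w | 1 < norm2 (S1 w, S2 w)]); last first.
  by apply/seteqP; split => w; rewrite /= in_itv/= andbT.
move=> ->; have mA : measurable [set w | 1 < `|Rad w|].
  exact: (measurable_lt_fun (measurable_cst _) mN).
rewrite (_ : [set w | _] = [set w | 1 < `|Rad w|]); last first.
  by apply/seteqP; split => w; rewrite /= in_itv/= andbT.
have [B [mB PB sub]] := Rad_le1.
apply/eqP; rewrite eq_le measure_ge0 andbT -PB; apply: le_measure; rewrite ?inE//.
by move=> w /= h; apply: sub => /=; apply/negP; rewrite -ltNge.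
Qed.

Let measurable_S1_le t : measurable [set w | S1 w <= t].
Proof.
have := mS1 measurableT (measurable_itv `]-oo, t]); rewrite setTI.
by rewrite (_ : _ @^-1` _ = [set w | S1 w <= t])//; apply/seteqP; split => w; rewrite /= in_itv.
Qed.

Let measurable_norm_gt1 : measurable [set w | 1 < norm2 (S1 w, S2 w)].
Proof.
apply: (measurable_lt_fun (measurable_cst _)).
by apply: (measurableT_comp measurable_norm2); exact: measurable_fun_pair.
Qed.

Lemma G_eq t : (G t)%:E = P1 [set w | S1 w <= t].
Proof. by rewrite hG fineK//; exact: fin_num_measure. Qed.

Lemma G_nd : {homo G : s t / s <= t}.
Proof.
move=> s t st; rewrite -lee_fin !G_eq; apply: le_measure; rewrite ?inE//.
by move=> w /= h; exact: le_trans st.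
Qed.

Lemma G_gtE t : P1 [set w | t < S1 w] = (1 - G t)%:E.
Proof.
rewrite EFinB G_eq -probability_setC//.
by congr (P1 _); apply/seteqP; split => x /=; [move=> h; apply/negP; rewrite -ltNge|move/negP; rewrite -ltNge].
Qed.

Let G_lt_N1 t : t < -1 -> G t = 0.
Proof.
move=> t1; suff : (G t)%:E = 0%E by case.
apply/eqP; rewrite G_eq eq_le measure_ge0 andbT -norm_gt1_null.
apply: le_measure; rewrite ?inE// => w /= h.
apply: lt_le_trans (S1_le_norm w); rewrite ltr0_norm; lra.
Qed.

Let G_1 : G 1 = 1.
Proof.
suff : (1 - G 1)%:E = 0%E by case=> /eqP; rewrite subr_eq0 => /eqP.
apply/eqP; rewrite -G_gtE eq_le measure_ge0 andbT -norm_gt1_null.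
apply: le_measure; rewrite ?inE//; first exact: (measurable_lt_fun (measurable_cst _) mS1).
by move=> w /= h; apply: lt_le_trans (S1_le_norm w); apply: lt_le_trans h (ler_norm _).
Qed.

Let G_right_continuous t : G x @[x --> t^'+] --> G t.
Proof.
pose RV : {mfun T1 >-> R} := HB.pack S1 (isMeasurableFun.Build _ _ _ _ S1 mS1).
have E x : cdf (P := P1) RV x = (G x)%:E.
  rewrite G_eq /cdf /distribution /pushforward.
  by congr (P1 _); apply/seteqP; split => w; rewrite /= in_itv.
have := @cdf_right_continuous _ _ _ P1 RV t; rewrite E.
rewrite (_ : cdf RV = EFin \o G); last by apply/funext => x; rewrite E.
by move/fine_cvgP => [_]; apply: near_eq_cvgR; exact: nearW.
Qed.

Section quantile.
Variable n : nat.
Hypothesis n2 : (1 < n)%N.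
Let p : R := 1 - n%:R^-1.
Let D := [set x : R | p <= G x].
Let g := ginv G p.

Let p_lt1 : p < 1.
Proof. by rewrite ltrBlDr ltrDl invr_gt0 ltr0n (leq_trans _ n2). Qed.

Let p_gt0 : 0 < p.
Proof. by rewrite subr_gt0 invf_lt1 ?ltr1n// ltr0n (leq_trans _ n2). Qed.

Let D1 : D 1. Proof. by rewrite /D /= G_1 ltW. Qed.

(** n > 1 makes p positive while [G] vanishes below -1, so [ginv] is a true infimum here and not a
    default value. *)
Let D_lb : lbound D (-1).
Proof. by move=> x Dx; rewrite leNgt; apply/negP => /G_lt_N1 h; move: Dx; rewrite /D /= h leNgt p_gt0. Qed.

Let D_inf : has_inf D. Proof. by split; [exists 1|exists (-1)]. Qed.

Let G_lt_p x : x < g -> G x < p.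
Proof.
move=> xg; rewrite ltNge; apply/negP => h.
have : g <= x by apply: ge_inf => //; case: D_inf.
by rewrite leNgt xg.
Qed.

Let p_le_Gg : p <= G g.
Proof.
rewrite leNgt; apply/negP => h.
have h2 : \forall x \near g^'+, G x < p by exact: (cvgr_lt _ (@G_right_continuous g)).
have [x [gx Gx]] : exists x, g < x /\ G x < p.
  have h3 : \forall x \near g^'+, g < x /\ G x < p.
    by near=> x; split; near: x; [exact: nbhs_right_gt|exact: h2].
  exact: filter_ex h3.
have gx' : inf D < x by exact: gx.
have [y Dy yx] := inf_lt D_inf.1 gx'.
by have := le_trans Dy (G_nd (ltW yx)); rewrite leNgt Gx.
Unshelve. all: by end_near. Qed.

Let below := [set w | S1 w < g].

Let P_lt_g : (P1 below <= p%:E)%E.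
Proof.
pose Fk (k : nat) := [set w | S1 w <= g - k.+1%:R^-1].
have U : \bigcup_k Fk k = below.
  apply/seteqP; split => [w [k _] /= h|w /= h].
    by apply: le_lt_trans h _; rewrite ltrBlDr ltrDl invr_gt0.
  have h0 : 0 < g - S1 w by rewrite subr_gt0.
  exists (Num.truncn (g - S1 w)^-1) => //=.
  rewrite /Fk /= lerBrDr addrC -lerBrDr -[leRHS]invrK lef_pV2 ?posrE ?invr_gt0//.
  exact/ltW/truncnS_gt.
have mbelow : measurable below by exact: (measurable_lt_fun mS1 (measurable_cst _)).
have lim : (P1 \o Fk) k @[k --> \oo] --> P1 below.
  rewrite -U; apply: nondecreasing_cvg_mu; [by move=> k; exact: measurable_S1_le|by rewrite U|].
  move=> i j ij; apply/subsetPset => w; rewrite /Fk /= => /le_trans; apply.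
  by rewrite lerD2l lerN2 lef_pV2 ?posrE// ler_nat.
rewrite -(cvg_lim _ lim)//; apply: lime_le; first exact: cvgP lim.
apply: nearW => k; rewrite /= -G_eq lee_fin ltW// G_lt_p//.
by rewrite ltrBlDr ltrDl invr_gt0.
Qed.

(** Right continuity gives p <= G g, and continuity from below gives P (S1 < g) <= p. A positive g
    carries no mass, so G g = p and the normalising probability is 1/n without any error term. *)
Lemma quantile_exceedance : 0 < g -> g < 1 /\ P1 [set w | g < S1 w] = (n%:R^-1)%:E.
Proof.
move=> g0.
have Gg : G g = p.
  apply/eqP; rewrite eq_le p_le_Gg andbT -lee_fin G_eq.
  have -> : [set w | S1 w <= g] = below `|` [set w | S1 w = g].
    apply/seteqP; split => w /=; first by rewrite le_eqVlt => /orP[/eqP|]; [right|left].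
    by case=> [/ltW|->].
  have meq : measurable [set w | S1 w = g].
    have := mS1 measurableT (measurable_set1 g); rewrite setTI.
    by rewrite (_ : _ @^-1` _ = [set w | S1 w = g]).
  apply: le_trans (measureU2 _ _ _) _ => //; first exact: (measurable_lt_fun mS1 (measurable_cst _)).
  by rewrite [X in (_ + X)%E]S1_no_atom// adde0.
split.
  have g1 : g <= 1 by apply: ge_inf => //; case: D_inf.
  rewrite lt_neqAle g1 andbT; apply/eqP => h.
  by move: Gg; rewrite h G_1 => /eqP; rewrite gt_eqF.
by rewrite G_gtE Gg /p opprB addrCA subrr addr0.
Qed.

Lemma quantile_ge w : G w < p -> w <= g.
Proof.
move=> Gw; apply: lb_le_inf; first by case: D_inf.
move=> x Dx; rewrite leNgt; apply/negP => /ltW /G_nd h.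
by have := le_lt_trans (le_trans Dx h) Gw; rewrite ltxx.
Qed.

End quantile.

End spherical_vector.

(** * First-order expansions relative to a rate *)

Lemma derive_taylor (R : realType) (g : R -> R) (l dg : R) : is_derive l 1 g dg ->
  forall e, 0 < e -> exists2 d, 0 < d & forall h, `|h| < d ->
    `|g (l + h) - g l - dg * h| <= e * `|h|.
Proof.
move=> [dl dgE] e e0.
have : h^-1 *: ((g \o shift l) (h *: 1) - g l) @[h --> 0^'] --> dg.
  by rewrite -dgE; exact: dl.
move=> /cvgrPdist_lt/(_ e e0) [d /= d0 H].
exists d => // h hd.
have [->|h0] := eqVneq h 0; first by rewrite addr0 subrr mulr0 subr0 !normr0 mulr0.
have := H h; rewrite /= sub0r normrN => /(_ hd h0).
rewrite /GRing.scale/= mulr1 addrC [h + l]addrC => /ltW h1.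
have -> : g (l + h) - g l - dg * h = (- (dg - h^-1 * (g (l + h) - g l))) * h.
  by field.
by rewrite normrM normrN ler_wpM2r// addrC.
Qed.

Section first_order_expansions.
Context {R : realType}.
Variable r : nat -> R.
Hypothesis r_gt0 : \forall n \near \oo, 0 < r n.
Hypothesis r_cvg0 : r n @[n --> \oo] --> 0.
Implicit Types (f g e d : nat -> R) (l : R).

Definition smallo e := forall eps : R, 0 < eps -> \forall n \near \oo, `|e n| <= eps * r n.
Definition bigo e := exists2 C : R, 0 < C & \forall n \near \oo, `|e n| <= C * r n.
(* [f n = l + d n + o(r n)] with [d n = O(r n)] *)
Definition jet f l d := bigo d /\ smallo (fun n => f n - l - d n).

Lemma smallo_bigo e : smallo e -> bigo e.
Proof. by move=> h; exists 1 => //; exact: h. Qed.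

Lemma smallo_near e e' : (\forall n \near \oo, e n = e' n) -> smallo e -> smallo e'.
Proof. by move=> E h eps e0; apply: filterS2 E (h eps e0) => n ->. Qed.

Lemma bigo_near e e' : (\forall n \near \oo, e n = e' n) -> bigo e -> bigo e'.
Proof. by move=> E [C C0 h]; exists C => //; apply: filterS2 E h => n ->. Qed.

Lemma smalloD e e' : smallo e -> smallo e' -> smallo (fun n => e n + e' n).
Proof.
move=> h h' eps e0; have e2 : 0 < eps / 2 by rewrite divr_gt0.
apply: filterS2 (h _ e2) (h' _ e2) => n h1 h2.
by apply: le_trans (ler_normD _ _) _; apply: le_trans (lerD h1 h2) _; rewrite -mulrDl -splitr.
Qed.

Lemma bigoD e e' : bigo e -> bigo e' -> bigo (fun n => e n + e' n).
Proof.
move=> [C C0 h] [C' C0' h']; exists (C + C'); first exact: addr_gt0.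
apply: filterS2 h h' => n h1 h2.
by apply: le_trans (ler_normD _ _) _; rewrite mulrDl lerD.
Qed.

Lemma smalloZ k e : smallo e -> smallo (fun n => k * e n).
Proof.
move=> h eps e0; have k0 : 0 < `|k| + 1 by rewrite ltr_wpDl.
apply: filterS2 (h _ (divr_gt0 e0 k0)) r_gt0 => n h1 rn; rewrite normrM.
apply: (@le_trans _ _ ((`|k| + 1) * `|e n|)); first by rewrite ler_wpM2r// lerDl.
by rewrite mulrC -ler_pdivlMr// mulrAC.
Qed.

Lemma bigoZ k e : bigo e -> bigo (fun n => k * e n).
Proof.
move=> [C C0 h]; exists ((`|k| + 1) * C); first by rewrite mulr_gt0// ltr_wpDl.
apply: filterS2 h r_gt0 => n h1 rn; rewrite normrM -mulrA.
by apply: ler_pM => //; rewrite lerDl.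
Qed.

Lemma bigoM e e' : bigo e -> bigo e' -> smallo (fun n => e n * e' n).
Proof.
move=> [C C0 h] [C' C0' h'] eps e0.
have CC : 0 < C * C' by exact: mulr_gt0.
have hr : \forall n \near \oo, `|r n| < eps / (C * C').
  by apply: (cvgr0_norm_lt _ r_cvg0); exact: divr_gt0.
apply: filterS3 (filterI h h') r_gt0 hr => n [h1 h2] rn; rewrite gtr0_norm// => hrn.
rewrite normrM; apply: le_trans (ler_pM (normr_ge0 _) (normr_ge0 _) h1 h2) _.
have -> : C * r n * (C' * r n) = r n * (C * C') * r n by ring.
by rewrite ler_wpM2r ?(ltW rn)// -ler_pdivlMr// ltW.
Qed.

Lemma smallo_cvg0M e e' : bigo e -> e' n @[n --> \oo] --> 0 -> smallo (fun n => e n * e' n).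
Proof.
move=> [C C0 h] e'0 eps e0.
have he : \forall n \near \oo, `|e' n| < eps / C.
  by apply: (cvgr0_norm_lt _ e'0); exact: divr_gt0.
apply: filterS3 h r_gt0 he => n h1 rn h2.
rewrite normrM; apply: le_trans (ler_pM (normr_ge0 _) (normr_ge0 _) h1 (ltW h2)) _.
by rewrite mulrAC mulrCA divff ?mulr1 ?gt_eqF.
Qed.

Lemma bigo_cvg0 e : bigo e -> e n @[n --> \oo] --> 0.
Proof.
move=> [C C0 h]; apply/cvgr0Pnorm_lt => eps e0.
have hr : \forall n \near \oo, `|r n| < eps / C.
  by apply: (cvgr0_norm_lt _ r_cvg0); exact: divr_gt0.
apply: filterS3 h r_gt0 hr => n h1 rn; rewrite gtr0_norm// => h2.
by apply: le_lt_trans h1 _; rewrite mulrC -ltr_pdivlMr.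
Qed.

Lemma smallo_cvg e : smallo e <-> e n / r n @[n --> \oo] --> 0.
Proof.
split=> h.
  apply/cvgr0Pnorm_le => eps e0; apply: filterS2 (h _ e0) r_gt0 => n h1 rn.
  by rewrite normrM normfV (gtr0_norm rn) ler_pdivrMr.
move=> eps e0.
have h1 : \forall n \near \oo, `|e n / r n| <= eps by apply: (cvgr0_norm_le _ h).
apply: filterS2 h1 r_gt0 => n + rn.
by rewrite normrM normfV (gtr0_norm rn) ler_pdivrMr.
Qed.

Lemma jet_bigo f l d : jet f l d -> bigo (fun n => f n - l).
Proof.
move=> [h1 /smallo_bigo h2]; apply: bigo_near (bigoD h1 h2).
by apply: nearW => n; rewrite addrC subrK.
Qed.

Lemma jet_cvg f l d : jet f l d -> f n @[n --> \oo] --> l.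
Proof.
move=> /jet_bigo/bigo_cvg0 h; rewrite -[X in _ --> X]add0r.
apply: near_eq_cvgR (cvgD h (cvg_cst l)); apply: nearW => n.
by rewrite /= subrK.
Qed.

Lemma jet_near f l d f' l' d' : (\forall n \near \oo, f n = f' n) -> l = l' ->
  (\forall n \near \oo, d n = d' n) -> jet f l d -> jet f' l' d'.
Proof.
move=> fE <- dE [h1 h2]; split; first exact: bigo_near h1.
by apply: smallo_near h2; apply: filterS2 fE dE => n -> ->.
Qed.

Lemma smallo0 : smallo (fun=> 0).
Proof.
move=> eps e0; apply: filterS r_gt0 => n rn.
by rewrite normr0 mulr_ge0// ltW.
Qed.

Lemma jetC l : jet (fun=> l) l (fun=> 0).
Proof.
split; first by apply: smallo_bigo; exact: smallo0.
by apply: smallo_near smallo0; apply: nearW => n; rewrite subrr subr0.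
Qed.

Lemma jetO d : bigo d -> jet d 0 d.
Proof.
move=> h; split => //; apply: smallo_near smallo0; apply: nearW => n.
by rewrite subr0 subrr.
Qed.

Lemma jetD f l d f' l' d' : jet f l d -> jet f' l' d' ->
  jet (fun n => f n + f' n) (l + l') (fun n => d n + d' n).
Proof.
move=> [h1 h2] [h1' h2']; split; first exact: bigoD.
by apply: smallo_near (smalloD h2 h2'); apply: nearW => n; ring.
Qed.

Lemma jetN f l d : jet f l d -> jet (fun n => - f n) (- l) (fun n => - d n).
Proof.
move=> [h1 h2]; split.
  by apply: bigo_near (bigoZ (-1) h1); apply: nearW => n; rewrite mulN1r.
by apply: smallo_near (smalloZ (-1) h2); apply: nearW => n; ring.
Qed.

Lemma jetM f l d f' l' d' : jet f l d -> jet f' l' d' ->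
  jet (fun n => f n * f' n) (l * l') (fun n => d n * l' + l * d' n).
Proof.
move=> j j'; have [h1 h2] := j; have [h1' h2'] := j'; split.
  apply: bigoD; last exact: bigoZ.
  by apply: bigo_near (bigoZ l' h1); apply: nearW => n; rewrite mulrC.
have h3 := bigoM (jet_bigo j) (jet_bigo j').
apply: smallo_near (smalloD (smalloD (smalloZ l h2') (smalloZ l' h2)) h3).
by apply: nearW => n; ring.
Qed.

Lemma jet_comp (g : R -> R) dg f l d : is_derive l 1 g dg -> jet f l d ->
  jet (fun n => g (f n)) (g l) (fun n => dg * d n).
Proof.
move=> /derive_taylor hg j; have [h1 h2] := j; split; first exact: bigoZ.
have [C C0 hC] := jet_bigo j.
have hs : smallo (fun n => g (f n) - g l - dg * (f n - l)).
  move=> eps e0; have [dl dl0 H] := hg _ (divr_gt0 e0 C0).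
  have hd : \forall n \near \oo, `|f n - l| < dl.
    by apply: (cvgr0_norm_lt _ (bigo_cvg0 (jet_bigo j))).
  apply: filterS2 hC hd => n hn /H; rewrite addrCA subrr addr0 => h.
  apply: le_trans h _; have -> : eps * r n = eps / C * (C * r n) by field; rewrite gt_eqF.
  by rewrite ler_wpM2l// ltW// divr_gt0.
apply: smallo_near (smalloD hs (smalloZ dg h2)).
by apply: nearW => n; ring.
Qed.

Lemma jetV f l d : l != 0 -> jet f l d ->
  jet (fun n => (f n)^-1) l^-1 (fun n => - d n / l ^+ 2).
Proof.
move=> l0 j; apply: jet_near (jet_comp (dervV l0 (dervI l)) j) => //; apply: nearW => // n.
by rewrite /=; field.
Qed.

Lemma jetSqrt f l d : 0 < l -> jet f l d ->
  jet (fun n => Num.sqrt (f n)) (Num.sqrt l) (fun n => d n / (2 * Num.sqrt l)).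
Proof.
move=> l0 j; apply: jet_near (jet_comp (is_derive1_sqrt l0) j) => //; apply: nearW => // n.
by rewrite mulrC.
Qed.

End first_order_expansions.

(** * The crossing point to first order *)

Definition arcinv {R : realType} (q t : R) : R :=
  t * Num.sqrt (2 / (1 + Num.sqrt (1 + 2 * q * t ^+ 2))).

(** [arcinv] solves t = s sqrt (1 + q s^2 / 2), which is quadratic in s^2. The root is written with
    the inner square root in the denominator, a form that stays regular as q -> 0. *)
Lemma arcmap_arcinv (R : realType) (q t : R) : 0 < q ->
  arcmap q (arcinv q t) = atan (Num.sqrt (2 * q) * t).
Proof.
move=> q0; rewrite /arcmap /arcinv; congr atan.
set S := Num.sqrt (1 + 2 * q * t ^+ 2).
have t0 : 0 <= 2 * q * t ^+ 2 by exact: mulr_ge0 (mulr_ge0 (ler0n _ 2) (ltW q0)) (sqr_ge0 _).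
have S2 : S ^+ 2 = 1 + 2 * q * t ^+ 2 by rewrite sqr_sqrtr//; lra.
have S0 : 0 <= S by exact: sqrtr_ge0.
have S1 : 0 < 1 + S by lra.
have e : 1 + q * (t * Num.sqrt (2 / (1 + S))) ^+ 2 / 2 = (1 + S) / 2.
  rewrite exprMn sqr_sqrtr; last by rewrite divr_ge0// ltW.
  have -> : q * (t ^+ 2 * (2 / (1 + S))) / 2 = (S ^+ 2 - 1) / (1 + S) / 2.
    by rewrite S2; field; rewrite gt_eqF.
  by field; rewrite gt_eqF.
have p : Num.sqrt (2 / (1 + S)) * Num.sqrt ((1 + S) / 2) = 1.
  rewrite -sqrtrM ?divr_ge0 ?(ltW S1)//.
  by rewrite (_ : 2 / (1 + S) * ((1 + S) / 2) = 1) ?sqrtr1//; field; rewrite gt_eqF.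
rewrite e; transitivity (Num.sqrt (2 * q) * t * (Num.sqrt (2 / (1 + S)) * Num.sqrt ((1 + S) / 2))).
  by ring.
by rewrite p mulr1.
Qed.

(** This is [zx] at (-X, -Y); exchanging X and Y gives [zy], so one computation covers both
    lines. *)
Definition crossing_slope {R : realType} (lam X Y : R) : R :=
  (lam + (X - Y) / (2 * lam)) / Num.sqrt (2 * X).

(** The last bracket in the first half of [Qn], for X = -x and Y = -y. The last bracket of the
    second half is the same expression with X and Y exchanged, once the powers of X - Y are
    collected. *)
Definition slope_increment {R : realType} (lam gam a c X Y : R) : R :=
  c * gam * (1 - (X - Y) / (2 * lam ^+ 2))
    - a / 2 * (lam * (X - Y) - X * (X - Y) / lam + 3 * (X - Y) ^+ 2 / (4 * lam)
                    + (X - Y) ^+ 3 / (8 * lam ^+ 3)).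

Section crossing_jet.
Context {R : realType}.
Variables (r a c lamn : nat -> R) (lam gam X Y : R).
Hypothesis r_gt0 : \forall n \near \oo, 0 < r n.
Hypothesis r_cvg0 : r n @[n --> \oo] --> 0.
Hypothesis a_gt0 : \forall n \near \oo, 0 < a n.
Hypothesis a_bigo : bigo r a.
Hypothesis lam_gt0 : 0 < lam.
Hypothesis lam_jet : jet r lamn lam (fun n => c n * gam).
Hypotheses (X_gt0 : 0 < X) (Y_gt0 : 0 < Y).

Let S := Num.sqrt (2 * X).
Let S_gt0 : 0 < S. Proof. by rewrite sqrtr_gt0 mulr_gt0. Qed.
Let S_sqr : S ^+ 2 = 2 * X. Proof. by rewrite sqr_sqrtr// mulr_ge0// ltW. Qed.

Let z := crossing_slope lam X Y.

Let u n := 1 - a n * X.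
Let q n := a n * X / u n.
Let p n := 1 - a n * (lamn n * lamn n).

Let jetMn k f l d : jet r f l d -> jet r (fun n => k * f n) (k * l) (fun n => k * d n).
Proof.
move=> h; apply: jet_near (jetM r_gt0 r_cvg0 (jetC r_gt0 k) h) => //; apply: nearW => // n /=.
by rewrite mul0r add0r.
Qed.

Let ja : jet r a 0 a. Proof. exact: jetO. Qed.

Let ju : jet r u 1 (fun n => - (a n * X)).
Proof.
apply: jet_near (jetD (jetC r_gt0 1) (jetN r_gt0 (jetMn X ja))); first by apply: nearW => n; rewrite /u mulrC.
  by rewrite mulr0 oppr0 addr0.
by apply: nearW => n; ring.
Qed.

Let jsu : jet r (fun n => Num.sqrt (u n)) 1 (fun n => - (a n * X) / 2).
Proof.
apply: jet_near (jetSqrt r_gt0 r_cvg0 ltr01 ju); rewrite ?sqrtr1//; apply: nearW => // n.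
by rewrite mulr1.
Qed.

Let juV : jet r (fun n => (u n)^-1) 1 (fun n => a n * X).
Proof.
apply: jet_near (jetV r_gt0 r_cvg0 (oner_neq0 R) ju); rewrite ?invr1//; apply: nearW => // n.
by field.
Qed.

Let jl2 : jet r (fun n => lamn n * lamn n) (lam * lam) (fun n => 2 * lam * (c n * gam)).
Proof.
apply: jet_near (jetM r_gt0 r_cvg0 lam_jet lam_jet) => //; apply: nearW => // n.
by ring.
Qed.

Let jp : jet r p 1 (fun n => - (a n * lam ^+ 2)).
Proof.
apply: jet_near (jetD (jetC r_gt0 1) (jetN r_gt0 (jetM r_gt0 r_cvg0 ja jl2))).
- by apply: nearW.
- by rewrite mul0r oppr0 addr0.
- by apply: nearW => n; ring.
Qed.

Let jpV : jet r (fun n => (Num.sqrt (p n))^-1) 1 (fun n => a n * lam ^+ 2 / 2).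
Proof.
have j := jetSqrt r_gt0 r_cvg0 ltr01 jp.
have s0 : Num.sqrt (1 : R) != 0 by rewrite sqrtr1 oner_neq0.
apply: jet_near (jetV r_gt0 r_cvg0 s0 j); rewrite ?sqrtr1 ?invr1//; apply: nearW => // n.
by field.
Qed.

Let N n := (X - Y) * (u n)^-1 + 2 * (lamn n * lamn n).

(** The scaled tangent of the crossing ray. The numerator of that tangent is a_n * N n, and 1 -
    rho_n^2 = a_n (2 lambda_n)^2 p n; after division by sqrt (2 q) the factor a_n cancels and the
    limit z is finite. *)
Let jT : jet r (fun n => N n * (lamn n)^-1 * (Num.sqrt (u n) * (Num.sqrt (p n))^-1) / (2 * S)) z
  (fun n => ((X - Y) * a n * X / (2 * lam) + 2 * (c n * gam)
     - ((X - Y) + 2 * lam ^+ 2) / (2 * lam ^+ 2) * (c n * gam)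
     + ((X - Y) + 2 * lam ^+ 2) / (2 * lam) * (a n * (lam ^+ 2 - X) / 2)) / S).
Proof.
have l0 : lam != 0 by rewrite gt_eqF.
have s0 : S != 0 by rewrite gt_eqF.
have jN := jetD (jetMn (X - Y) juV) (jetMn 2 jl2).
have jlV := jetV r_gt0 r_cvg0 l0 lam_jet.
have j1 := jetM r_gt0 r_cvg0 jN jlV.
have j2 := jetM r_gt0 r_cvg0 jsu jpV.
have j3 := jetMn (2 * S)^-1 (jetM r_gt0 r_cvg0 j1 j2).
apply: jet_near j3.
- by apply: nearW => n; rewrite mulrC.
- by rewrite /z /crossing_slope -/S; field; rewrite l0 s0.
- by apply: nearW => n; field; rewrite l0 s0.
Qed.

Definition crossing_point n := arcinv (q n)
  (crossing_tan (a n * X) (a n * Y) (1 - 2 * a n * (lamn n) ^+ 2) / Num.sqrt (2 * q n)).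

(** The first-order part is split so that its first summand is the bracket in the theorem and its
    second, multiplied by the weight (1 - z^2)^alpha, is a_n X times the boundary term in [J1E]. *)
Lemma crossing_point_jet : jet r crossing_point z
  (fun n => slope_increment lam gam (a n) (c n) X Y / S - a n * X * z * (1 / 2 - 3 / 4 * z ^+ 2)).
Proof.
have l0 : lam != 0 by rewrite gt_eqF.
have s0 : S != 0 by rewrite gt_eqF.
have XE : X = S ^+ 2 / 2 by rewrite S_sqr; field.
have jq : jet r q 0 (fun n => a n * X).
  apply: jet_near (jetM r_gt0 r_cvg0 (jetMn X ja) juV).
  - by apply: nearW => n; rewrite /q [a n * X]mulrC.
  - by rewrite mulr0 mul0r.
  - by apply: nearW => n; ring.
pose Tn n := N n * (lamn n)^-1 * (Num.sqrt (u n) * (Num.sqrt (p n))^-1) / (2 * S).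
(* [arcinv] multiplies the scaled tangent by sqrt (2 / (1 + sqrt (1 + 2 q Tn^2))), which is 1 - a_n
   X z^2 / 4 + o(r). *)
have jT2 := jetM r_gt0 r_cvg0 (jetMn 2 jq) (jetM r_gt0 r_cvg0 jT jT).
have jS2 : jet r (fun n => 1 + 2 * q n * (Tn n * Tn n)) 1 (fun n => 2 * a n * X * z ^+ 2).
  apply: jet_near (jetD (jetC r_gt0 1) jT2); [exact: nearW| |apply: nearW => n].
    by rewrite mulr0 mul0r addr0.
  by rewrite mulr0 mul0r addr0 add0r; ring.
have jS := jetSqrt r_gt0 r_cvg0 ltr01 jS2.
have jB : jet r (fun n => 1 + Num.sqrt (1 + 2 * q n * (Tn n * Tn n))) 2 (fun n => a n * X * z ^+ 2).
  apply: jet_near (jetD (jetC r_gt0 1) jS); [exact: nearW|by rewrite sqrtr1|apply: nearW => n].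
  by rewrite sqrtr1; field.
have two0 : (2 : R) != 0 by rewrite pnatr_eq0.
have jC : jet r (fun n => 2 / (1 + Num.sqrt (1 + 2 * q n * (Tn n * Tn n)))) 1
    (fun n => - (a n * X * z ^+ 2) / 2).
  apply: jet_near (jetMn 2 (jetV r_gt0 r_cvg0 two0 jB)); [exact: nearW|by field|].
  by apply: nearW => n; field.
have jD := jetSqrt r_gt0 r_cvg0 ltr01 jC.
have jE := jetM r_gt0 r_cvg0 jT jD.
apply: jet_near jE.
- have l_gt0 : \forall n \near \oo, 0 < lamn n.
    by apply: (cvgr_gt _ (jet_cvg r_gt0 r_cvg0 lam_jet)).
  have u_gt0 : \forall n \near \oo, 0 < u n.
    by apply: (cvgr_gt _ (jet_cvg r_gt0 r_cvg0 ju)).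
  have p_gt0 : \forall n \near \oo, 0 < p n.
    by apply: (cvgr_gt _ (jet_cvg r_gt0 r_cvg0 jp)).
  near=> n.
  have an : 0 < a n by near: n.
  have ln : 0 < lamn n by near: n.
  have un : 0 < u n by near: n.
  have pn : 0 < p n by near: n.
  rewrite /crossing_point /arcinv.
  have -> : crossing_tan (a n * X) (a n * Y) (1 - 2 * a n * lamn n ^+ 2) / Num.sqrt (2 * q n) = Tn n.
    rewrite /crossing_tan -/(u n).
    have -> : 1 - (1 - 2 * a n * lamn n ^+ 2) ^+ 2 = a n * (2 * lamn n) ^+ 2 * p n.
      by rewrite /p; ring.
    have -> : 2 * q n = a n * (2 * X) * (u n)^-1 by rewrite /q; ring.
    have e1 : Num.sqrt (a n * (2 * lamn n) ^+ 2 * p n) = Num.sqrt (a n) * (2 * lamn n) * Num.sqrt (p n).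
      have a1 : 0 <= a n * (2 * lamn n) ^+ 2 by rewrite mulr_ge0 ?sqr_ge0// ltW.
      rewrite (sqrtrM _ a1) (sqrtrM _ (ltW an)) sqrtr_sqr ger0_norm// mulr_ge0//.
      exact: ltW.
    have e2 : Num.sqrt (a n * (2 * X) * (u n)^-1) = Num.sqrt (a n) * S * (Num.sqrt (u n))^-1.
      have a1 : 0 <= a n * (2 * X) by rewrite !mulr_ge0// ltW.
      by rewrite (sqrtrM _ a1) (sqrtrM _ (ltW an)) sqrtrV// ltW.
    rewrite e1 e2.
    have su : Num.sqrt (u n) != 0 by rewrite gt_eqF ?sqrtr_gt0.
    have sp : Num.sqrt (p n) != 0 by rewrite gt_eqF ?sqrtr_gt0.
    have sa : Num.sqrt (a n) != 0 by rewrite gt_eqF ?sqrtr_gt0.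
    have aE : a n = Num.sqrt (a n) ^+ 2 by rewrite sqr_sqrtr ?ltW.
    have -> : (1 - a n * Y) / u n - (1 - 2 * a n * lamn n ^+ 2) = a n * N n.
      by rewrite /N /u; field; rewrite gt_eqF.
    rewrite {1}aE /Tn; field.
    by rewrite su sp sa s0 gt_eqF.
  by rewrite expr2.
- by rewrite sqrtr1 mulr1.
- apply: nearW => n; rewrite sqrtr1 /slope_increment /z /crossing_slope -/S XE; field.
  by rewrite l0 s0.
Unshelve. all: by end_near. Qed.

End crossing_jet.

(** * Tail integrals along the scaling sequence *)

Section tail_jets.
Context {R : realType}.
Variables (Phi A : R -> R) (alpha tau : R).
Hypothesis Phi_nd : {homo Phi : v w / v <= w}.
Hypothesis Phi_ge0 : forall w, 0 <= Phi w.
Hypothesis Phi_gt0 : forall w, 0 < w -> 0 < Phi w.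
Hypothesis alpha_gt0 : 0 < alpha.
Hypothesis tau_le0 : tau <= 0.
Hypothesis PhiA : twoRV (fun t => Phi t^-1) alpha tau A.
Variables (r a : nat -> R).
Hypothesis r_gt0 : \forall n \near \oo, 0 < r n.
Hypothesis r_cvg0 : r n @[n --> \oo] --> 0.
Hypothesis a_gt0 : \forall n \near \oo, 0 < a n.
Hypothesis a_bigo : bigo r a.
Hypothesis A_bigo : bigo r (fun n => A (a n)^-1).

Let aV_cvg : (a n)^-1 @[n --> \oo] --> +oo%R.
Proof.
apply/gtr0_cvgV0; first by apply: filterS a_gt0 => n ?; rewrite invr_gt0.
apply: near_eq_cvgR (bigo_cvg0 r_gt0 r_cvg0 a_bigo); apply: nearW => n.
by rewrite /= invrK.
Qed.

Let A_neq0 : \forall n \near \oo, A (a n)^-1 != 0.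
Proof.
have [[t0 sg] _] := PhiA.
have h : \forall n \near \oo, t0 <= (a n)^-1.
  by move/cvgryPge : aV_cvg; exact.
apply: filterS h => n h.
by case: sg => /(_ _ h) ?; [rewrite gt_eqF|rewrite lt_eqF].
Qed.

Lemma auxiliary_jet X : 0 < X ->
  jet r (fun n => A (a n * X)^-1) 0 (fun n => X `^ (- tau) * A (a n)^-1).
Proof.
move=> X0; have XV : 0 < X^-1 by rewrite invr_gt0.
split; first exact: bigoZ.
have H : A (t * X^-1) / A t @[t --> +oo] --> X^-1 `^ tau.
  apply: (@auxiliary_ratio_cvg R (fun t => Phi t^-1) A alpha tau) => //.
  by move=> t t0; rewrite Phi_gt0// invr_gt0.
have lim : A (a n * X)^-1 / A (a n)^-1 - X `^ (- tau) @[n --> \oo] --> 0.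
  rewrite -[X in _ --> X](subrr (X `^ (- tau))).
  apply: cvgB; last exact: cvg_cst.
  have := cvg_comp _ _ aV_cvg H; rewrite invr_powR//.
  apply: near_eq_cvgR; apply: nearW => n /=.
  by rewrite -invfM.
apply: smallo_near (smallo_cvg0M r_gt0 A_bigo lim).
apply: filterS A_neq0 => n An.
by field.
Qed.

Lemma tail_value_jet X : 0 < X ->
  jet r (fun n => Phi (a n * X) / Phi (a n)) (X `^ alpha)
    (fun n => X `^ alpha * qneg tau X * A (a n)^-1).
Proof.
move=> X0; split; first exact: bigoZ.
have [_ [_ H]] := PhiA.
have XV : 0 < X^-1 by rewrite invr_gt0.
have lim : (Phi (a n * X) / Phi (a n) - X `^ alpha) / A (a n)^-1 - X `^ alpha * qneg tau X
   @[n --> \oo] --> 0.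
  rewrite -[X in _ --> X](subrr (X `^ alpha * qneg tau X)).
  apply: cvgB; last exact: cvg_cst.
  have := cvg_comp _ _ aV_cvg (H X^-1 XV).
  have -> : X^-1 `^ (- alpha) * hpow tau X^-1 = X `^ alpha * qneg tau X.
    by rewrite invr_powR// opprK /hpow /qneg lnV ?posrE// invr_powR.
  apply: near_eq_cvgR; apply: nearW => n /=.
  by rewrite -invfM !invrK invr_powR// opprK.
apply: smallo_near (smallo_cvg0M r_gt0 A_bigo lim).
apply: filterS A_neq0 => n An.
by move: (Phi (a n * X) / Phi (a n)) => rho; field.
Qed.

(** Uniformity of the expansion in z allows inserting s n. [Kap] and [J2] enter with coefficients
    that are O(r), so only their limits K and J survive. *)
Lemma tail_integral_jet X (s : nat -> R) (P K J : R) dP dK dJ : 0 < X ->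
  (\forall n \near \oo, -1 <= s n <= 1) ->
  jet r (fun n => Psi alpha (s n)) P dP ->
  jet r (fun n => Kap alpha (s n)) K dK ->
  jet r (fun n => J2 alpha tau (s n)) J dJ ->
  jet r (fun n => tail_integral Phi (a n * X) (s n) / Phi (a n * X)) P
    (fun n => dP n - 5 / 4 * (a n * X) * K + X `^ (- tau) * A (a n)^-1 * J).
Proof.
move=> X0 s1 jP jK jJ.
have jA := auxiliary_jet X0.
have ja : jet r (fun n => a n * X) 0 (fun n => a n * X).
  by apply: jetO => //; apply: bigo_near (bigoZ r_gt0 X a_bigo); apply: nearW => n; rewrite mulrC.
have jM := jetD (jetD jP (jetM r_gt0 r_cvg0 (jetM r_gt0 r_cvg0 (jetC r_gt0 (- (5 / 4))) ja) jK))
   (jetM r_gt0 r_cvg0 jA jJ).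
have so : smallo r (fun n => tail_integral Phi (a n * X) (s n) / Phi (a n * X) -
     (Psi alpha (s n) - 5 / 4 * (a n * X) * Kap alpha (s n) + A (a n * X)^-1 * J2 alpha tau (s n))).
  move=> eps e0.
  have [C1 C10 h1] := ja.1.
  have [C2 C20 h2] : bigo r (fun n => A (a n * X)^-1).
    by apply: bigo_near (jet_bigo jA); apply: nearW => n; rewrite subr0.
  have C0 : 0 < C1 + C2 by exact: addr_gt0.
  have [d /andP[d0 _] H] := tail_integral_expansion Phi_nd Phi_ge0 Phi_gt0 alpha_gt0 tau_le0 PhiA
    (divr_gt0 e0 C0).
  have hd : \forall n \near \oo, a n * X < d.
    by apply: (cvgr_lt _ (jet_cvg r_gt0 r_cvg0 ja)).
  near=> n.
  have an : 0 < a n by near: n.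
  have sn : -1 <= s n <= 1 by near: n.
  apply: le_trans (H (a n * X) (s n) _ sn) _.
    by rewrite mulr_gt0//=; near: n.
  have -> : eps * r n = eps / (C1 + C2) * ((C1 + C2) * r n) by field; rewrite gt_eqF.
  rewrite ler_wpM2l ?(ltW (divr_gt0 e0 C0))// mulrDl lerD//.
    by apply: le_trans (ler_norm _) _; near: n.
  by near: n.
split.
  apply: bigo_near jM.1; apply: nearW => n /=.
  by rewrite !mul0r !mulr0; ring.
apply: smallo_near (smalloD so jM.2); apply: nearW => n /=.
by ring.
Unshelve. all: by end_near. Qed.

Lemma is_derive_J2 (z : R) : -1 < z < 1 ->
  is_derive z 1 (J2 alpha tau) ((1 - z ^+ 2) `^ alpha * qneg tau (1 - z ^+ 2)).
Proof.
move=> zI; have /andP[z1 z2] := zI.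
have iJ := J2_integrable Phi_nd Phi_gt0 alpha_gt0 tau_le0 PhiA (lexx 1).
apply: (derive_Rint z1 z2 iJ).
have dp := is_derive_onem_sqr_powR alpha zI.
have dh : is_derive z 1 (fun s : R => 1 - s ^+ 2) (- (2 * z)).
  by derive_by; rewrite /= ?expr1; ring.
have h0 := onem_sqr_gt0 zI.
rewrite /qneg; case: (tau =P 0) => _.
  exact: (is_derive_continuous (dervM dp (dervN (dervComp (g := fun s : R => 1 - s ^+ 2) (is_derive1_ln h0) dh)))).
have dq := is_derive_onem_sqr_powR (- tau) zI.
exact: (is_derive_continuous (dervM dp (dervM (dervD dq (dervC z (- 1))) (dervC z tau^-1)))).
Qed.

Lemma tail_integral_jet_interior X (s : nat -> R) (z : R) ds : 0 < X -> -1 < z < 1 -> jet r s z ds ->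
  jet r (fun n => tail_integral Phi (a n * X) (s n) / Phi (a n * X)) (Psi alpha z)
    (fun n => (1 - z ^+ 2) `^ alpha * ds n - 5 / 4 * (a n * X) * Kap alpha z
       + X `^ (- tau) * A (a n)^-1 * J2 alpha tau z).
Proof.
move=> X0 zI js; have /andP[z1 z2] := zI.
have s1 : \forall n \near \oo, -1 <= s n <= 1.
  have scvg := jet_cvg r_gt0 r_cvg0 js.
  have h1 : \forall n \near \oo, -1 < s n by apply: (cvgr_gt _ scvg).
  have h2 : \forall n \near \oo, s n < 1 by apply: (cvgr_lt _ scvg).
  by apply: filterS2 h1 h2 => n /ltW -> /ltW ->.
exact: (tail_integral_jet X0 s1 (jet_comp r_gt0 r_cvg0 (is_derive_Psi alpha_gt0 zI) js)
  (jet_comp r_gt0 r_cvg0 (is_derive_Kap alpha_gt0 zI) js)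
  (jet_comp r_gt0 r_cvg0 (is_derive_J2 zI) js)).
Qed.

(** The derivatives used in the interior do not reach z = 1, but here the argument is constant and
    constant jets replace them. *)
Lemma tail_integral_jet_full :
  jet r (fun n => tail_integral Phi (a n) 1 / Phi (a n)) (c_alpha alpha)
    (fun n => - (5 / 4 * a n * Kap alpha 1) + A (a n)^-1 * J2 alpha tau 1).
Proof.
have s1 : \forall n \near \oo, -1 <= (fun=> 1 : R) n <= 1 by apply: nearW => n; rewrite lexx andbT; lra.
have j := tail_integral_jet ltr01 s1 (jetC r_gt0 (Psi alpha 1)) (jetC r_gt0 (Kap alpha 1))
  (jetC r_gt0 (J2 alpha tau 1)).
apply: jet_near j.
- by apply: nearW => n; rewrite mulr1.
- by rewrite c_alphaE.
- by apply: nearW => n; rewrite powR1; ring.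
Qed.

End tail_jets.

(** * Powers and maxima of independent vectors *)

Lemma ln_onem_bound (R : realType) (p : R) : 0 <= p <= 1 / 2 ->
  `|ln (1 - p) + p + p ^+ 2 / 2| <= 2 * p ^+ 3.
Proof.
move=> /andP[]; rewrite le_eqVlt => /orP[/eqP <- _|p0 p1].
  by rewrite subr0 ln1 !expr0n/= mul0r !addr0 normr0 mulr0.
pose k (t : R) := ln (1 - t) + t + t ^+ 2 / 2.
have dk t : 0 <= t <= p -> is_derive t 1 k (- (1 - t)^-1 + 1 + t).
  move=> /andP[t0 t1]; have h : 0 < 1 - t by lra.
  have d1 : is_derive t 1 (fun s : R => 1 - s) (- 1) by derive_by; rewrite /=; ring.
  have d2 := dervComp (g := fun s : R => 1 - s) (is_derive1_ln h) d1.
  have d3 := dervM (dervX 2 (dervI t)) (dervC t (2^-1)).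
  apply: (is_derive_eq (dervD (dervD d2 (dervI t)) d3)).
  by rewrite /= ?expr1; field; rewrite gt_eqF.
have cont : {within `[0, p], continuous k}.
  apply: continuous_in_subspaceT => t; rewrite inE/= in_itv/= => tI.
  exact: (is_derive_continuous (dk t tI)).
have [t tI kE] := @MVT R k (fun t => - (1 - t)^-1 + 1 + t) 0 p p0
  (fun t tI => dk t (subset_itv_oo_cc tI)) cont.
move: kE; rewrite {2}/k subr0 ln1 expr0n/= mul0r !addr0 !subr0 => kE.
rewrite -/(k p) kE normrM (ger0_norm (ltW p0)).
move: tI; rewrite in_itv/= => /andP[t0 tp].
have -> : - (1 - t)^-1 + 1 + t = - (t ^+ 2 / (1 - t)) by field; rewrite subr_eq0 gt_eqF//; lra.
have t1 : 0 < 1 - t by lra.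
rewrite normrN ger0_norm ?divr_ge0 ?sqr_ge0 ?(ltW t1)//.
have h : t ^+ 2 / (1 - t) <= 2 * p ^+ 2 by rewrite ler_pdivrMr//; nra.
have -> : 2 * p ^+ 3 = 2 * p ^+ 2 * p by ring.
by rewrite ler_wpM2r// ltW.
Qed.

Lemma power_jet (R : realType) (r B dB : nat -> R) (L : R) :
  (\forall n \near \oo, 0 < r n) -> r n @[n --> \oo] --> 0 ->
  bigo r (fun n => n%:R^-1) -> (\forall n \near \oo, 0 <= B n) -> jet r B L dB ->
  jet r (fun n => (1 - B n / n%:R) ^+ n) (expR (- L))
    (fun n => expR (- L) * (- dB n - L ^+ 2 / 2 * n%:R^-1)).
Proof.
move=> r0 rcvg nO B0 jB.
have jn : jet r (fun n => n%:R^-1) 0 (fun n => n%:R^-1) by exact: jetO.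
have Bcvg := jet_cvg r0 rcvg jB.
have jBn := jetM r0 rcvg jB jn.
have pcvg : B n / n%:R @[n --> \oo] --> 0.
  by have := jet_cvg r0 rcvg jBn; rewrite mulr0.
have p2 : \forall n \near \oo, B n / n%:R < 1 / 2 by apply: (cvgr_lt _ pcvg); lra.
have n0 : \forall n \near \oo, (0 < n)%N by exact: nbhs_infty_gt.
have j2 : jet r (fun n => - B n + - (2^-1 * (B n * (B n / n%:R)))) (- L)
    (fun n => - dB n - L ^+ 2 / 2 * n%:R^-1).
  apply: jet_near (jetD (jetN r0 jB) (jetN r0 (jetM r0 rcvg (jetC r0 (2^-1)) (jetM r0 rcvg jB jBn)))).
  - by apply: nearW => n.
  - by rewrite !mulr0 oppr0 addr0.
  - by apply: nearW => n; move: (n%:R^-1) => u; field.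
have jl : jet r (fun n => n%:R * ln (1 - B n / n%:R)) (- L) (fun n => - dB n - L ^+ 2 / 2 * n%:R^-1).
  have [h1 h2] := j2; split => //.
  have so : smallo r (fun n => n%:R * (ln (1 - B n / n%:R) + B n / n%:R + (B n / n%:R) ^+ 2 / 2)).
    (* After multiplication by n the cubic bound on the logarithm leaves 2 B^3 / n^2, which is 1/n
       times a null sequence. *)
    have lim : 2 * (B n * B n * B n * n%:R^-1) @[n --> \oo] --> 0.
      have := jet_cvg r0 rcvg (jetM r0 rcvg (jetC r0 2) (jetM r0 rcvg (jetM r0 rcvg (jetM r0 rcvg jB jB) jB) jn)).
      by rewrite !mulr0.
    have so2 := smallo_cvg0M r0 nO lim.
    move=> eps e0; near=> n.
    have nn : (0 < n)%N by near: n.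
    have nR : 0 < n%:R :> R by rewrite ltr0n.
    have Bn : 0 <= B n by near: n.
    have pn : 0 <= B n / n%:R <= 1 / 2.
      by rewrite divr_ge0 ?ler0n//= ltW//; near: n.
    have h : `|n%:R^-1 * (2 * (B n * B n * B n * n%:R^-1))| <= eps * r n by near: n; exact: so2.
    apply: le_trans h; rewrite normrM (ger0_norm (ltW nR)).
    apply: le_trans (ler_wpM2l (ltW nR) (ln_onem_bound pn)) _.
    rewrite ger0_norm; last by rewrite !mulr_ge0// ?invr_ge0 ?ler0n.
    rewrite le_eqVlt; apply/orP; left; apply/eqP; field.
    by rewrite gt_eqF.
  apply: smallo_near (smalloD so h2); near=> n.
  have nR : n%:R != 0 :> R by rewrite pnatr_eq0 -lt0n; near: n.
  by field.
apply: jet_near (jet_comp r0 rcvg (is_derive_expR (- L)) jl) => //; last exact: nearW.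
near=> n.
have nR : 0 < n%:R :> R by rewrite ltr0n; near: n.
rewrite expRM_natl lnK// posrE subr_gt0.
by apply: (@lt_trans _ _ (1 / 2)); [near: n|lra].
Unshelve. all: by end_near. Qed.

Lemma maxn_seq_le (R : realType) (f : nat -> R) n u : (0 < n)%N ->
  maxn_seq f n <= u <-> forall i, (i < n)%N -> f i <= u.
Proof.
move=> n0; rewrite /maxn_seq; split.
  move=> /bigmax_leP[_ h] i lin; exact: (h (Ordinal lin)).
by move=> h; apply/bigmax_leP; split => [|i _]; apply: h.
Qed.

Section maxima.
Context {R : realType} {d1 : measure_display} {T1 : measurableType d1} (P1 : probability T1 R).
Variables (S1 S2 : T1 -> R).
Hypotheses (mS1 : measurable_fun setT S1) (mS2 : measurable_fun setT S2).
Context {d2 : measure_display} {T2 : measurableType d2} (P2 : probability T2 R).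
Variables (xi eta : nat -> T2 -> R) (n : nat) (rho wx wy pe : R).
Hypothesis n0 : (0 < n)%N.
Hypothesis hindep : indep_vecs P2 n (fun i w => (xi i w, eta i w)).
Hypothesis hlaw : forall i, (i < n)%N -> forall B : set (R * R), measurable B ->
     P2 ((fun w => (xi i w, eta i w)) @^-1` B)
     = P1 ((fun w => (S1 w, rho * S1 w + Num.sqrt (1 - rho ^+ 2) * S2 w)) @^-1` B).
Hypothesis peE : P1 ((fun w => (S1 w, S2 w)) @^-1` exceedance wx wy rho) = pe%:E.

Lemma max_probability :
  P2 [set w | maxn_seq (fun i => xi i w) n <= 1 - wx /\ maxn_seq (fun i => eta i w) n <= 1 - wy]
  = ((1 - pe) ^+ n)%:E.
Proof.
pose B : set (R * R) := [set z | z.1 <= 1 - wx] `&` [set z | z.2 <= 1 - wy].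
have mB : measurable B.
  have m1 : measurable_fun setT (fun z : R * R => z.1) by exact: measurable_fst.
  have m2 : measurable_fun setT (fun z : R * R => z.2) by exact: measurable_snd.
  apply: measurableI.
  - rewrite [X in measurable X](_ : _ = setT `&` (fun z : R * R => z.1) @^-1` `]-oo, 1 - wx]); first exact: m1.
    by apply/seteqP; split => z /=; rewrite in_itv/=; tauto.
  - rewrite [X in measurable X](_ : _ = setT `&` (fun z : R * R => z.2) @^-1` `]-oo, 1 - wy]); first exact: m2.
    by apply/seteqP; split => z /=; rewrite in_itv/=; tauto.
have -> : [set w | maxn_seq (fun i => xi i w) n <= 1 - wx /\ maxn_seq (fun i => eta i w) n <= 1 - wy] =
   \bigcap_(i in [set i | (i < n)%N]) ((fun w => (xi i w, eta i w)) @^-1` B).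
  apply/seteqP; split => w /=.
    by move=> [/(maxn_seq_le _ _ n0) h1 /(maxn_seq_le _ _ n0) h2] i /= lin; split => /=; [exact: h1|exact: h2].
  move=> h; split; apply/(maxn_seq_le _ _ n0) => i lin; by have [h1 h2] := h i lin.
rewrite (hindep (fun=> mB)).
have PB i : (i < n)%N -> P2 ((fun w => (xi i w, eta i w)) @^-1` B) = (1 - pe)%:E.
  move=> lin; rewrite hlaw// EFinB -peE -probability_setC; last first.
    have mS : measurable_fun setT (fun w => (S1 w, S2 w)) by exact: measurable_fun_pair.
    by rewrite -[X in measurable X]setTI; apply: mS => //; exact: measurable_exceedance.
  congr (P1 _); apply/seteqP; split => w /=; rewrite /B /exceedance /=.
    by move=> [h1 h2] []; rewrite ltNge ?h1 ?h2.
  by move=> h; split; rewrite leNgt; apply/negP => h'; apply: h; [left|right].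
rewrite (eq_bigr (fun=> (1 - pe)%:E)); last by move=> i _; exact: PB.
by rewrite big_const_ord; elim: n => [|k IH]; rewrite ?expr0//= IH -EFinM exprS.
Qed.

End maxima.

(** * The exceedance ratio and the scaling sequence *)

Section tail_ratio.
Context {R : realType}.
Variables (Phi A : R -> R) (alpha tau : R).
Hypothesis Phi_nd : {homo Phi : v w / v <= w}.
Hypothesis Phi_ge0 : forall w, 0 <= Phi w.
Hypothesis Phi_gt0 : forall w, 0 < w -> 0 < Phi w.
Hypothesis alpha_gt0 : 0 < alpha.
Hypothesis tau_le0 : tau <= 0.
Hypothesis PhiA : twoRV (fun t => Phi t^-1) alpha tau A.

(** This makes P (S1 > 1 - w) positive for small w, which is what forces a_n to 0. The leading term
    c_alpha dominates the corrections. *)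
Lemma near_tail_integral_gt0 : \forall w \near 0^'+, 0 < tail_integral Phi w 1.
Proof.
have c0 := c_alpha_gt0 alpha_gt0.
(* The summand 1 pays for the error w + |A| of the expansion taken with e = 1; all corrections
   together are at most 2 C times the larger of w and |A|. *)
set C := `|5 / 4 * Kap alpha 1| + `|J2 alpha tau 1| + 1.
have C0 : 0 < C by rewrite ltr_wpDl ?addr_ge0.
have [d /andP[d0 _] H] := tail_integral_expansion Phi_nd Phi_ge0 Phi_gt0 alpha_gt0 tau_le0 PhiA ltr01.
have wV : w^-1 @[w --> (0:R)^'+] --> +oo%R.
  apply/gtr0_cvgV0; first by near=> w; rewrite invr_gt0; near: w; exact: nbhs_right_gt.
  apply: near_eq_cvgR (cvg_at_right_filter (@cvg_id _ (nbhs (0 : R)))); apply: nearW => w.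
  by rewrite /= invrK.
have A0 : A w^-1 @[w --> (0:R)^'+] --> 0 by apply: cvg_comp wV _; have [_ []] := PhiA.
have e0 : 0 < c_alpha alpha / (2 * C) by rewrite divr_gt0// mulr_gt0.
have hA : \forall w \near (0:R)^'+, `|A w^-1| < c_alpha alpha / (2 * C).
  by apply: (cvgr0_norm_lt _ A0).
near=> w.
have w0 : 0 < w by near: w; exact: nbhs_right_gt.
have wd : w < d by near: w; exact: nbhs_right_lt.
have w1 : w < c_alpha alpha / (2 * C) by near: w; exact: nbhs_right_lt.
have Aw : `|A w^-1| < c_alpha alpha / (2 * C) by near: w.
have h : -1 <= (1 : R) <= 1 by apply/andP; split => //; lra.
have wI : 0 < w < d by rewrite w0.
have := H w 1 wI h; rewrite -c_alphaE// mul1r ler_norml => /andP[h1 _].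
have Phiw := Phi_gt0 w0.
suff : 0 < tail_integral Phi w 1 / Phi w by rewrite pmulr_lgt0// invr_gt0.
have b1 : `|w * (5 / 4 * Kap alpha 1)| <= w * `|5 / 4 * Kap alpha 1| by rewrite normrM gtr0_norm.
have b2 : `|A w^-1 * J2 alpha tau 1| <= `|A w^-1| * `|J2 alpha tau 1| by rewrite normrM.
have k1 := ler_norm (w * (5 / 4 * Kap alpha 1)).
have k2 := ler_norm (- (A w^-1 * J2 alpha tau 1)).
rewrite normrN in k2.
have m : Num.max w `|A w^-1| * (2 * C) < c_alpha alpha.
  by rewrite -ltr_pdivlMr ?mulr_gt0// gt_max w1 Aw.
have mw : w <= Num.max w `|A w^-1| by rewrite le_max lexx.
have mA : `|A w^-1| <= Num.max w `|A w^-1| by rewrite le_max lexx orbT.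
have p1 := ler_wpM2r (normr_ge0 (5 / 4 * Kap alpha 1)) mw.
have p2 := ler_wpM2r (normr_ge0 (J2 alpha tau 1)) mA.
have mC : Num.max w `|A w^-1| * (2 * C) = 2 * (Num.max w `|A w^-1| * `|5 / 4 * Kap alpha 1|)
   + 2 * (Num.max w `|A w^-1| * `|J2 alpha tau 1|) + 2 * Num.max w `|A w^-1| by rewrite /C; ring.
have q1 : 0 <= Num.max w `|A w^-1| * `|5 / 4 * Kap alpha 1|.
  by apply: le_trans p1; rewrite mulr_ge0// ltW.
have q2 : 0 <= Num.max w `|A w^-1| * `|J2 alpha tau 1| by apply: le_trans p2; rewrite mulr_ge0.
lra.
Unshelve. all: by end_near. Qed.

Variables (r a : nat -> R).
Hypothesis r_gt0 : \forall n \near \oo, 0 < r n.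
Hypothesis r_cvg0 : r n @[n --> \oo] --> 0.
Hypothesis a_gt0 : \forall n \near \oo, 0 < a n.
Hypothesis a_bigo : bigo r a.
Hypothesis A_bigo : bigo r (fun n => A (a n)^-1).

Let a_jet : jet r a 0 a. Proof. exact: jetO. Qed.

Let onem_jet X : jet r (fun n => 1 - a n * X) 1 (fun n => - (a n * X)).
Proof.
apply: jet_near (jetD (jetC r_gt0 1) (jetN r_gt0 (jetM r_gt0 r_cvg0 a_jet (jetC r_gt0 X)))).
- by apply: nearW.
- by rewrite mul0r oppr0 addr0.
- by apply: nearW => n; ring.
Qed.

Let sqrt_ratio_jet X : 0 < X ->
  jet r (fun n => Num.sqrt (X * (1 - a n * 1) / (1 - a n * X))) (Num.sqrt X)
    (fun n => Num.sqrt X * (a n * X - a n) / 2).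
Proof.
move=> X0.
have j := jetM r_gt0 r_cvg0 (jetM r_gt0 r_cvg0 (jetC r_gt0 X) (onem_jet 1))
   (jetV r_gt0 r_cvg0 (oner_neq0 R) (onem_jet X)).
have l0 : 0 < X * 1 / 1 by rewrite mulr1 divr1.
apply: jet_near (jetSqrt r_gt0 r_cvg0 l0 j).
- by apply: nearW.
- by rewrite mulr1 divr1.
- apply: nearW => n; rewrite (_ : X * 1 / 1 = X); last by rewrite mulr1 divr1.
  have s0 : Num.sqrt X != 0 by rewrite gt_eqF ?sqrtr_gt0.
  have XE : X = Num.sqrt X ^+ 2 by rewrite sqr_sqrtr// ltW.
  move: (Num.sqrt X) s0 XE => s s0 ->.
  by field.
Qed.

(** The quotient is factored into a square root, Phi (a X) / Phi a, and the two tail integrals each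
    divided by its own value of [Phi]. The first two factors give X^(alpha + 1/2), and Phi (a n)
    drops out. *)
Lemma tail_ratio_jet X (s : nat -> R) (z : R) ds : 0 < X -> -1 < z < 1 -> jet r s z ds ->
  jet r (fun n => Num.sqrt (2 * (a n * X / (1 - a n * X))) * tail_integral Phi (a n * X) (s n)
     / (Num.sqrt (2 * (a n / (1 - a n))) * tail_integral Phi (a n) 1))
    (X `^ (alpha + 2^-1) * (Psi alpha z / c_alpha alpha))
    (fun n => X `^ (alpha + 2^-1) / c_alpha alpha *
      (((a n * X - a n) / 2 + qneg tau X * A (a n)^-1) * Psi alpha z
       + ((1 - z ^+ 2) `^ alpha * ds n - 5 / 4 * (a n * X) * Kap alpha z
           + X `^ (- tau) * A (a n)^-1 * J2 alpha tau z)
       - Psi alpha z / c_alpha alpha *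
         (- (5 / 4 * a n * Kap alpha 1) + A (a n)^-1 * J2 alpha tau 1))).
Proof.
move=> X0 zI js.
have c0 := c_alpha_gt0 alpha_gt0; have cn0 : c_alpha alpha != 0 by rewrite gt_eqF.
have j1 := sqrt_ratio_jet X0.
have j2 := tail_value_jet PhiA r_gt0 r_cvg0 a_gt0 a_bigo A_bigo X0.
have j3 := tail_integral_jet_interior Phi_nd Phi_ge0 Phi_gt0 alpha_gt0 tau_le0 PhiA r_gt0 r_cvg0 a_gt0
  a_bigo A_bigo X0 zI js.
have j4 := tail_integral_jet_full Phi_nd Phi_ge0 Phi_gt0 alpha_gt0 tau_le0 PhiA r_gt0 r_cvg0 a_gt0
  a_bigo A_bigo.
have powE : X `^ (alpha + 2^-1) = Num.sqrt X * X `^ alpha.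
  rewrite powRD; last by rewrite (gt_eqF X0) implybT.
  by rewrite powR12_sqrt ?(ltW X0)// mulrC.
apply: jet_near (jetM r_gt0 r_cvg0 (jetM r_gt0 r_cvg0 (jetM r_gt0 r_cvg0 j1 j2) j3) (jetV r_gt0 r_cvg0 cn0 j4)).
- have h4 : \forall n \near \oo, 0 < tail_integral Phi (a n) 1 / Phi (a n).
    by apply: (cvgr_gt _ (jet_cvg r_gt0 r_cvg0 j4)).
  have hX : \forall n \near \oo, 0 < 1 - a n * X.
    by apply: (cvgr_gt _ (jet_cvg r_gt0 r_cvg0 (onem_jet X))).
  have h1 : \forall n \near \oo, 0 < 1 - a n * 1.
    by apply: (cvgr_gt _ (jet_cvg r_gt0 r_cvg0 (onem_jet 1))).
  near=> n.
  have an : 0 < a n by near: n.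
  have hn : 0 < tail_integral Phi (a n) 1 / Phi (a n) by near: n.
  have un : 0 < 1 - a n * X by near: n.
  have vn : 0 < 1 - a n by rewrite -[X in _ - X]mulr1; near: n.
  have P1 := Phi_gt0 an; have P2 := Phi_gt0 (mulr_gt0 an X0).
  have I0 : tail_integral Phi (a n) 1 != 0.
    by apply/eqP => h; move: hn; rewrite h mul0r ltxx.
  have q0 : 0 < 2 * (a n / (1 - a n)) by rewrite mulr_gt0// divr_gt0.
  have s0 : Num.sqrt (2 * (a n / (1 - a n))) != 0 by rewrite gt_eqF ?sqrtr_gt0.
  have -> : 2 * (a n * X / (1 - a n * X)) = X * (1 - a n * 1) / (1 - a n * X) * (2 * (a n / (1 - a n))).
    by rewrite mulr1; field; rewrite !gt_eqF.
  have ge : 0 <= X * (1 - a n * 1) / (1 - a n * X).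
    by rewrite mulr1 divr_ge0 ?mulr_ge0// ltW.
  rewrite (sqrtrM _ ge); field.
  by rewrite s0 I0 !gt_eqF.
- by rewrite powE; field.
- by apply: nearW => n; rewrite powE; field.
Unshelve. all: by end_near. Qed.

End tail_ratio.

Section scaling_sequence.
Context {R : realType} {d1 : measure_display} {T1 : measurableType d1} (P1 : probability T1 R).
Variables (S1 S2 Rad Th : T1 -> R).
Hypotheses (mS1 : measurable_fun setT S1) (mS2 : measurable_fun setT S2).
Hypotheses (mRad : measurable_fun setT Rad) (mTh : measurable_fun setT Th).
Hypothesis hsph : forall B : set (R * R), measurable B ->
     P1 ((fun w => (S1 w, S2 w)) @^-1` B)
     = P1 ((fun w => (Rad w * cos (Th w), Rad w * sin (Th w))) @^-1` B).
Hypothesis hunif : forall B : set R, measurable B ->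
     P1 (Th @^-1` B) = (lebesgue_measure (B `&` `[0%R, (2 * pi)%R[) * ((2 * pi)^-1)%R%:E)%E.
Hypothesis hind : forall A B : set R, measurable A -> measurable B ->
     P1 (Rad @^-1` A `&` Th @^-1` B) = (P1 (Rad @^-1` A) * P1 (Th @^-1` B))%E.
Variables F G : R -> R.
Hypothesis hF : forall t, F t = fine (P1 [set w | Num.sqrt (S1 w ^+ 2 + S2 w ^+ 2) <= t]).
Hypothesis hRpos : P1 [set w | 0 < Num.sqrt (S1 w ^+ 2 + S2 w ^+ 2)] = 1%E.
Hypothesis hFend : sup [set t : R | F t < 1] = 1.
Hypothesis hG : forall t, G t = fine (P1 [set w | S1 w <= t]).
Variables (alpha tau : R) (A : R -> R).
Hypotheses (alpha_gt0 : 0 < alpha) (tau_le0 : tau <= 0).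
Hypothesis tailA : twoRV (fun t => tail_of F t^-1) alpha tau A.

(** Fix w < e with P (S1 > 1 - w) > 0. Once 1/n is below this probability the quantile is at least 1
    - w, so a_n <= w < e. Taking w < 1 makes the quantile positive, as [quantile_exceedance]
    requires. *)
Lemma near_a_seq e : 0 < e -> \forall n \near \oo, 0 < a_seq G n < e /\
  P1 [set w | 1 - a_seq G n < S1 w] = (n%:R^-1)%:E.
Proof.
move=> e0; have pi0 := pi_gt0 R.
have nd : {homo tail_of F : v w / v <= w} by move=> v w; exact: (tail_of_nd mS1 mS2 mRad hsph hF).
have ge0 := tail_of_ge0 mS1 mS2 mRad hsph hF.
have gt0 : forall w, 0 < w -> 0 < tail_of F w by move=> w; exact: (tail_of_gt0 mS1 mS2 mRad hsph hF hFend).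
have near_gt0 := near_tail_integral_gt0 nd ge0 gt0 alpha_gt0 tau_le0 tailA.
have [w [w0 we w1 Iw]] : exists w : R, [/\ 0 < w, w < e, w < 1 & 0 < tail_integral (tail_of F) w 1].
  apply: (@filter_ex _ (0 : R)^'+); near=> w; split; near: w => //.
  - exact: nbhs_right_gt.
  - exact: nbhs_right_lt.
  - exact: nbhs_right_lt.
have Gw : G (1 - w) < 1.
  have w01 : 0 < w < 1 by rewrite w0.
  have := marginal_probability mS1 mS2 mRad mTh hsph hunif hind hF hRpos hFend w01.
  rewrite (G_gtE mS1 hG) => -[E]; rewrite -subr_gt0 E divr_gt0 ?mulr_gt0//.
  by rewrite sqrtr_gt0 mulr_gt0// divr_gt0// subr_gt0.
have inv0 : n%:R^-1 @[n --> \oo] --> (0 : R) by apply/gtr0_cvgV0; [exact: nbhs_infty_gtr|exact: cvgr_idn].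
have hn : \forall n \near \oo, n%:R^-1 < 1 - G (1 - w).
  by apply: (cvgr_lt _ inv0); rewrite subr_gt0.
near=> n.
have n2 : (1 < n)%N by near: n; exact: nbhs_infty_gt.
have Gn : G (1 - w) < 1 - n%:R^-1.
  have : n%:R^-1 < 1 - G (1 - w) by near: n.
  lra.
have g0 := quantile_ge mS1 mS2 mRad hsph hF hFend hG n2 Gn.
have g_gt0 : 0 < ginv G (1 - n%:R^-1) by lra.
have [g1 PE] := quantile_exceedance mS1 mS2 mRad mTh hsph hunif hind hF hFend hG n2 g_gt0.
rewrite /a_seq opprB addrCA subrr addr0; split => //.
by rewrite subr_gt0 g1/=; lra.
Unshelve. all: by end_near. Qed.

End scaling_sequence.

(** * Matching the first-order terms *)

Lemma psi_interior (R : realType) (alpha z : R) : -1 < z < 1 ->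
  psi alpha z = Psi alpha z / c_alpha alpha.
Proof.
by move=> /andP[z1 z2]; rewrite /psi ltNge (ltW z1) ltNge (ltW z2) /= mulrC.
Qed.

(** In the terms with a X, half of [Psi] from the square roots, -5/4 [Kap] from the arc density and
    the boundary term from the crossing point add up to [J1] at z. In those with a alone the same
    combination appears at 1, where the boundary term vanishes, and gives [I1]. The terms with Aa
    match one by one. *)
Lemma rate_identity (R : realType) (alpha tau a Aa X z W D s : R) :
  0 < alpha -> tau <= 0 -> -1 < z < 1 -> s != 0 ->
  - (W / c_alpha alpha *
      (((a * X - a) / 2 + qneg tau X * Aa) * Psi alpha z
       + ((1 - z ^+ 2) `^ alpha * (D / s - a * X * z * (1 / 2 - 3 / 4 * z ^+ 2))
           - 5 / 4 * (a * X) * Kap alpha z + X `^ (- tau) * Aa * J2 alpha tau z)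
       - Psi alpha z / c_alpha alpha * (- (5 / 4 * a * Kap alpha 1) + Aa * J2 alpha tau 1)))
  = W * (- (a * X) / c_alpha alpha * J1 alpha z - Aa * X `^ (- tau) / c_alpha alpha * J2 alpha tau z
     + psi alpha z * (- Aa * qneg tau X + a / c_alpha alpha * I1 alpha + Aa / c_alpha alpha * I2 alpha tau)
     - (1 - z ^+ 2) `^ alpha / (c_alpha alpha * s) * D).
Proof.
move=> alpha0 tau0 zI s0; have /andP[z1 z2] := zI.
have c0 : c_alpha alpha != 0 by rewrite gt_eqF ?c_alpha_gt0.
rewrite (psi_interior _ zI) I2E// /I1 !J1E ?z1 ?(ltW z2)// ?lexx ?andbT; last by lra.
rewrite -c_alphaE// expr1n subrr powR0 ?gt_eqF// !mul0r subr0.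
by field; rewrite c0 s0.
Qed.

(** The hypothesis is (lam + (X - Y) / (2 lam))^2 < 2 X, expanded; it is symmetric in X and Y and so
    serves both slopes. *)
Lemma crossing_slope_itv (R : realType) (lam X Y : R) : 0 < lam -> 0 < X ->
  lam ^+ 2 - X - Y + (X - Y) ^+ 2 / (4 * lam ^+ 2) < 0 ->
  -1 < crossing_slope lam X Y < 1.
Proof.
move=> l0 X0 h; rewrite /crossing_slope.
have S0 : 0 < Num.sqrt (2 * X) by rewrite sqrtr_gt0 mulr_gt0.
have S2 : Num.sqrt (2 * X) ^+ 2 = 2 * X by rewrite sqr_sqrtr// mulr_ge0// ltW.
have t2 : (lam + (X - Y) / (2 * lam)) ^+ 2 < Num.sqrt (2 * X) ^+ 2.
  rewrite S2 -subr_lt0; apply: le_lt_trans h.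
  rewrite le_eqVlt; apply/orP; left; apply/eqP; field; rewrite gt_eqF//.
move: (lam + (X - Y) / (2 * lam)) (Num.sqrt (2 * X)) S0 t2 => t S S0 t2.
by rewrite ltr_pdivlMr// ltr_pdivrMr// mulN1r mul1r; apply/andP; split; nra.
Qed.

Lemma QnE (R : realType) (alpha tau lam gam a Aa c X Y : R) :
  0 < lam -> 0 < X -> 0 < Y ->
  let side U V := U `^ (alpha + 2^-1) *
    (- (a * U) / c_alpha alpha * J1 alpha (crossing_slope lam U V)
     - Aa * U `^ (- tau) / c_alpha alpha * J2 alpha tau (crossing_slope lam U V)
     + psi alpha (crossing_slope lam U V) *
       (- Aa * qneg tau U + a / c_alpha alpha * I1 alpha + Aa / c_alpha alpha * I2 alpha tau)
     - (1 - crossing_slope lam U V ^+ 2) `^ alpha / (c_alpha alpha * Num.sqrt (2 * U)) *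
       slope_increment lam gam a c U V) in
  Qn alpha tau lam gam a Aa c (- X) (- Y) = side X Y + side Y X.
Proof.
move=> l0 X0 Y0 side.
have zxE : zx lam (- X) (- Y) = crossing_slope lam X Y.
  by rewrite /zx normrN gtr0_norm// opprK [- Y + X]addrC.
have zyE : zy lam (- X) (- Y) = crossing_slope lam Y X.
  by rewrite /zy normrN gtr0_norm// opprK [- X + Y]addrC.
have l1 : lam != 0 by rewrite gt_eqF.
rewrite /Qn zxE zyE !normrN !gtr0_norm// /side.
congr (_ * (_ - _ * _) + _ * (_ - _ * _)); rewrite /slope_increment; by field.
Qed.

Theorem theorem1 (R : realType)
  (* the spherical vector (S1,S2), with radius Rad and angle Th, on (T1,P1) *)
  (d1 : measure_display) (T1 : measurableType d1) (P1 : probability T1 R)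
  (S1 S2 Rad Th : T1 -> R)
  (mS1 : measurable_fun setT S1) (mS2 : measurable_fun setT S2)
  (mRad : measurable_fun setT Rad) (mTh : measurable_fun setT Th)
  (hsph : forall B : set (R * R), measurable B ->
     P1 ((fun w => (S1 w, S2 w)) @^-1` B)
     = P1 ((fun w => (Rad w * cos (Th w), Rad w * sin (Th w))) @^-1` B))
  (hunif : forall B : set R, measurable B ->
     P1 (Th @^-1` B) = (lebesgue_measure (B `&` `[0%R, (2 * pi)%R[) * ((2 * pi)^-1)%R%:E)%E)
  (hind : forall A B : set R, measurable A -> measurable B ->
     P1 (Rad @^-1` A `&` Th @^-1` B) = (P1 (Rad @^-1` A) * P1 (Th @^-1` B))%E)
  (F G : R -> R)
  (hF : forall t, F t = fine (P1 [set w | Num.sqrt (S1 w ^+ 2 + S2 w ^+ 2) <= t]))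
  (hRpos : P1 [set w | 0 < Num.sqrt (S1 w ^+ 2 + S2 w ^+ 2)] = 1%E)
  (hFend : sup [set t : R | F t < 1] = 1)
  (hG : forall t, G t = fine (P1 [set w | S1 w <= t]))
  (* the triangular array on (T2,P2) *)
  (rho : nat -> R) (hrho : forall n, 0 < rho n < 1)
  (d2 : measure_display) (T2 : measurableType d2) (P2 : probability T2 R)
  (xi eta : nat -> nat -> T2 -> R)
  (mxi : forall n i, measurable_fun setT (xi n i))
  (meta : forall n i, measurable_fun setT (eta n i))
  (hindep : forall n, indep_vecs P2 n (fun i w => (xi n i w, eta n i w)))
  (hlaw : forall n i, (i < n)%N -> forall B : set (R * R), measurable B ->
     P2 ((fun w => (xi n i w, eta n i w)) @^-1` B)
     = P1 ((fun w => (S1 w, rho n * S1 w + Num.sqrt (1 - rho n ^+ 2) * S2 w)) @^-1` B))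
  (* second-order regular variation *)
  (alpha tau : R) (A : R -> R) (halpha : 0 < alpha) (htau : tau <= 0)
  (h2RV : twoRV (fun t => 1 - F (1 - t^-1)) alpha tau A)
  (lam : R) (hlam : 0 < lam)
  (c : nat -> R) (hc0 : c n @[n --> \oo] --> 0) (hcnz : forall n, c n != 0)
  (gam : R)
  (hgam : ((Num.sqrt ((1 - rho n) / (2 * a_seq G n)) - lam) / c n) @[n --> \oo] --> gam)
  (x y : R) (hx : x < 0) (hy : y < 0)
  (hxy : lam ^+ 2 + x + y + (x - y) ^+ 2 / (4 * lam ^+ 2) < 0) :
  let an := a_seq G in
  let Pn := fun n : nat => fine (P2 [set w |
              maxn_seq (fun i => xi n i w) n <= 1 + an n * x /\
              maxn_seq (fun i => eta n i w) n <= 1 + an n * y]) in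
  let Hxy := H alpha lam x y in
  let rn := fun n : nat => an n + `|c n| + `|A (an n)^-1| + n%:R^-1 in
  exists e : nat -> R,
    (e n / rn n) @[n --> \oo] --> 0 /\
    forall n : nat, (0 < n)%N ->
      Pn n - Hxy = Hxy * (- 2^-1 * n%:R^-1 *
          (`|x| `^ (alpha + 2^-1) * psi alpha (zx lam x y)
           + `|y| `^ (alpha + 2^-1) * psi alpha (zy lam x y)) ^+ 2
        + Qn alpha tau lam gam (an n) (A (an n)^-1) (c n) x y + e n).
Proof.
move=> an Pn Hxy rn.
pose X := - x; pose Y := - y.
have X0 : 0 < X by rewrite oppr_gt0.
have Y0 : 0 < Y by rewrite oppr_gt0.
have xE : `|x| = X by rewrite ltr0_norm.
have yE : `|y| = Y by rewrite ltr0_norm.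
pose Phi := tail_of F.
have nd : {homo Phi : v w / v <= w} by move=> v w; exact: (tail_of_nd mS1 mS2 mRad hsph hF).
have ge0 := tail_of_ge0 mS1 mS2 mRad hsph hF.
have gt0 : forall w, 0 < w -> 0 < Phi w by move=> w; exact: (tail_of_gt0 mS1 mS2 mRad hsph hF hFend).
have a_near := near_a_seq mS1 mS2 mRad mTh hsph hunif hind hF hRpos hFend hG halpha htau h2RV.
have a_gt0 : \forall n \near \oo, 0 < an n.
  by apply: filterS (a_near 1 ltr01) => n [/andP[]].
have a_cvg0 : an n @[n --> \oo] --> 0.
  apply/cvgr0Pnorm_lt => e e0; apply: filterS (a_near e e0) => n [/andP[h1 h2] _].
  by rewrite gtr0_norm.
have aV_cvg : (an n)^-1 @[n --> \oo] --> +oo%R.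
  apply/gtr0_cvgV0; first by apply: filterS a_gt0 => n ?; rewrite invr_gt0.
  by apply: near_eq_cvgR a_cvg0; apply: nearW => n; rewrite /= invrK.
have A_cvg0 : A (an n)^-1 @[n --> \oo] --> 0 by apply: cvg_comp aV_cvg _; have [_ []] := h2RV.
have n_cvg0 : n%:R^-1 @[n --> \oo] --> (0 : R).
  by apply/gtr0_cvgV0; [exact: nbhs_infty_gtr|exact: cvgr_idn].
have rn_cvg0 : rn n @[n --> \oo] --> 0.
  have -> : (0 : R) = 0 + `|0 : R| + `|0 : R| + 0 by rewrite normr0 !addr0.
  exact: (cvgD (cvgD (cvgD a_cvg0 (cvg_norm hc0)) (cvg_norm A_cvg0)) n_cvg0).
have rn_ge : \forall n \near \oo,
    [/\ 0 < rn n, an n <= rn n, `|c n| <= rn n, `|A (an n)^-1| <= rn n & n%:R^-1 <= rn n].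
  apply: filterS a_gt0 => n an0.
  have h1 := normr_ge0 (c n); have h2 := normr_ge0 (A (an n)^-1).
  have h3 : 0 <= n%:R^-1 :> R by rewrite invr_ge0.
  by rewrite /rn; split; lra.
have rn_gt0 : \forall n \near \oo, 0 < rn n by apply: filterS rn_ge => n [].
have a_O : bigo rn an.
  by exists 1 => //; apply: filterS2 a_gt0 rn_ge => n h [_ h1 _ _ _]; rewrite mul1r gtr0_norm.
have c_O : bigo rn c.
  by exists 1 => //; apply: filterS rn_ge => n [_ _ h1 _ _]; rewrite mul1r.
have A_O : bigo rn (fun n => A (an n)^-1).
  by exists 1 => //; apply: filterS rn_ge => n [_ _ _ h1 _]; rewrite mul1r.
have n_O : bigo rn (fun n => n%:R^-1).
  exists 1 => //; apply: filterS rn_ge => n [_ _ _ _ h1].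
  by rewrite mul1r ger0_norm// invr_ge0.
pose lamn n := Num.sqrt ((1 - rho n) / (2 * an n)).
have lam_jet : jet rn lamn lam (fun n => c n * gam).
  split.
    by apply: bigo_near (bigoZ rn_gt0 gam c_O); apply: nearW => n; rewrite mulrC.
  have lim : (lamn n - lam) / c n - gam @[n --> \oo] --> 0.
    rewrite -[X in _ --> X](subrr gam).
    by apply: cvgB; [exact: hgam|exact: cvg_cst].
  apply: smallo_near (smallo_cvg0M rn_gt0 c_O lim).
  apply: nearW => n; have cn := hcnz n.
  by field.
(* The square root defining lambda_n can be undone because rho_n < 1 and a_n > 0. *)
have rhoE : \forall n \near \oo, rho n = 1 - 2 * an n * lamn n ^+ 2.
  apply: filterS a_gt0 => n an0; have /andP[_ r1] := hrho n.
  rewrite sqr_sqrtr; first by field; rewrite gt_eqF.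
  by rewrite divr_ge0 ?subr_ge0 ?(ltW r1)// mulr_ge0// ltW.
pose zX := crossing_slope lam X Y.
pose zY := crossing_slope lam Y X.
have zXE : zx lam x y = zX by rewrite /zx xE /zX /crossing_slope /X /Y opprK [- x + y]addrC.
have zYE : zy lam x y = zY by rewrite /zy yE /zY /crossing_slope /X /Y opprK [- y + x]addrC.
have zXI : -1 < zX < 1.
  apply: crossing_slope_itv => //; apply: le_lt_trans hxy.
  by rewrite /X /Y !opprK (_ : - x + y = - (x - y)) ?sqrrN//; ring.
have zYI : -1 < zY < 1.
  apply: crossing_slope_itv => //; apply: le_lt_trans hxy.
  by rewrite /X /Y !opprK [- y + x]addrC [_ + y + x]addrAC.
have jsx := crossing_point_jet Y rn_gt0 rn_cvg0 a_gt0 a_O hlam lam_jet X0.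
have jsy := crossing_point_jet X rn_gt0 rn_cvg0 a_gt0 a_O hlam lam_jet Y0.
pose sx := crossing_point an lamn X Y; pose sy := crossing_point an lamn Y X.
have jX := tail_ratio_jet nd ge0 gt0 halpha htau h2RV rn_gt0 rn_cvg0 a_gt0 a_O A_O X0 zXI jsx.
have jY := tail_ratio_jet nd ge0 gt0 halpha htau h2RV rn_gt0 rn_cvg0 a_gt0 a_O A_O Y0 zYI jsy.
pose q w : R := w / (1 - w).
(* Eventually n times the exceedance probability, with 1/n traded for the marginal tail integral in
   the denominators. *)
pose B n := Num.sqrt (2 * q (an n * X)) * tail_integral Phi (an n * X) (sx n)
     / (Num.sqrt (2 * q (an n)) * tail_integral Phi (an n) 1)
   + Num.sqrt (2 * q (an n * Y)) * tail_integral Phi (an n * Y) (sy n)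
     / (Num.sqrt (2 * q (an n)) * tail_integral Phi (an n) 1).
have jB := jetD jX jY.
have s_itv (s : nat -> R) z ds : -1 < z < 1 -> jet rn s z ds -> \forall n \near \oo, -1 <= s n <= 1.
  move=> /andP[z1 z2] /(jet_cvg rn_gt0 rn_cvg0) s_cvg.
  have h1 : \forall n \near \oo, -1 < s n by apply: (cvgr_gt _ s_cvg).
  have h2 : \forall n \near \oo, s n < 1 by apply: (cvgr_lt _ s_cvg).
  by apply: filterS2 h1 h2 => n /ltW -> /ltW ->.
have sxI := s_itv _ _ _ zXI jsx; have syI := s_itv _ _ _ zYI jsy.
have aX_cvg0 V : an n * V @[n --> \oo] --> 0.
  by rewrite -[X in _ --> X](mul0r V); apply: cvgM a_cvg0 _; exact: cvg_cst.
have aX_lt1 V : \forall n \near \oo, an n * V < 1.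
  by apply: (cvgr_lt _ (aX_cvg0 V)).
have PnE : \forall n \near \oo, 0 <= B n /\ (1 - B n / n%:R) ^+ n = Pn n.
  have pi0 := pi_gt0 R.
  have marg_near := a_near 1 ltr01.
  near=> n.
  have n0 : (0 < n)%N by near: n; exact: nbhs_infty_gt.
  have nR : 0 < n%:R :> R by rewrite ltr0n.
  have [/andP[an0 an1] marg] : 0 < an n < 1 /\ P1 [set w | 1 - an n < S1 w] = (n%:R^-1)%:E by near: n.
  have aX1 : an n * X < 1 by near: n; exact: aX_lt1.
  have aY1 : an n * Y < 1 by near: n; exact: aX_lt1.
  have aXI : 0 < an n * X < 1 by rewrite mulr_gt0.
  have aYI : 0 < an n * Y < 1 by rewrite mulr_gt0.
  have rE : rho n = 1 - 2 * an n * lamn n ^+ 2 by near: n.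
  have sX : -1 <= sx n <= 1 by near: n.
  have sY : -1 <= sy n <= 1 by near: n.
  have arcE U V : 0 < an n * U < 1 -> arcmap (q (an n * U)) (crossing_point an lamn U V n)
      = atan (crossing_tan (an n * U) (an n * V) (rho n)).
    move=> /andP[u0 u1]; have q0 : 0 < q (an n * U) by rewrite divr_gt0// subr_gt0.
    rewrite /crossing_point arcmap_arcinv// mulrCA divff ?mulr1 -?rE//.
    by rewrite gt_eqF// sqrtr_gt0 mulr_gt0.
  have joint := exceedance_probability mS1 mS2 mRad mTh hsph hunif hind hF hRpos hFend
    aXI aYI (hrho n) sX sY (arcE X Y aXI) (arcE Y X aYI).
  have anI : 0 < an n < 1 by rewrite an0.
  have := marginal_probability mS1 mS2 mRad mTh hsph hunif hind hF hRpos hFend anI.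
  rewrite marg => -[nE].
  set D := Num.sqrt (2 * q (an n)) * tail_integral Phi (an n) 1.
  (* The marginal probability is exactly 1/n, which turns the common denominator in [B] into 2 pi /
     n. *)
  have DE : D = 2 * pi / n%:R by rewrite nE; rewrite -/(q (an n)) -/D mulrC divfK// gt_eqF// mulr_gt0.
  have B_E : B n / n%:R = (Num.sqrt (2 * q (an n * X)) * tail_integral Phi (an n * X) (sx n)
     + Num.sqrt (2 * q (an n * Y)) * tail_integral Phi (an n * Y) (sy n)) / (2 * pi).
    by rewrite /B -/D DE -mulrDl invf_div -mulrA mulrAC divff ?mul1r// gt_eqF.
  rewrite -B_E in joint.
  split.
    have : (0 <= P1 ((fun w => (S1 w, S2 w)) @^-1` exceedance (an n * X) (an n * Y) (rho n)))%E.
      exact: measure_ge0.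
    by rewrite joint lee_fin pmulr_lge0// invr_gt0.
  have := max_probability mS1 mS2 n0 (hindep n) (@hlaw n) joint.
  rewrite /Pn (_ : 1 + an n * x = 1 - an n * X); last by rewrite /X mulrN opprK.
  by rewrite (_ : 1 + an n * y = 1 - an n * Y) ?/Y ?mulrN ?opprK// => ->.
have B_ge0 : \forall n \near \oo, 0 <= B n by apply: filterS PnE => n [].
have jP := power_jet rn_gt0 rn_cvg0 n_O B_ge0 jB.
set L := X `^ (alpha + 2^-1) * (Psi alpha zX / c_alpha alpha) +
   Y `^ (alpha + 2^-1) * (Psi alpha zY / c_alpha alpha).
have HxyE : Hxy = expR (- L).
  by rewrite /Hxy /H zXE zYE xE yE !psi_interior// /L opprD -!mulNr.
have H0 : Hxy != 0 by rewrite HxyE gt_eqF ?expR_gt0.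
pose main n := - 2^-1 * n%:R^-1 *
          (`|x| `^ (alpha + 2^-1) * psi alpha (zx lam x y)
           + `|y| `^ (alpha + 2^-1) * psi alpha (zy lam x y)) ^+ 2
        + Qn alpha tau lam gam (an n) (A (an n)^-1) (c n) x y.
(* The error is obtained by solving the claimed identity for it, so the identity holds for every n
   and only the smallness of the error is asymptotic. *)
exists (fun n => (Pn n - Hxy) / Hxy - main n); split; last first.
  by move=> n _; rewrite -/(main n); field.
apply/smallo_cvg => //.
apply: smallo_near (smalloZ rn_gt0 Hxy^-1 jP.2).
apply: filterS PnE => n [_ ->]; rewrite -HxyE.
set dX := (Z in - (Z + _)); set dY := (Z in - (dX + Z)).
have QE : Qn alpha tau lam gam (an n) (A (an n)^-1) (c n) x y = - (dX + dY).
  have := QnE alpha tau gam (an n) (A (an n)^-1) (c n) hlam X0 Y0.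
  rewrite /= !opprK -!rate_identity ?gt_eqF ?sqrtr_gt0 ?mulr_gt0// => ->.
  by rewrite [RHS]opprD.
rewrite /main QE xE yE zXE zYE !psi_interior// -/L; move: n%:R^-1 => u.
by field.
Unshelve. all: by end_near. Qed.
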